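(* Assume the angle between $X$ and $Y$ is $\alpha=\pi/2$ and $\kappa=1$. Then every $g\in SO(3)$ admits an optimal decomposition (for Problem 1) of one of the following forms, where $t_1,t_2,t_3\ge 0$: (1) $R(t_1X)\,R(t_2Y)\,R(-t_3X)$ with $t_1,t_3\le t_2\le\pi$; (2) $R(t_1X)\,R(t_2Y)\,R(-t_2X)\,R(-t_3Y)$ with $t_1,t_3\le t_2\le \pi$; (3) $R(t_1X)\,R\big(t_2\tfrac{X+Y}{2}\big)\,R(t_3X)$ with $t_1,t_3\le\pi$, $t_2\le\sqrt2\,\pi$; (4) $R(t_1X)\,R\big(t_2\tfrac{X+Y}{2}\big)\,R(t_3Y)$ with $t_1,t_3\le\pi$, $t_2\le\sqrt2\,\pi$; or of a form obtained from one of (1)–(4) by applying to the vectors $X,Y$ one of the eight substitutions $(X,Y)\mapsto(\varepsilon X,\varepsilon' Y)$ or $(X,Y)\mapsto(\varepsilon Y,\varepsilon' X)$, $\varepsilon,\varepsilon'\in\{1,-1\}$ (keeping the times and the constraints on them unchanged).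
   Context: Fix unit vectors $X,Y\in\mathbb R^3$ with angle $\alpha\in(0,\pi/2]$ between them and a parameter $\kappa\in[0,1]$. For a unit vector $v$ and $t\in\mathbb R$, $R(tv)\in SO(3)$ denotes rotation by angle $t$ about $v$ (counterclockwise when viewed from the tip of $v$): $R(tv)=\cos t\,I+\sin t\,[v]_\times+(1-\cos t)vv^T$, where $[v]_\times w=v\times w$. For a nonzero non-unit vector $v$, $R(tv):=R\big((t|v|)\,\tfrac{v}{|v|}\big)$. For a nonzero $C=aX+bY$ set $\mathrm{cost}(C)=|a|+\kappa|b|$. A decomposition of $g\in SO(3)$ is a finite product $g=R(\tau_1C_1)\cdots R(\tau_nC_n)$ with $\tau_j\ge0$ and $C_j$ nonzero vectors in $\mathrm{span}\{X,Y\}$ (a factor written $R(-\tau C)$ with $\tau\ge 0$ is read as $R(\tau\cdot(-C))$); its cost is $\sum_j\tau_j\,\mathrm{cost}(C_j)$. Problem 1: for given $g$, find the infimum of the costs of all decompositions of $g$. A decomposition of $g$ is optimal if its cost equals this infimum. *)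

(* Defs.v *)
From Stdlib Require Import Reals Lra List.
Import ListNotations.
Open Scope R_scope.

Record vec := mkV { v1 : R; v2 : R; v3 : R }.
Record mat := mkM { m11 : R; m12 : R; m13 : R;
                    m21 : R; m22 : R; m23 : R;
                    m31 : R; m32 : R; m33 : R }.

Definition vadd (u w : vec) : vec := mkV (v1 u + v1 w) (v2 u + v2 w) (v3 u + v3 w).
Definition vscale (c : R) (u : vec) : vec := mkV (c * v1 u) (c * v2 u) (c * v3 u).
Definition dot (u w : vec) : R := v1 u * v1 w + v2 u * v2 w + v3 u * v3 w.
Definition vnorm (u : vec) : R := sqrt (dot u u).

Definition mat_id : mat := mkM 1 0 0 0 1 0 0 0 1.
Definition mat_mul (A B : mat) : mat :=
  mkM (m11 A * m11 B + m12 A * m21 B + m13 A * m31 B)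
      (m11 A * m12 B + m12 A * m22 B + m13 A * m32 B)
      (m11 A * m13 B + m12 A * m23 B + m13 A * m33 B)
      (m21 A * m11 B + m22 A * m21 B + m23 A * m31 B)
      (m21 A * m12 B + m22 A * m22 B + m23 A * m32 B)
      (m21 A * m13 B + m22 A * m23 B + m23 A * m33 B)
      (m31 A * m11 B + m32 A * m21 B + m33 A * m31 B)
      (m31 A * m12 B + m32 A * m22 B + m33 A * m32 B)
      (m31 A * m13 B + m32 A * m23 B + m33 A * m33 B).
Definition transpose (A : mat) : mat :=
  mkM (m11 A) (m21 A) (m31 A) (m12 A) (m22 A) (m32 A) (m13 A) (m23 A) (m33 A).
Definition det (A : mat) : R :=
  m11 A * (m22 A * m33 A - m23 A * m32 A)
  - m12 A * (m21 A * m33 A - m23 A * m31 A)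
  + m13 A * (m21 A * m32 A - m22 A * m31 A).

Definition in_SO3 (g : mat) : Prop :=
  mat_mul (transpose g) g = mat_id /\ det g = 1.

(* R(t v) for unit v: cos t I + sin t [v]_x + (1 - cos t) v v^T *)
Definition rot_unit (t : R) (v : vec) : mat :=
  let c := cos t in let s := sin t in let k := 1 - c in
  let x := v1 v in let y := v2 v in let z := v3 v in
  mkM (c + k * x * x)     (- s * z + k * x * y) (s * y + k * x * z)
      (s * z + k * y * x) (c + k * y * y)       (- s * x + k * y * z)
      (- s * y + k * z * x) (s * x + k * z * y) (c + k * z * z).

Definition rot (t : R) (v : vec) : mat :=
  rot_unit (t * vnorm v) (vscale (/ vnorm v) v).

(* A factor of a decomposition: a time tau and the coefficient pair (a,b)
   of the vector C = a X + b Y in span{X,Y}. *)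
Definition factor := (R * (R * R))%type.

Definition factor_vec (X Y : vec) (f : factor) : vec :=
  vadd (vscale (fst (snd f)) X) (vscale (snd (snd f)) Y).

Definition factor_mat (X Y : vec) (f : factor) : mat :=
  rot (fst f) (factor_vec X Y f).

Definition prod_decomp (X Y : vec) (d : list factor) : mat :=
  fold_right (fun f M => mat_mul (factor_mat X Y f) M) mat_id d.

Definition cost_decomp (kappa : R) (d : list factor) : R :=
  fold_right (fun f s => fst f * (Rabs (fst (snd f)) + kappa * Rabs (snd (snd f))) + s) 0 d.

Definition is_decomp (X Y : vec) (g : mat) (d : list factor) : Prop :=
  Forall (fun f => 0 <= fst f /\ factor_vec X Y f <> mkV 0 0 0) d /\
  prod_decomp X Y d = g.

(* Optimal decomposition for Problem 1: its cost equals the infimum of costs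
   of all decompositions of g, i.e. (as d itself is one) it is a lower bound. *)
Definition optimal (X Y : vec) (kappa : R) (g : mat) (d : list factor) : Prop :=
  is_decomp X Y g d /\
  forall d', is_decomp X Y g d' -> cost_decomp kappa d <= cost_decomp kappa d'.

(* The four normal forms, written with coefficient pairs of the "formal"
   vectors X = (1,0), Y = (0,1). A factor R(-t C) is read as R(t (-C)). *)
Definition nform1 (t1 t2 t3 : R) : list factor :=
  [(t1, (1, 0)); (t2, (0, 1)); (t3, (-1, 0))].
Definition nform2 (t1 t2 t3 : R) : list factor :=
  [(t1, (1, 0)); (t2, (0, 1)); (t2, (-1, 0)); (t3, (0, -1))].
Definition nform3 (t1 t2 t3 : R) : list factor :=
  [(t1, (1, 0)); (t2, (1/2, 1/2)); (t3, (1, 0))].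
Definition nform4 (t1 t2 t3 : R) : list factor :=
  [(t1, (1, 0)); (t2, (1/2, 1/2)); (t3, (0, 1))].

(* Substitutions (X,Y) |-> (eps X, eps' Y) or (eps Y, eps' X).
   A substitution is given by the coefficient pairs sX, sY of the images
   of X and Y; it acts on coefficient pairs linearly. *)
Definition is_sign (e : R) : Prop := e = 1 \/ e = -1.

Definition admissible_subst (sX sY : R * R) : Prop :=
  exists e e', is_sign e /\ is_sign e' /\
    ((sX = (e, 0) /\ sY = (0, e')) \/ (sX = (0, e) /\ sY = (e', 0))).

Definition subst_factor (sX sY : R * R) (f : factor) : factor :=
  let a := fst (snd f) in let b := snd (snd f) in
  (fst f, (a * fst sX + b * fst sY, a * snd sX + b * snd sY)).

Definition subst_decomp (sX sY : R * R) (d : list factor) : list factor :=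
  map (subst_factor sX sY) d.

(* Main.v *)
From Coquelicot Require Import Coquelicot.
From Stdlib Require Import Reals Lra Lia List Classical ClassicalEpsilon Wf_nat.
Require Import Defs.
Import ListNotations.
Open Scope R_scope.

(** In an orthonormal frame [X, Y, X x Y], rotations lift to unit quaternions, and by the Lie
    product formula any decomposition is a limit, at equal cost, of words in rotations about [X]
    and [Y] alone.  Among the words with at most [N] letters and a given product (up to sign)
    take one of least cost and, then, of least length.

    The factorisation of [R(aX) R(bY) R(cX) R(sY)] into Euler angles is explicit, so its cost can
    be differentiated at [s = 0].  Stationarity forces the inner angles of a minimal word to be
    equal in size, and the word to be of one of two types: either signs change from each letter to
    the next letter on the same axis (X, Y, -X, -Y, ...), or signs are constant (X, Y, X, Y, ...).
    In the first case, a second-order variation along the explicit fibre through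
    [R(tY) R(-tX) R(-tY)] excludes five letters, and end-point variations bound the outer angles by
    the inner one: this gives forms (1) and (2).  In the second case inserting a letter would lower
    the cost, so all [N] available letters are in use and the inner angles are [O(1/N)]: as [N]
    grows, the inner part tends to a rotation about a diagonal, which gives forms (3) and (4).

    Normal forms of bounded cost form a compact set, hence the limits exist and the least cost of a
    normal form is attained.  The angle bounds in (3) and (4) hold because a rotation by more than
    [pi] is cheaper in the opposite direction. *)

(** * Quaternions *)

(** A diagonal rotation is a limit of ever longer words, so without a cap on the length a cheapest
    word need not exist. The cap [N] restores compactness, and it also measures how many letters a
    variation may still insert. Approximating by words loses no cost because at [kappa = 1] the cost
    of [aX + bY] is the l1 norm of [(a, b)], which is the length of a monotone staircase with the
    same ends. Since a rotation determines its quaternion only up to sign, products are compared by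
    [qeq]; this is what makes an angle beyond [PI] improvable. The tie-break by length removes zero
    letters, mergeable neighbours and inner half turns, so that reduced words lie where the Euler
    coordinates and the absolute values are differentiable. Words X, Y, -X, -Y, ... with equal inner
    angles pass the first-order test on every four consecutive letters, hence the need for a
    second-order variation. Words X, Y, X, Y, ... with equal inner angles pass it too; they are
    beaten by a variation that needs two additional letters, so a nearly exhausted cap protects
    them. *)

Record quat := mkQ { q0 : R; q1 : R; q2 : R; q3 : R }.

Definition qone : quat := mkQ 1 0 0 0.
Definition qneg (p : quat) : quat := mkQ (- q0 p) (- q1 p) (- q2 p) (- q3 p).
Definition qconj (p : quat) : quat := mkQ (q0 p) (- q1 p) (- q2 p) (- q3 p).
Definition qsub (p q : quat) : quat :=
  mkQ (q0 p - q0 q) (q1 p - q1 q) (q2 p - q2 q) (q3 p - q3 q).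
Definition qmul (p q : quat) : quat :=
  mkQ (q0 p * q0 q - q1 p * q1 q - q2 p * q2 q - q3 p * q3 q)
      (q0 p * q1 q + q1 p * q0 q + q2 p * q3 q - q3 p * q2 q)
      (q0 p * q2 q - q1 p * q3 q + q2 p * q0 q + q3 p * q1 q)
      (q0 p * q3 q + q1 p * q2 q - q2 p * q1 q + q3 p * q0 q).
Definition qnorm2 (p : quat) : R := q0 p ^ 2 + q1 p ^ 2 + q2 p ^ 2 + q3 p ^ 2.
Definition qabs (p : quat) : R := Rabs (q0 p) + Rabs (q1 p) + Rabs (q2 p) + Rabs (q3 p).
Definition qunit (p : quat) : Prop := qnorm2 p = 1.
Definition qeq (p q : quat) : Prop := p = q \/ p = qneg q.

Ltac qring := unfold qmul, qneg, qconj, qsub, qone; simpl; f_equal; ring.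

Lemma quat_eq (p q : quat) :
  q0 p = q0 q -> q1 p = q1 q -> q2 p = q2 q -> q3 p = q3 q -> p = q.
Proof. destruct p, q; simpl; congruence. Qed.

Lemma qmul_assoc p q r : qmul p (qmul q r) = qmul (qmul p q) r.
Proof. qring. Qed.
Lemma qmul_1_l p : qmul qone p = p.
Proof. destruct p; qring. Qed.
Lemma qmul_1_r p : qmul p qone = p.
Proof. destruct p; qring. Qed.
Lemma qmul_neg_l p q : qmul (qneg p) q = qneg (qmul p q).
Proof. qring. Qed.
Lemma qmul_neg_r p q : qmul p (qneg q) = qneg (qmul p q).
Proof. qring. Qed.
Lemma qneg_neg p : qneg (qneg p) = p.
Proof. destruct p; qring. Qed.
Lemma qconj_mul p q : qconj (qmul p q) = qmul (qconj q) (qconj p).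
Proof. qring. Qed.
Lemma qconj_neg p : qconj (qneg p) = qneg (qconj p).
Proof. qring. Qed.
Lemma qconj_conj p : qconj (qconj p) = p.
Proof. destruct p; qring. Qed.
Lemma qnorm2_mul p q : qnorm2 (qmul p q) = qnorm2 p * qnorm2 q.
Proof. unfold qnorm2, qmul; simpl; ring. Qed.
Lemma qunit_mul p q : qunit p -> qunit q -> qunit (qmul p q).
Proof. unfold qunit; rewrite qnorm2_mul; intros -> ->; ring. Qed.
Lemma qunit_one : qunit qone.
Proof. unfold qunit, qnorm2; simpl; ring. Qed.
Lemma qunit_conj p : qunit p -> qunit (qconj p).
Proof. unfold qunit, qnorm2; simpl; lra. Qed.
Lemma qconj_mul_l p : qunit p -> qmul (qconj p) p = qone.
Proof.
  unfold qunit, qnorm2; intros H; apply quat_eq; simpl; try ring.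
  lra.
Qed.
Lemma qconj_mul_r p : qunit p -> qmul p (qconj p) = qone.
Proof.
  unfold qunit, qnorm2; intros H; apply quat_eq; simpl; try ring.
  lra.
Qed.

Lemma qeq_refl p : qeq p p.
Proof. now left. Qed.
Lemma qeq_trans p q r : qeq p q -> qeq q r -> qeq p r.
Proof.
  intros [->| ->] [->| ->]; unfold qeq; rewrite ?qneg_neg; auto.
Qed.
Lemma qeq_mul p p' q q' : qeq p p' -> qeq q q' -> qeq (qmul p q) (qmul p' q').
Proof.
  intros [->| ->] [->| ->]; unfold qeq;
    rewrite ?qmul_neg_l, ?qmul_neg_r, ?qneg_neg; auto.
Qed.
Lemma qeq_conj p q : qeq p q -> qeq (qconj p) (qconj q).
Proof. intros [->| ->]; unfold qeq; rewrite ?qconj_neg; auto. Qed.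
Lemma qabs_pos p : 0 <= qabs p.
Proof.
  unfold qabs.
  generalize (Rabs_pos (q0 p)) (Rabs_pos (q1 p)) (Rabs_pos (q2 p)) (Rabs_pos (q3 p)); lra.
Qed.

Lemma qabs_qsub_0 p q : (forall e, 0 < e -> qabs (qsub p q) < e) -> p = q.
Proof.
  intros H.
  assert (H0 : qabs (qsub p q) <= 0).
  { apply Rnot_lt_le; intros H1; specialize (H _ H1); lra. }
  unfold qabs, qsub in H0; simpl in H0.
  generalize (Rabs_pos (q0 p - q0 q)) (Rabs_pos (q1 p - q1 q))
    (Rabs_pos (q2 p - q2 q)) (Rabs_pos (q3 p - q3 q)); intros.
  apply quat_eq; apply Rminus_diag_uniq;
    (destruct (Req_dec (q0 p - q0 q) 0) as [E|E]; [|apply Rabs_pos_lt in E; lra]);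
    (destruct (Req_dec (q1 p - q1 q) 0) as [E1|E1]; [|apply Rabs_pos_lt in E1; lra]);
    (destruct (Req_dec (q2 p - q2 q) 0) as [E2|E2]; [|apply Rabs_pos_lt in E2; lra]);
    (destruct (Req_dec (q3 p - q3 q) 0) as [E3|E3]; [|apply Rabs_pos_lt in E3; lra]);
    assumption.
Qed.

Lemma qabs_sub_sym p q : qabs (qsub p q) = qabs (qsub q p).
Proof.
  unfold qabs, qsub; simpl.
  now rewrite (Rabs_minus_sym (q0 p)), (Rabs_minus_sym (q1 p)),
    (Rabs_minus_sym (q2 p)), (Rabs_minus_sym (q3 p)).
Qed.

Lemma qabs_triangle p q r : qabs (qsub p r) <= qabs (qsub p q) + qabs (qsub q r).
Proof.
  unfold qabs, qsub; simpl.
  assert (T : forall x y z, Rabs (x - z) <= Rabs (x - y) + Rabs (y - z)).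
  { intros x y z; replace (x - z) with ((x - y) + (y - z)) by ring; apply Rabs_triang. }
  generalize (T (q0 p) (q0 q) (q0 r)) (T (q1 p) (q1 q) (q1 r))
    (T (q2 p) (q2 q) (q2 r)) (T (q3 p) (q3 q) (q3 r)); lra.
Qed.

Lemma qabs_mul p q : qabs (qmul p q) <= qabs p * qabs q.
Proof.
  assert (T : forall x y z t, Rabs (x + y + z + t) <= Rabs x + Rabs y + Rabs z + Rabs t).
  { intros x y z t.
    generalize (Rabs_triang (x + y + z) t) (Rabs_triang (x + y) z) (Rabs_triang x y); lra. }
  unfold qabs, qmul, Rminus; simpl.
  generalize
    (T (q0 p * q0 q) (- (q1 p * q1 q)) (- (q2 p * q2 q)) (- (q3 p * q3 q)))
    (T (q0 p * q1 q) (q1 p * q0 q) (q2 p * q3 q) (- (q3 p * q2 q)))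
    (T (q0 p * q2 q) (- (q1 p * q3 q)) (q2 p * q0 q) (q3 p * q1 q))
    (T (q0 p * q3 q) (q1 p * q2 q) (- (q2 p * q1 q)) (q3 p * q0 q)).
  rewrite !Rabs_Ropp, !Rabs_mult; lra.
Qed.

(** Cauchy-Schwarz on four coordinates: the l1 norm is at most [sqrt 4] times the Euclidean norm.
    This is the source of the factors 2 in all later estimates. *)
Lemma qunit_qabs p : qunit p -> qabs p <= 2.
Proof.
  unfold qunit, qnorm2, qabs; intros H.
  rewrite <- (pow2_abs (q0 p)), <- (pow2_abs (q1 p)), <- (pow2_abs (q2 p)), <- (pow2_abs (q3 p)) in H.
  generalize dependent (Rabs (q0 p)); generalize (Rabs (q1 p)) (Rabs (q2 p)) (Rabs (q3 p)).
  intros y z t x H. apply Rnot_lt_le; intros K.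
  assert ((x + y + z + t) ^ 2 <= 4).
  { generalize (pow2_ge_0 (x - y)) (pow2_ge_0 (x - z)) (pow2_ge_0 (x - t))
      (pow2_ge_0 (y - z)) (pow2_ge_0 (y - t)) (pow2_ge_0 (z - t)); simpl in *; nra. }
  nra.
Qed.

Lemma qsub_mul_r p q r : qsub (qmul p r) (qmul q r) = qmul (qsub p q) r.
Proof. qring. Qed.
Lemma qsub_mul_l p q r : qsub (qmul r p) (qmul r q) = qmul r (qsub p q).
Proof. qring. Qed.

Lemma qabs_mul_close p p' q q' : qunit p -> qunit q' ->
  qabs (qsub (qmul p q) (qmul p' q')) <= 2 * qabs (qsub p p') + 2 * qabs (qsub q q').
Proof.
  intros Hp Hq.
  eapply Rle_trans; [apply (qabs_triangle _ (qmul p q'))|].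
  rewrite qsub_mul_l, qsub_mul_r.
  generalize (qabs_mul p (qsub q q')) (qabs_mul (qsub p p') q')
    (qunit_qabs _ Hp) (qunit_qabs _ Hq) (qabs_pos (qsub q q')) (qabs_pos (qsub p p')).
  nra.
Qed.

Fixpoint qpow (p : quat) (n : nat) : quat :=
  match n with O => qone | S n => qmul (qpow p n) p end.

Lemma qunit_pow p n : qunit p -> qunit (qpow p n).
Proof. intros H; induction n; simpl; auto using qunit_one, qunit_mul. Qed.

(* The trailing unit factor [v] keeps the constant of the telescoping sum independent of [n]. *)
Lemma qpow_close_aux p q v n : qunit p -> qunit q -> qunit v ->
  qabs (qsub (qmul (qpow p n) v) (qmul (qpow q n) v)) <= 4 * INR n * qabs (qsub p q).
Proof.
  intros Hp Hq; revert v; induction n as [|n IH]; intros v Hv.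
  - simpl. unfold qsub, qabs; simpl. rewrite !Rminus_diag, Rabs_R0. lra.
  - rewrite S_INR. simpl qpow.
    eapply Rle_trans; [apply (qabs_triangle _ (qmul (qmul (qpow p n) q) v))|].
    rewrite <- !qmul_assoc.
    specialize (IH (qmul q v) (qunit_mul _ _ Hq Hv)).
    rewrite qsub_mul_l, qsub_mul_r.
    generalize (qabs_mul (qpow p n) (qmul (qsub p q) v)) (qabs_mul (qsub p q) v)
      (qunit_qabs _ (qunit_pow p n Hp)) (qunit_qabs _ Hv)
      (qabs_pos (qsub p q)) (qabs_pos (qmul (qsub p q) v)) (qabs_pos (qpow p n)).
    nra.
Qed.

Lemma qpow_close p q n : qunit p -> qunit q ->
  qabs (qsub (qpow p n) (qpow q n)) <= 4 * INR n * qabs (qsub p q).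
Proof.
  intros Hp Hq.
  generalize (qpow_close_aux p q qone n Hp Hq qunit_one); now rewrite !qmul_1_r.
Qed.

(** * Words in rotations about the two axes *)

(* A letter [(false, t)] stands for R(tX) and [(true, t)] for R(tY), with real [t];
   quaternions use half angles. *)
Notation letter := (bool * R)%type.

Definition lquat (l : letter) : quat :=
  if fst l then mkQ (cos (snd l / 2)) 0 (sin (snd l / 2)) 0
  else mkQ (cos (snd l / 2)) (sin (snd l / 2)) 0 0.

Definition wprod (w : list letter) : quat :=
  fold_right (fun l p => qmul (lquat l) p) qone w.

Definition wcost (w : list letter) : R :=
  fold_right (fun l s => Rabs (snd l) + s) 0 w.

Lemma sin2_cos2' x : sin x ^ 2 + cos x ^ 2 = 1.
Proof. generalize (sin2_cos2 x); unfold Rsqr; simpl; lra. Qed.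

Lemma lquat_unit l : qunit (lquat l).
Proof.
  unfold qunit, qnorm2, lquat; destruct l as [[|] t]; simpl;
  generalize (sin2_cos2' (t / 2)); simpl; lra.
Qed.

Lemma wprod_unit w : qunit (wprod w).
Proof. induction w; simpl; auto using qunit_one, qunit_mul, lquat_unit. Qed.

Lemma wprod_app u v : wprod (u ++ v) = qmul (wprod u) (wprod v).
Proof.
  induction u as [|l u IH]; simpl; [now rewrite qmul_1_l|].
  now rewrite IH, qmul_assoc.
Qed.

Lemma wcost_app u v : wcost (u ++ v) = wcost u + wcost v.
Proof. induction u as [|l u IH]; simpl; [ring|rewrite IH; ring]. Qed.

Lemma wcost_pos w : 0 <= wcost w.
Proof. induction w as [|l w IH]; simpl; [lra|generalize (Rabs_pos (snd l)); lra]. Qed.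

Lemma lquat_add b s t : qmul (lquat (b, s)) (lquat (b, t)) = lquat (b, s + t).
Proof.
  unfold lquat, qmul; simpl.
  replace ((s + t) / 2) with (s / 2 + t / 2) by field.
  rewrite cos_plus, sin_plus. destruct b; simpl; f_equal; ring.
Qed.

Lemma lquat_0 b : lquat (b, 0) = qone.
Proof.
  unfold lquat, qone; simpl. replace (0 / 2) with 0 by field.
  rewrite cos_0, sin_0; now destruct b.
Qed.

Lemma lquat_neg_conj b t : lquat (b, - t) = qconj (lquat (b, t)).
Proof.
  unfold lquat, qconj; simpl. replace (- t / 2) with (- (t / 2)) by field.
  rewrite cos_neg, sin_neg. destruct b; simpl; f_equal; ring.
Qed.

Lemma lquat_shift b t : lquat (b, t - 2 * PI) = qneg (lquat (b, t)).
Proof.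
  unfold lquat, qneg; simpl. replace ((t - 2 * PI) / 2) with (t / 2 - PI) by field.
  rewrite cos_minus, sin_minus, cos_PI, sin_PI. destruct b; simpl; f_equal; ring.
Qed.

Lemma lquat_shift' b t : lquat (b, t + 2 * PI) = qneg (lquat (b, t)).
Proof.
  rewrite <- (qneg_neg (lquat (b, t + 2 * PI))), <- lquat_shift. do 3 f_equal; ring.
Qed.

(** The axes are orthogonal, so a half turn about one reverses the other. This lets a letter of
    angle [PI] travel through a word and merge its neighbours. *)
Lemma lquat_PI b c t : b <> c ->
  qmul (lquat (b, t)) (lquat (c, PI)) = qmul (lquat (c, PI)) (lquat (b, - t)).
Proof.
  intros H; unfold lquat, qmul; simpl.
  replace (- t / 2) with (- (t / 2)) by field.
  rewrite cos_neg, sin_neg, cos_PI2, sin_PI2.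
  destruct b, c; try congruence; simpl; f_equal; ring.
Qed.

(** * Symmetries of words *)

Definition lswap (l : letter) : letter := (negb (fst l), snd l).
Definition lflip (l : letter) : letter := if fst l then (true, - snd l) else l.
Definition linv (l : letter) : letter := (fst l, - snd l).
Definition winv (w : list letter) : list letter := rev (map linv w).

(** Conjugation by the half turn about the diagonal [X + Y], which exchanges the axes and reverses
    the third one; [qflip] is conjugation by the half turn about X. Both are automorphisms, and they
    reduce later arguments to words that begin with X and to positive angles. *)
Definition qswap (p : quat) : quat := mkQ (q0 p) (q2 p) (q1 p) (- q3 p).
Definition qflip (p : quat) : quat := mkQ (q0 p) (q1 p) (- q2 p) (- q3 p).

Lemma wprod_swap w : wprod (map lswap w) = qswap (wprod w).
Proof.
  induction w as [|[b t] w IH]; simpl; [unfold qswap, qone; simpl; f_equal; ring|].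
  rewrite IH. unfold lquat, lswap, qswap, qmul; destruct b; simpl; f_equal; ring.
Qed.

Lemma wprod_flip w : wprod (map lflip w) = qflip (wprod w).
Proof.
  induction w as [|[b t] w IH]; simpl; [unfold qflip, qone; simpl; f_equal; ring|].
  rewrite IH. unfold lquat, lflip, qflip, qmul; destruct b; simpl;
  [replace (- t / 2) with (- (t / 2)) by field; rewrite cos_neg, sin_neg|]; f_equal; ring.
Qed.

Lemma wprod_inv w : wprod (winv w) = qconj (wprod w).
Proof.
  unfold winv; induction w as [|[b t] w IH]; simpl.
  - unfold qconj, qone; simpl; f_equal; ring.
  - rewrite wprod_app, IH, qconj_mul; simpl. now rewrite qmul_1_r, <- lquat_neg_conj.
Qed.

Lemma wcost_swap w : wcost (map lswap w) = wcost w.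
Proof. induction w as [|[b t] w IH]; simpl; [|rewrite IH]; reflexivity. Qed.
Lemma wcost_flip w : wcost (map lflip w) = wcost w.
Proof.
  induction w as [|[b t] w IH]; simpl; [reflexivity|rewrite IH].
  destruct b; simpl; now rewrite ?Rabs_Ropp.
Qed.
Lemma wcost_inv w : wcost (winv w) = wcost w.
Proof.
  unfold winv; induction w as [|[b t] w IH]; simpl; [reflexivity|].
  rewrite wcost_app, IH; simpl; rewrite Rabs_Ropp; ring.
Qed.

Lemma swap_swap w : map lswap (map lswap w) = w.
Proof.
  rewrite map_map. rewrite <- (map_id w) at 2. apply map_ext.
  intros [b t]; unfold lswap; simpl; now rewrite Bool.negb_involutive.
Qed.
Lemma flip_flip w : map lflip (map lflip w) = w.
Proof.
  rewrite map_map. rewrite <- (map_id w) at 2. apply map_ext.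
  intros [[|] t]; unfold lflip; simpl; now rewrite ?Ropp_involutive.
Qed.
(** * Reduced words *)

(** Lexicographic minimality, cost before length, among words within the cap. The cap is independent
    of the length of [w], so it records how many letters competitors may add. *)
Definition reduced (N : nat) (w : list letter) : Prop :=
  (length w <= N)%nat /\
  forall w', (length w' <= N)%nat -> qeq (wprod w') (wprod w) ->
    wcost w < wcost w' \/ (wcost w = wcost w' /\ (length w <= length w')%nat).

Lemma reduced_no_cheaper N w w' : reduced N w -> (length w' <= N)%nat ->
  qeq (wprod w') (wprod w) -> wcost w <= wcost w'.
Proof. intros [_ H] Hl Hq; destruct (H w' Hl Hq) as [K|[K _]]; lra. Qed.

Lemma reduced_no_shorter N w w' : reduced N w ->
  qeq (wprod w') (wprod w) -> wcost w' <= wcost w -> (length w' < length w)%nat -> False.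
Proof.
  intros [Hl0 H] Hq Hc Hl.
  destruct (H w') as [K|[K K']]; auto; [lia|lra|lia].
Qed.

Lemma reduced_infix N p u s : reduced N (p ++ u ++ s) ->
  reduced (N - length p - length s) u.
Proof.
  intros [Hl H]; rewrite !length_app in Hl; split; [lia|].
  intros u' Hl' Hq.
  destruct (H (p ++ u' ++ s)) as [K|[K K']].
  - rewrite !length_app; lia.
  - rewrite !wprod_app; repeat apply qeq_mul; auto using qeq_refl.
  - rewrite !wcost_app in K; left; lra.
  - rewrite !wcost_app in K; rewrite !length_app in K'; right; split; [lra|lia].
Qed.

Lemma reduced_mono N M w : (M <= N)%nat -> (length w <= M)%nat -> reduced N w -> reduced M w.
Proof.
  intros HM Hl [_ H]; split; auto. intros w' Hl'; apply H; lia.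
Qed.

Lemma qeq_swap p q : qeq (qswap p) (qswap q) -> qeq p q.
Proof.
  destruct p, q; unfold qeq, qswap, qneg; simpl; intros [E|E]; injection E; intros;
    [left|right]; f_equal; lra.
Qed.
Lemma qeq_flip p q : qeq (qflip p) (qflip q) -> qeq p q.
Proof.
  destruct p, q; unfold qeq, qflip, qneg; simpl; intros [E|E]; injection E; intros;
    [left|right]; f_equal; lra.
Qed.

Lemma reduced_swap N w : reduced N w -> reduced N (map lswap w).
Proof.
  intros [Hl H]; split; rewrite length_map; auto.
  intros w' Hl' Hq. rewrite wcost_swap, <- (wcost_swap w').
  rewrite <- (length_map lswap w'). apply H; [now rewrite length_map|].
  apply qeq_swap. rewrite <- !wprod_swap, swap_swap; auto.
Qed.
Lemma reduced_flip N w : reduced N w -> reduced N (map lflip w).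
Proof.
  intros [Hl H]; split; rewrite length_map; auto.
  intros w' Hl' Hq. rewrite wcost_flip, <- (wcost_flip w').
  rewrite <- (length_map lflip w'). apply H; [now rewrite length_map|].
  apply qeq_flip. rewrite <- !wprod_flip, flip_flip; auto.
Qed.
Lemma length_winv w : length (winv w) = length w.
Proof. unfold winv; now rewrite length_rev, length_map. Qed.
Lemma reduced_inv N w : reduced N w -> reduced N (winv w).
Proof.
  intros [Hl H]; split; rewrite length_winv; auto.
  intros w' Hl' Hq. rewrite wcost_inv, <- (wcost_inv w'), <- (length_winv w').
  apply H; [now rewrite length_winv|].
  apply qeq_conj in Hq. now rewrite !wprod_inv, qconj_conj in *.
Qed.

Lemma reduced_letter_neq0 N b t : reduced N [(b, t)] -> t <> 0.
Proof.
  intros H ->. eapply (reduced_no_shorter N _ [] H); simpl.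
  - rewrite lquat_0, qmul_1_l; apply qeq_refl.
  - rewrite Rabs_R0; lra.
  - lia.
Qed.

(** A full turn changes the quaternion only by its sign, and beyond [PI] subtracting it makes the
    angle smaller in size. *)
Lemma reduced_letter_le_PI N b t : reduced N [(b, t)] -> Rabs t <= PI.
Proof.
  intros H. apply Rnot_lt_le; intros K.
  assert (T : forall t', lquat (b, t') = qneg (lquat (b, t)) -> Rabs t <= Rabs t').
  { intros t' E.
    assert (Hc : wcost [(b, t)] <= wcost [(b, t')]).
    { apply (reduced_no_cheaper N); auto; [apply H|].
      right; simpl; now rewrite E, qmul_neg_l. }
    simpl in Hc; lra. }
  generalize PI_RGT_0; intros HP.
  destruct (Rle_lt_dec 0 t) as [Ht|Ht].
  - specialize (T (t - 2 * PI) (lquat_shift b t)).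
    rewrite (Rabs_right t) in * by lra.
    revert T; unfold Rabs; destruct (Rcase_abs _); lra.
  - specialize (T (t + 2 * PI) (lquat_shift' b t)).
    rewrite (Rabs_left t) in * by lra.
    revert T; unfold Rabs; destruct (Rcase_abs _); lra.
Qed.

Lemma reduced_alternate N b c s t : reduced N [(b, s); (c, t)] -> c = negb b.
Proof.
  intros H. destruct (Bool.bool_dec c b) as [->|E].
  - exfalso. eapply (reduced_no_shorter N _ [(b, s + t)] H); simpl.
    + rewrite !qmul_1_r, lquat_add; apply qeq_refl.
    + generalize (Rabs_triang s t); lra.
    + lia.
  - destruct b, c; simpl; congruence.
Qed.

(** * Moving a rotation across an Euler factorisation *)

Lemma polar x y : 0 < x ->
  x = sqrt (x ^ 2 + y ^ 2) * cos (atan (y / x)) /\ y = sqrt (x ^ 2 + y ^ 2) * sin (atan (y / x)).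
Proof.
  intros Hx.
  assert (E : sqrt (x ^ 2 + y ^ 2) = x * sqrt (1 + (y / x)²)).
  { rewrite <- (sqrt_pow2 x) at 2 by lra. rewrite <- sqrt_mult.
    - f_equal; unfold Rsqr; field; lra.
    - apply pow2_ge_0.
    - generalize (Rle_0_sqr (y / x)); lra. }
  assert (0 < sqrt (1 + (y / x)²)).
  { apply sqrt_lt_R0. generalize (Rle_0_sqr (y / x)); lra. }
  rewrite cos_atan, sin_atan, E. split; field; lra.
Qed.

Lemma derive_expansion f l : is_derive f 0 l -> forall e, 0 < e ->
  exists d, 0 < d /\ forall s, Rabs s < d -> Rabs (f s - f 0 - l * s) <= e * Rabs s.
Proof.
  intros H e He. apply is_derive_Reals in H. destruct (H e He) as [d Hd].
  exists d; split; [apply cond_pos|]. intros s Hs.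
  destruct (Req_dec s 0) as [->|Hs0].
  - replace (f 0 - f 0 - l * 0) with 0 by ring. rewrite !Rabs_R0; lra.
  - specialize (Hd s Hs0 Hs). rewrite Rplus_0_l in Hd.
    replace (f s - f 0 - l * s) with (((f s - f 0) / s - l) * s) by (field; auto).
    rewrite Rabs_mult. apply Rmult_le_compat_r; [apply Rabs_pos|lra].
Qed.

Lemma continuity_pos f x : continuity_pt f x -> 0 < f x ->
  exists d, 0 < d /\ forall s, Rabs (s - x) < d -> 0 < f s.
Proof.
  intros H Hf. destruct (H (f x) Hf) as [d [Hd K]]. exists d; split; auto.
  intros s Hs. destruct (Req_dec s x) as [->|E]; auto.
  assert (Hk : R_dist (f s) (f x) < f x).
  { apply K. split; [split; [exact I|auto]|exact Hs]. }
  revert Hk; unfold R_dist, Rabs; destruct (Rcase_abs _); lra.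
Qed.

Lemma wprod_XYX a b c :
  wprod [(false, a); (true, b); (false, c)] =
  mkQ (cos (b / 2) * cos ((a + c) / 2)) (cos (b / 2) * sin ((a + c) / 2))
      (sin (b / 2) * cos ((a - c) / 2)) (sin (b / 2) * sin ((a - c) / 2)).
Proof.
  replace ((a + c) / 2) with (a / 2 + c / 2) by field.
  replace ((a - c) / 2) with (a / 2 - c / 2) by field.
  rewrite cos_plus, sin_plus, cos_minus, sin_minus.
  simpl wprod; rewrite qmul_1_r. unfold lquat, qmul; simpl; f_equal; ring.
Qed.

(** [x1 + i y1] and [x2 + i y2] are the two complex coordinates of the four-letter product, divided
    by the phases [(a + c) / 2] and [(a - c) / 2]. Their arguments change the outer angles, the
    ratio of their moduli gives the middle one. Positive real parts keep the arguments in the range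
    of [atan]. *)
Lemma euler_exact a b c s :
  let x1 := cos (b / 2) * cos (s / 2) - sin (b / 2) * sin (s / 2) * cos c in
  let y1 := sin (b / 2) * sin (s / 2) * sin c in
  let x2 := sin (b / 2) * cos (s / 2) + cos (b / 2) * sin (s / 2) * cos c in
  let y2 := cos (b / 2) * sin (s / 2) * sin c in
  0 < x1 -> 0 < x2 ->
  wprod [(false, a + (atan (y1 / x1) + atan (y2 / x2)));
         (true, 2 * atan (sqrt (x2 ^ 2 + y2 ^ 2) / sqrt (x1 ^ 2 + y1 ^ 2)));
         (false, c + (atan (y1 / x1) - atan (y2 / x2)))]
  = wprod [(false, a); (true, b); (false, c); (true, s)].
Proof.
  intros x1 y1 x2 y2 H1 H2.
  destruct (polar x1 y1 H1) as [P1 P2]. destruct (polar x2 y2 H2) as [P3 P4].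
  set (f1 := atan (y1 / x1)) in *. set (f2 := atan (y2 / x2)) in *.
  set (r1 := sqrt (x1 ^ 2 + y1 ^ 2)) in *. set (r2 := sqrt (x2 ^ 2 + y2 ^ 2)) in *.
  assert (S1 : r1 ^ 2 = x1 ^ 2 + y1 ^ 2) by (apply pow2_sqrt; nra).
  assert (S2 : r2 ^ 2 = x2 ^ 2 + y2 ^ 2) by (apply pow2_sqrt; nra).
  assert (R1 : 0 < r1) by (apply sqrt_lt_R0; nra).
  destruct (polar r1 r2 R1) as [P5 P6].
  replace (sqrt (r1 ^ 2 + r2 ^ 2)) with 1 in P5, P6.
  (* The product is a unit quaternion, so the squared moduli add up to 1. *)
  2:{ rewrite S1, S2. rewrite <- sqrt_1 at 1. f_equal. unfold x1, y1, x2, y2.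
      assert (Hc : forall C S c s u v : R, S ^ 2 + C ^ 2 = 1 -> s ^ 2 + c ^ 2 = 1 ->
        v ^ 2 + u ^ 2 = 1 ->
        1 = (C * c - S * s * u) ^ 2 + (S * s * v) ^ 2 + ((S * c + C * s * u) ^ 2 + (C * s * v) ^ 2)).
      { intros C S c' s' u v E1 E2 E3.
        transitivity ((S ^ 2 + C ^ 2) * (c' ^ 2 + s' ^ 2 * (v ^ 2 + u ^ 2))); [|ring].
        rewrite E3, E1. lra. }
      apply Hc; apply sin2_cos2'. }
  change [(false, a); (true, b); (false, c); (true, s)]
    with ([(false, a); (true, b); (false, c)] ++ [(true, s)]).
  rewrite wprod_app, !wprod_XYX. simpl wprod; rewrite qmul_1_r.
  replace (2 * atan (r2 / r1) / 2) with (atan (r2 / r1)) by field.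
  rewrite Rmult_1_l in P5, P6. rewrite <- P5, <- P6.
  replace ((a + (f1 + f2) + (c + (f1 - f2))) / 2) with ((a + c) / 2 + f1) by field.
  replace ((a + (f1 + f2) - (c + (f1 - f2))) / 2) with ((a - c) / 2 + f2) by field.
  rewrite !cos_plus, !sin_plus.
  unfold lquat, qmul; simpl.
  assert (T : forall u v : R, r1 * (u * cos f1 - v * sin f1) = u * x1 - v * y1 /\
     r1 * (u * cos f1 + v * sin f1) = u * x1 + v * y1 /\
     r2 * (u * cos f2 - v * sin f2) = u * x2 - v * y2 /\
     r2 * (u * cos f2 + v * sin f2) = u * x2 + v * y2).
  { intros. symmetry in P1, P2, P3, P4. repeat split; ring [P1 P2 P3 P4]. }
  f_equal.
  - rewrite (proj1 (T _ _)). unfold x1, y1.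
    replace ((a - c) / 2) with ((a + c) / 2 - c) by field. rewrite cos_minus. ring.
  - rewrite (proj1 (proj2 (T _ _))). unfold x1, y1.
    replace ((a - c) / 2) with ((a + c) / 2 - c) by field. rewrite sin_minus. ring.
  - rewrite (proj1 (proj2 (proj2 (T _ _)))). unfold x2, y2.
    replace ((a + c) / 2) with ((a - c) / 2 + c) by field. rewrite cos_plus. ring.
  - rewrite (proj2 (proj2 (proj2 (T _ _)))). unfold x2, y2.
    replace ((a + c) / 2) with ((a - c) / 2 + c) by field. rewrite sin_plus. ring.
Qed.

(** One computation serves both phases: the first one with [u] negated, the second one with [C] and
    [S] exchanged. *)
Lemma euler_derive_phase C S u v : 0 < C ->
  is_derive (fun s => atan ((S * sin (s / 2) * v) / (C * cos (s / 2) + S * sin (s / 2) * u)))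
    0 (S * v / (2 * C)).
Proof.
  intros HC. auto_derive; replace (0 * / 2) with 0 by field; rewrite ?sin_0, ?cos_0.
  - lra.
  - field; lra.
Qed.

Lemma euler_derive_modulus C S u v : 0 < C -> 0 < S -> S ^ 2 + C ^ 2 = 1 ->
  is_derive (fun s => 2 * atan (
     sqrt ((S * cos (s / 2) + C * sin (s / 2) * u) ^ 2 + (C * sin (s / 2) * v) ^ 2) /
     sqrt ((C * cos (s / 2) - S * sin (s / 2) * u) ^ 2 + (S * sin (s / 2) * v) ^ 2))) 0 u.
Proof.
  intros HC HS E.
  assert (E1 : sqrt (S ^ 2) = S) by (apply sqrt_pow2; lra).
  assert (E2 : sqrt (C ^ 2) = C) by (apply sqrt_pow2; lra).
  auto_derive; replace (0 * / 2) with 0 by field; rewrite ?sin_0, ?cos_0.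
  - replace ((S * 1 + C * 0 * u) * ((S * 1 + C * 0 * u) * 1) + C * 0 * v * (C * 0 * v * 1))
      with (S ^ 2) by ring.
    replace ((C * 1 + - (S * 0 * u)) * ((C * 1 + - (S * 0 * u)) * 1) + S * 0 * v * (S * 0 * v * 1))
      with (C ^ 2) by ring.
    rewrite E2. repeat split; try lra; apply pow_lt; lra.
  - replace ((S * 1 + C * 0 * u) * ((S * 1 + C * 0 * u) * 1) + C * 0 * v * (C * 0 * v * 1))
      with (S ^ 2) by ring.
    replace ((C * 1 + - (S * 0 * u)) * ((C * 1 + - (S * 0 * u)) * 1) + S * 0 * v * (S * 0 * v * 1))
      with (C ^ 2) by ring.
    rewrite E1, E2.
    match goal with |- ?X = u => replace X with (u * (S ^ 2 + C ^ 2) / (S ^ 2 + C ^ 2)) end.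
    + rewrite E; field.
    + field. split; nra.
Qed.

(** A perturbation no larger than [a] cannot cross zero, so the absolute value stays affine; at
    [a = 0] the perturbation vanishes. *)
Lemma Rabs_near a x : Rabs x <= Rabs a -> Rabs (a + x) = Rabs a + sign a * x.
Proof.
  intros H. destruct (Rtotal_order a 0) as [K|[K|K]].
  - rewrite sign_eq_m1 by auto. rewrite (Rabs_left a) in * by auto.
    revert H; unfold Rabs; destruct (Rcase_abs x), (Rcase_abs (a + x)); lra.
  - subst. rewrite Rabs_R0 in H. generalize (Rabs_pos x); intros.
    assert (x = 0) as ->. { destruct (Req_dec x 0); auto. apply Rabs_pos_lt in H1; lra. }
    rewrite Rplus_0_l, Rmult_0_r; ring.
  - rewrite sign_eq_1 by auto. rewrite (Rabs_right a) in * by lra.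
    revert H; unfold Rabs; destruct (Rcase_abs x), (Rcase_abs (a + x)); lra.
Qed.

Lemma sign_abs a : Rabs (sign a) <= 1.
Proof.
  destruct (Rtotal_order a 0) as [K|[K|K]].
  - rewrite sign_eq_m1 by auto. rewrite Rabs_left; lra.
  - subst; rewrite sign_0, Rabs_R0; lra.
  - rewrite sign_eq_1 by auto. rewrite Rabs_right; lra.
Qed.

Lemma first_order_abs f l : is_derive f 0 l -> f 0 <> 0 -> forall e, 0 < e ->
  exists d, 0 < d /\ forall s, Rabs s < d ->
    Rabs (f s) <= Rabs (f 0) + sign (f 0) * l * s + e * Rabs s.
Proof.
  intros H Hf e He.
  destruct (derive_expansion f l H e He) as [d [Hd K]].
  assert (Ha : 0 < Rabs (f 0)) by now apply Rabs_pos_lt.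
  assert (Hl : 0 < Rabs l + e) by (generalize (Rabs_pos l); lra).
  exists (Rmin d (Rabs (f 0) / (Rabs l + e))); split.
  { apply Rmin_pos; auto. now apply Rdiv_lt_0_compat. }
  intros s Hs. assert (Hs1 : Rabs s < d) by (eapply Rlt_le_trans; [apply Hs|apply Rmin_l]).
  assert (Hs2 : Rabs s < Rabs (f 0) / (Rabs l + e)) by (eapply Rlt_le_trans; [apply Hs|apply Rmin_r]).
  specialize (K s Hs1).
  set (r := f s - f 0 - l * s) in *.
  replace (f s) with (f 0 + (l * s + r)) by (unfold r; ring).
  rewrite Rabs_near.
  - assert (sign (f 0) * r <= e * Rabs s); [|lra].
    eapply Rle_trans; [apply Rle_abs|]. rewrite Rabs_mult.
    generalize (sign_abs (f 0)) (Rabs_pos r) (Rabs_pos (sign (f 0))); nra.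
  - eapply Rle_trans; [apply Rabs_triang|]. rewrite Rabs_mult.
    apply Rlt_le in Hs2. apply (Rmult_le_compat_r (Rabs l + e)) in Hs2; [|lra].
    replace (Rabs (f 0) / (Rabs l + e) * (Rabs l + e)) with (Rabs (f 0)) in Hs2 by (field; lra).
    lra.
Qed.

(* First-order variation of [|a| + |b| + |c|] when [R(aX) R(bY) R(cX)] is multiplied by
   [R(sY)] and factored again; it is the value at [Y] of the Pontryagin covector. *)
Definition slope (a b c : R) : R :=
  sign a * (sin c / sin b) + sign b * cos c - sign c * (cos b * sin c / sin b).

Lemma half_sin_cos b : sin b = 2 * sin (b / 2) * cos (b / 2) /\ cos b = cos (b / 2) ^ 2 - sin (b / 2) ^ 2.
Proof.
  split; [rewrite <- sin_2a|rewrite <- Rsqr_pow2, <- Rsqr_pow2; unfold Rsqr; rewrite <- cos_2a];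
  f_equal; field.
Qed.

(** Nonzero angles make the absolute values differentiable, and [0 < b < PI] keeps both coordinates
    of [euler_exact] in the right half-plane for small [s]. Both signs of [s] are allowed; the slope
    conditions below need this. *)
Lemma euler_move_pos a b c e : a <> 0 -> 0 < b < PI -> c <> 0 -> 0 < e ->
  exists d, 0 < d /\ forall s, Rabs s < d -> exists a' b' c',
    wprod [(false, a'); (true, b'); (false, c')]
      = wprod [(false, a); (true, b); (false, c); (true, s)] /\
    Rabs a' + Rabs b' + Rabs c' <= Rabs a + Rabs b + Rabs c + slope a b c * s + e * Rabs s.
Proof.
  intros Ha Hb Hc He.
  set (C := cos (b / 2)). set (S := sin (b / 2)).
  assert (HC : 0 < C) by (apply cos_gt_0; lra).
  assert (HS : 0 < S) by (apply sin_gt_0; lra).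
  set (u := cos c). set (v := sin c).
  set (F1 := fun s => atan ((S * sin (s / 2) * v) / (C * cos (s / 2) - S * sin (s / 2) * u))).
  set (F2 := fun s => atan ((C * sin (s / 2) * v) / (S * cos (s / 2) + C * sin (s / 2) * u))).
  assert (D1 : is_derive F1 0 (S * v / (2 * C))).
  { eapply is_derive_ext; [|apply (euler_derive_phase C S (- u) v HC)].
    intros t; unfold F1. f_equal; f_equal; ring. }
  assert (D2 : is_derive F2 0 (C * v / (2 * S))).
  { apply (euler_derive_phase S C u v HS). }
  set (F3 := fun s => 2 * atan (
     sqrt ((S * cos (s / 2) + C * sin (s / 2) * u) ^ 2 + (C * sin (s / 2) * v) ^ 2) /
     sqrt ((C * cos (s / 2) - S * sin (s / 2) * u) ^ 2 + (S * sin (s / 2) * v) ^ 2))).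
  assert (D3 : is_derive F3 0 u).
  { apply euler_derive_modulus; auto. apply sin2_cos2'. }
  assert (Z1 : F1 0 = 0).
  { unfold F1; replace (0 / 2) with 0 by field; rewrite sin_0.
    replace (S * 0 * v / _) with 0 by (unfold Rdiv; ring). apply atan_0. }
  assert (Z2 : F2 0 = 0).
  { unfold F2; replace (0 / 2) with 0 by field; rewrite sin_0.
    replace (C * 0 * v / _) with 0 by (unfold Rdiv; ring). apply atan_0. }
  assert (Z3 : F3 0 = b).
  { unfold F3; replace (0 / 2) with 0 by field; rewrite sin_0, cos_0.
    replace ((S * 1 + C * 0 * u) ^ 2 + (C * 0 * v) ^ 2) with (S ^ 2) by ring.
    replace ((C * 1 - S * 0 * u) ^ 2 + (S * 0 * v) ^ 2) with (C ^ 2) by ring.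
    rewrite !sqrt_pow2 by lra. change (S / C) with (tan (b / 2)).
    rewrite atan_tan; [field|lra]. }
  assert (e3 : 0 < e / 3) by lra.
  assert (DA : is_derive (fun s => a + (F1 s + F2 s)) 0 (sin c / sin b)).
  { replace (sin c / sin b) with (0 + (S * v / (2 * C) + C * v / (2 * S))).
    (* The two phase rates add up through [S / C + C / S = 2 / sin b], and subtract in [DC] to give
       [cos b / sin b]. *)
    2:{ destruct (half_sin_cos b) as [-> _]. fold S C v.
        transitivity (v * (S ^ 2 + C ^ 2) / (2 * S * C)); [field; lra|].
        unfold S, C; rewrite sin2_cos2'. field; fold S C; lra. }
    apply (is_derive_plus (fun _ => a) (fun s => F1 s + F2 s));
      [exact (@is_derive_const _ R_NormedModule a 0)|].
    now apply (is_derive_plus F1 F2). }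
  assert (DC : is_derive (fun s => c + (F1 s - F2 s)) 0 (- (cos b * sin c / sin b))).
  { replace (- (cos b * sin c / sin b)) with (0 + (S * v / (2 * C) - C * v / (2 * S))).
    2:{ destruct (half_sin_cos b) as [-> ->]. fold S C v. field; lra. }
    apply (is_derive_plus (fun _ => c) (fun s => F1 s - F2 s));
      [exact (@is_derive_const _ R_NormedModule c 0)|].
    now apply (is_derive_minus F1 F2). }
  destruct (first_order_abs _ _ DA) with (e := e / 3) as [dA [HdA KA]]; auto.
  { rewrite Z1, Z2; lra. }
  destruct (first_order_abs _ _ D3) with (e := e / 3) as [dB [HdB KB]]; auto.
  { rewrite Z3; lra. }
  destruct (first_order_abs _ _ DC) with (e := e / 3) as [dC [HdC KC]]; auto.
  { rewrite Z1, Z2; lra. }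
  rewrite Z1, Z2 in KA, KC. rewrite Z3 in KB.
  replace (a + (0 + 0)) with a in KA by ring. replace (c + (0 - 0)) with c in KC by ring.
  destruct (continuity_pos (fun s => C * cos (s / 2) - S * sin (s / 2) * u) 0) as [d1 [Hd1 K1]].
  { reg. }
  { replace (0 / 2) with 0 by field; rewrite sin_0, cos_0; lra. }
  destruct (continuity_pos (fun s => S * cos (s / 2) + C * sin (s / 2) * u) 0) as [d2 [Hd2 K2]].
  { reg. }
  { replace (0 / 2) with 0 by field; rewrite sin_0, cos_0; lra. }
  exists (Rmin (Rmin d1 d2) (Rmin dA (Rmin dB dC))); split.
  { repeat apply Rmin_pos; auto. }
  intros s Hs.
  apply Rmin_Rgt_l in Hs; destruct Hs as [Hs Hs'].
  apply Rmin_Rgt_l in Hs; destruct Hs as [Hs1 Hs2].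
  apply Rmin_Rgt_l in Hs'; destruct Hs' as [HsA Hs'].
  apply Rmin_Rgt_l in Hs'; destruct Hs' as [HsB HsC].
  exists (a + (F1 s + F2 s)), (F3 s), (c + (F1 s - F2 s)); split.
  - apply (euler_exact a b c s); [apply K1|apply K2]; rewrite Rminus_0_r; auto.
  - specialize (KA s HsA). specialize (KB s HsB). specialize (KC s HsC).
    unfold slope; fold u. lra.
Qed.

(** For [b < 0], flipping the Y axis replaces [b] and [s] by their negatives, and [slope] is odd in
    [b]. *)
Lemma euler_move a b c e : a <> 0 -> b <> 0 -> Rabs b < PI -> c <> 0 -> 0 < e ->
  exists d, 0 < d /\ forall s, Rabs s < d -> exists a' b' c',
    wprod [(false, a'); (true, b'); (false, c')]
      = wprod [(false, a); (true, b); (false, c); (true, s)] /\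
    Rabs a' + Rabs b' + Rabs c' <= Rabs a + Rabs b + Rabs c + slope a b c * s + e * Rabs s.
Proof.
  intros Ha Hb Hb' Hc He.
  destruct (Rlt_le_dec 0 b) as [K|K].
  { apply euler_move_pos; auto. rewrite Rabs_right in Hb'; lra. }
  rewrite Rabs_left in Hb' by lra.
  destruct (euler_move_pos a (- b) c e) as [d [Hd H]]; auto; try lra.
  exists d; split; auto. intros s Hs.
  destruct (H (- s)) as (a' & b' & c' & E & Hl); [now rewrite Rabs_Ropp|].
  exists a', (- b'), c'; split.
  - change (wprod (map lflip [(false, a'); (true, b'); (false, c')]) =
            wprod [(false, a); (true, b); (false, c); (true, s)]).
    rewrite wprod_flip, E, <- wprod_flip. unfold lflip; cbn [map fst snd].
    now rewrite !Ropp_involutive.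
  - replace (slope a (- b) c) with (- slope a b c) in Hl.
    + rewrite !Rabs_Ropp in *. lra.
    + assert (sin b < 0).
      { rewrite <- (Ropp_involutive b), sin_neg. assert (0 < sin (- b)) by (apply sin_gt_0; lra). lra. }
      unfold slope. rewrite sin_neg, cos_neg, (sign_eq_m1 b), (sign_eq_1 (- b)) by lra.
      field; lra.
Qed.

(** * First-order conditions on reduced words *)

Lemma lquat_mPI b : lquat (b, - PI) = qneg (lquat (b, PI)).
Proof. rewrite <- lquat_shift. do 2 f_equal; ring. Qed.

Lemma Rabs_eq_PI t : Rabs t = PI -> t = PI \/ t = - PI.
Proof. unfold Rabs; destruct (Rcase_abs t); lra. Qed.

Lemma lquat_abs_PI b t : Rabs t = PI -> qeq (lquat (b, PI)) (lquat (b, t)).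
Proof.
  intros [->| ->]%Rabs_eq_PI; [left; auto|right; now rewrite lquat_mPI, qneg_neg].
Qed.

(** An inner half turn can be moved to the front, inverting the letter that it passes; the two outer
    letters then merge into a shorter word of no greater cost. *)
Lemma reduced3_mid_lt_PI N x a b c :
  reduced N [(x, a); (negb x, b); (x, c)] -> Rabs b < PI.
Proof.
  intros H.
  assert (Hb : Rabs b <= PI).
  { apply reduced_letter_le_PI with (N := (N - 1 - 1)%nat) (b := negb x).
    exact (reduced_infix N [(x, a)] [(negb x, b)] [(x, c)] H). }
  destruct (Rle_lt_or_eq_dec _ _ Hb) as [K|K]; auto. exfalso.
  apply (reduced_no_shorter N _ [(negb x, PI); (x, - a + c)] H); simpl.
  - rewrite !qmul_1_r, <- lquat_add, !qmul_assoc.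
    apply qeq_mul; [|apply qeq_refl].
    rewrite <- lquat_PI by (destruct x; discriminate).
    apply qeq_mul; [apply qeq_refl|]. now apply lquat_abs_PI.
  - rewrite (Rabs_right PI) by (generalize PI_RGT_0; lra).
    generalize (Rabs_triang (- a) c); rewrite Rabs_Ropp; lra.
  - lia.
Qed.

(** A final half turn moves past the middle letter, inverting it, and merges with the first one. *)
Lemma reduced3_last_lt_PI N x a b c :
  reduced N [(x, a); (negb x, b); (x, c)] -> Rabs c < PI.
Proof.
  intros H.
  assert (Hb : Rabs c <= PI).
  { apply reduced_letter_le_PI with (N := (N - 2 - 0)%nat) (b := x).
    exact (reduced_infix N [(x, a); (negb x, b)] [(x, c)] [] H). }
  destruct (Rle_lt_or_eq_dec _ _ Hb) as [K|K]; auto. exfalso.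
  apply (reduced_no_shorter N _ [(x, a + PI); (negb x, - b)] H); simpl.
  - rewrite !qmul_1_r, <- lquat_add, <- !qmul_assoc.
    apply qeq_mul; [apply qeq_refl|].
    rewrite <- lquat_PI by (destruct x; discriminate).
    apply qeq_mul; [apply qeq_refl|]. now apply lquat_abs_PI.
  - rewrite Rabs_Ropp, K.
    generalize (Rabs_triang a PI); rewrite (Rabs_right PI) by (generalize PI_RGT_0; lra); lra.
  - lia.
Qed.

(** The hypothesis says that undoing the rotation by [s] after the triple costs at most
    [k * Rabs s - m * s]. Two cases occur: [k = 0] and [m] the sign of the next letter, when that
    letter absorbs [- s]; [k = 1] and [m = 0], when a new letter is inserted. Testing both signs of
    [s] gives the two-sided bound. *)
Lemma slope_bound a b c k m :
  a <> 0 -> b <> 0 -> Rabs b < PI -> c <> 0 ->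
  (exists d, 0 < d /\ forall s a' b' c', Rabs s < d ->
    wprod [(false, a'); (true, b'); (false, c')]
      = wprod [(false, a); (true, b); (false, c); (true, s)] ->
    Rabs a + Rabs b + Rabs c <= Rabs a' + Rabs b' + Rabs c' + k * Rabs s - m * s) ->
  Rabs (slope a b c - m) <= k.
Proof.
  intros Ha Hb Hb' Hc [d [Hd H]]. apply le_epsilon; intros e He.
  destruct (euler_move a b c e) as [d' [Hd' H']]; auto.
  set (s := Rmin d d' / 2).
  assert (Hs : 0 < s /\ s < d /\ s < d').
  { unfold s; generalize (Rmin_pos d d' Hd Hd') (Rmin_l d d') (Rmin_r d d'); lra. }
  assert (As : Rabs s = s) by (apply Rabs_right; lra).
  assert (As' : Rabs (- s) = s) by now rewrite Rabs_Ropp.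
  destruct (H' s) as (a1 & b1 & c1 & E1 & L1); [lra|].
  destruct (H' (- s)) as (a2 & b2 & c2 & E2 & L2); [lra|].
  specialize (H s a1 b1 c1 ltac:(lra) E1) as G1.
  specialize (H (- s) a2 b2 c2 ltac:(lra) E2) as G2.
  rewrite As in *; rewrite As' in *. clear H H' E1 E2.
  unfold Rabs at 1; destruct (Rcase_abs _); nra.
Qed.

(** * Trigonometry of the slope conditions *)

Lemma sign_neq0 x : x <> 0 -> (sign x = 1 \/ sign x = -1) /\ x = sign x * Rabs x.
Proof.
  intros H. destruct (Rtotal_order x 0) as [K|[K|K]]; [|lra|].
  - rewrite sign_eq_m1, Rabs_left; auto; lra.
  - rewrite sign_eq_1, Rabs_right; auto; lra.
Qed.

Lemma sin_sign x : x <> 0 -> sin x = sign x * sin (Rabs x).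
Proof.
  intros H. destruct (sign_neq0 x H) as [[E|E] E']; rewrite E in *; rewrite E' at 1.
  - f_equal; ring_simplify; auto. now rewrite Rmult_1_l.
  - replace (-1 * Rabs x) with (- Rabs x) by ring. rewrite sin_neg; ring.
Qed.

Lemma cos_abs x : cos x = cos (Rabs x).
Proof. unfold Rabs; destruct (Rcase_abs x); [now rewrite cos_neg|auto]. Qed.

(** With the denominator cleared, only sizes and products of signs remain, so the trigonometric
    lemmas below may assume angles in [(0, PI)]. *)
Lemma slope_sin a b c : a <> 0 -> b <> 0 -> Rabs b < PI -> c <> 0 ->
  slope a b c * sin (Rabs b) =
  sign b * (sign a * sign c * sin (Rabs c) + sin (Rabs b - Rabs c)).
Proof.
  intros Ha Hb Hb' Hc. unfold slope.
  assert (0 < sin (Rabs b)) by (apply sin_gt_0; auto; now apply Rabs_pos_lt).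
  rewrite (cos_abs c), (cos_abs b), (sin_sign c), (sin_sign b), sin_minus by auto.
  destruct (sign_neq0 b Hb) as [[E|E] _], (sign_neq0 c Hc) as [[E'|E'] _]; rewrite E, E'; field; lra.
Qed.

Lemma half_angle_products B C :
  let x := C / 2 in let y := (B - C) / 2 in
  sin C + sin (B - C) - sin B = 4 * sin (x + y) * sin x * sin y /\
  - sin C + sin (B - C) + sin B = 4 * sin y * cos (x + y) * cos x /\
  sin C + sin (B - C) + sin B = 4 * sin (x + y) * cos x * cos y /\
  - sin C + sin (B - C) - sin B = - (4 * cos (x + y) * cos y * sin x).
Proof.
  intros x y.
  replace C with (2 * x) by (unfold x; field).
  replace (B - 2 * x) with (2 * y) by (unfold x, y; field).
  replace B with (2 * (x + y)) by (unfold x, y; field).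
  rewrite !sin_2a, !sin_plus, !cos_plus.
  generalize (sin2_cos2' x) (sin2_cos2' y).
  generalize (sin x) (cos x) (sin y) (cos y); intros sx cx sy cy E1 E2.
  assert (E1' : cx ^ 2 = 1 - sx ^ 2) by lra. assert (E2' : cy ^ 2 = 1 - sy ^ 2) by lra.
  repeat split; ring [E1' E2'].
Qed.

(** For [e <> e'] the equation would make a product of positive factors vanish; for [e = e'] the
    only factor that can vanish is [sin y]. *)
Lemma stationary_trig B C e e' :
  0 < B < PI -> 0 < C < PI -> (e = 1 \/ e = -1) -> (e' = 1 \/ e' = -1) ->
  e * sin C + sin (B - C) = e' * sin B -> B = C /\ e = e'.
Proof.
  intros HB HC He He' H.
  destruct (half_angle_products B C) as (P1 & P2 & P3 & P4).
  set (x := C / 2) in *. set (y := (B - C) / 2) in *.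
  assert (0 < sin x) by (apply sin_gt_0; unfold x; lra).
  assert (0 < cos x) by (apply cos_gt_0; unfold x; lra).
  assert (0 < cos y) by (apply cos_gt_0; unfold y; lra).
  assert (0 < sin (x + y)) by (apply sin_gt_0; unfold x, y; lra).
  assert (0 < cos (x + y)) by (apply cos_gt_0; unfold x, y; lra).
  assert (Y : sin y = 0 -> B = C).
  { intros Hy. destruct (Rtotal_order y 0) as [K|[K|K]].
    - assert (0 < sin (- y)) by (apply sin_gt_0; unfold y in *; lra). rewrite sin_neg in *; lra.
    - unfold y in K; lra.
    - assert (0 < sin y) by (apply sin_gt_0; unfold y in *; lra). lra. }
  assert (0 < sin x * cos x) by (apply Rmult_lt_0_compat; auto).
  destruct He as [->| ->], He' as [->| ->]; split; try reflexivity.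
  - apply Y. assert (0 < sin (x + y) * sin x) by (apply Rmult_lt_0_compat; auto). nra.
  - assert (0 < sin (x + y) * cos x * cos y) by (repeat apply Rmult_lt_0_compat; auto). nra.
  - assert (0 < sin (x + y) * cos x * cos y) by (repeat apply Rmult_lt_0_compat; auto). nra.
  - assert (0 < cos (x + y) * cos y * sin x) by (repeat apply Rmult_lt_0_compat; auto). nra.
  - assert (0 < cos (x + y) * cos y * sin x) by (repeat apply Rmult_lt_0_compat; auto). nra.
  - apply Y. assert (0 < cos (x + y) * cos x) by (apply Rmult_lt_0_compat; auto). nra.
Qed.

Lemma sin_nonneg_arg y : - PI < y < PI -> 0 <= sin y -> 0 <= y.
Proof.
  intros Hy H. apply Rnot_lt_le; intros K.
  assert (0 < sin (- y)) by (apply sin_gt_0; lra). rewrite sin_neg in *; lra.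
Qed.

Lemma opposite_slope_trig B C : 0 < B < PI -> 0 < C < PI ->
  - sin B <= - sin C + sin (B - C) -> C <= B.
Proof.
  intros HB HC H.
  destruct (half_angle_products B C) as (_ & P2 & _ & _).
  set (x := C / 2) in *. set (y := (B - C) / 2) in *.
  assert (0 < cos x) by (apply cos_gt_0; unfold x; lra).
  assert (0 < cos (x + y)) by (apply cos_gt_0; unfold x, y; lra).
  assert (0 < cos (x + y) * cos x) by (apply Rmult_lt_0_compat; auto).
  assert (0 <= y); [|unfold y in *; lra].
  apply sin_nonneg_arg; [unfold y; lra|nra].
Qed.

Lemma same_slope_trig B C : 0 < B < PI -> 0 < C < PI ->
  sin C + sin (B - C) <= sin B -> B <= C.
Proof.
  intros HB HC H.
  destruct (half_angle_products B C) as (P1 & _ & _ & _).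
  set (x := C / 2) in *. set (y := (B - C) / 2) in *.
  assert (0 < sin x) by (apply sin_gt_0; unfold x; lra).
  assert (0 < sin (x + y)) by (apply sin_gt_0; unfold x, y; lra).
  assert (0 < sin (x + y) * sin x) by (apply Rmult_lt_0_compat; auto).
  assert (0 <= - y); [|unfold y in *; lra].
  apply sin_nonneg_arg; [unfold y; lra|]. rewrite sin_neg; nra.
Qed.

Lemma sign_mult_pos a c : a <> 0 -> c <> 0 ->
  (sign a * sign c = 1 <-> 0 < a * c) /\ (sign a * sign c = -1 <-> a * c < 0).
Proof.
  intros Ha Hc.
  destruct (Rtotal_order a 0) as [K|[K|K]], (Rtotal_order c 0) as [K'|[K'|K']]; try lra;
  rewrite ?(sign_eq_m1 a), ?(sign_eq_1 a), ?(sign_eq_m1 c), ?(sign_eq_1 c) by auto;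
  repeat split; intros; nra.
Qed.

(** * Signs and sizes of neighbouring letters *)

Definition opposite (x y : R) : Prop := x * y < 0.
Definition same_sign (x y : R) : Prop := 0 < x * y.

Lemma reduced_letters N w : reduced N w -> Forall (fun l => snd l <> 0) w.
Proof.
  intros H. apply Forall_forall. intros [b t] Hin.
  apply in_split in Hin; destruct Hin as (u & v & ->).
  apply (reduced_letter_neq0 (N - length u - length v) b).
  apply (reduced_infix N u [(b, t)] v H).
Qed.

(** Transferring a small rotation from the last letter to the first three keeps the number of
    letters, so minimality in both directions gives [slope a b c = sign d]. The sign pattern and the
    equality of the inner sizes are both read off this one equation. *)
Lemma reduced4_XYXY a b c d : reduced 4 [(false, a); (true, b); (false, c); (true, d)] ->
  Rabs b = Rabs c /\ ((same_sign a c /\ same_sign b d) \/ (opposite a c /\ opposite b d)).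
Proof.
  intros H. generalize (reduced_letters _ _ H); intros F.
  inversion F as [|? ? Ha F1]; inversion F1 as [|? ? Hb F2]; inversion F2 as [|? ? Hc F3];
    inversion F3 as [|? ? Hd F4]; subst; simpl in *; clear F F1 F2 F3 F4.
  assert (Hb' : Rabs b < PI).
  { apply (reduced3_mid_lt_PI (4 - 0 - 1) false a b c).
    exact (reduced_infix 4 [] [(false, a); (true, b); (false, c)] [(true, d)] H). }
  assert (Hc' : Rabs c < PI).
  { apply (reduced3_mid_lt_PI (4 - 1 - 0) true b c d).
    exact (reduced_infix 4 [(false, a)] [(true, b); (false, c); (true, d)] [] H). }
  assert (E : Rabs (slope a b c - sign d) <= 0).
  { apply slope_bound; auto.
    exists (Rabs d); split; [now apply Rabs_pos_lt|].
    intros s a' b' c' Hs E.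
    assert (L : wcost [(false, a); (true, b); (false, c); (true, d)] <=
                wcost [(false, a'); (true, b'); (false, c'); (true, d + - s)]).
    { apply (reduced_no_cheaper 4); auto.
      left.
      change (wprod ([(false, a'); (true, b'); (false, c')] ++ [(true, d + - s)]) =
              wprod ([(false, a); (true, b); (false, c)] ++ [(true, d)])).
      rewrite !wprod_app, E.
      change [(false, a); (true, b); (false, c); (true, s)]
        with ([(false, a); (true, b); (false, c)] ++ [(true, s)]).
      rewrite wprod_app, <- qmul_assoc. f_equal. simpl; rewrite !qmul_1_r, lquat_add.
      do 2 f_equal; ring. }
    simpl in L. rewrite (Rabs_near d (- s)) in L by (rewrite Rabs_Ropp; lra). lra. }
  assert (S0 : slope a b c = sign d).
  { generalize (Rabs_pos (slope a b c - sign d)); intros.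
    apply Rminus_diag_uniq. destruct (Req_dec (slope a b c - sign d) 0) as [Z|Z]; auto.
    apply Rabs_pos_lt in Z; lra. }
  generalize (slope_sin a b c Ha Hb Hb' Hc). rewrite S0; intros T.
  assert (0 < Rabs b) by now apply Rabs_pos_lt. assert (0 < Rabs c) by now apply Rabs_pos_lt.
  destruct (sign_neq0 b Hb) as [Sb _], (sign_neq0 d Hd) as [Sd _],
    (sign_neq0 a Ha) as [Sa _], (sign_neq0 c Hc) as [Sc _].
  destruct (stationary_trig (Rabs b) (Rabs c) (sign a * sign c) (sign b * sign d)) as [E1 E2];
    try lra.
  - destruct Sa as [->| ->], Sc as [->| ->]; lra.
  - destruct Sb as [->| ->], Sd as [->| ->]; lra.
  - destruct Sb as [Eb|Eb]; rewrite Eb in *; lra.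
  - split; auto.
    destruct (sign_mult_pos a c Ha Hc) as [K1 K2], (sign_mult_pos b d Hb Hd) as [K3 K4].
    unfold same_sign, opposite.
    destruct Sa as [Ea|Ea], Sc as [Ec|Ec]; rewrite Ea, Ec in *;
      [left|right|right|left]; split; (apply K1 || apply K2 || apply K3 || apply K4); lra.
Qed.

Lemma reduced4 x y z t a b c d : reduced 4 [(x, a); (y, b); (z, c); (t, d)] ->
  Rabs b = Rabs c /\ ((same_sign a c /\ same_sign b d) \/ (opposite a c /\ opposite b d)).
Proof.
  intros H.
  assert (y = negb x) as ->.
  { eapply reduced_alternate. exact (reduced_infix 4 [] [(x, a); (y, b)] [(z, c); (t, d)] H). }
  assert (z = negb (negb x)) as ->.
  { eapply reduced_alternate. exact (reduced_infix 4 [(x, a)] [(negb x, b); (z, c)] [(t, d)] H). }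
  assert (t = negb (negb (negb x))) as ->.
  { eapply reduced_alternate.
    exact (reduced_infix 4 [(x, a); (negb x, b)] [(negb (negb x), c); (t, d)] [] H). }
  destruct x; [apply reduced_swap in H|]; now apply reduced4_XYXY.
Qed.

(** The third letter is cut into [c'] and [c - c'], and a cancelling pair of Y letters is put into
    the gap: one of them is absorbed by the triple, the other stays and costs at most [Rabs s]. This
    makes five letters. The condition on [c'] says that the cut is free of cost. *)
Lemma reduced3_slope a b c c' : reduced 5 [(false, a); (true, b); (false, c)] ->
  c' <> 0 -> Rabs c' + Rabs (c - c') <= Rabs c -> Rabs (slope a b c') <= 1.
Proof.
  intros H Hc' Hcc. generalize (reduced_letters _ _ H); intros F.
  inversion F as [|? ? Ha F1]; inversion F1 as [|? ? Hb F2]; inversion F2 as [|? ? Hc F3];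
    subst; simpl in *; clear F F1 F2 F3.
  assert (Hb' : Rabs b < PI) by exact (reduced3_mid_lt_PI 5 false a b c H).
  replace (slope a b c') with (slope a b c' - 0) by ring.
  apply slope_bound; auto.
  exists 1; split; [lra|]. intros s a1 b1 c1 Hs E.
  assert (L : wcost [(false, a); (true, b); (false, c)] <=
              wcost [(false, a1); (true, b1); (false, c1); (true, - s); (false, c - c')]).
  { apply (reduced_no_cheaper 5); auto. left.
    change (wprod ([(false, a1); (true, b1); (false, c1)] ++ [(true, - s); (false, c - c')]) =
            wprod ([(false, a); (true, b)] ++ [(false, c)])).
    rewrite !wprod_app, E.
    change [(false, a); (true, b); (false, c'); (true, s)]
      with ([(false, a); (true, b)] ++ [(false, c'); (true, s)]).
    rewrite wprod_app, <- qmul_assoc. f_equal. simpl; rewrite !qmul_1_r, <- !qmul_assoc.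
    rewrite (qmul_assoc (lquat (true, s))), lquat_add, Rplus_opp_r, lquat_0, qmul_1_l, lquat_add.
    do 2 f_equal; ring. }
  simpl in L. rewrite Rabs_Ropp in L. lra.
Qed.

(** The cancelling pair is appended after the last letter, so a single additional letter
    suffices. *)
Lemma reduced3_slope4 a b c : reduced 4 [(false, a); (true, b); (false, c)] ->
  Rabs (slope a b c) <= 1.
Proof.
  intros H. generalize (reduced_letters _ _ H); intros F.
  inversion F as [|? ? Ha F1]; inversion F1 as [|? ? Hb F2]; inversion F2 as [|? ? Hc F3];
    subst; simpl in *; clear F F1 F2 F3.
  assert (Hb' : Rabs b < PI) by exact (reduced3_mid_lt_PI 4 false a b c H).
  replace (slope a b c) with (slope a b c - 0) by ring.
  apply slope_bound; auto.
  exists 1; split; [lra|]. intros s a1 b1 c1 Hs E.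
  assert (L : wcost [(false, a); (true, b); (false, c)] <=
              wcost [(false, a1); (true, b1); (false, c1); (true, - s)]).
  { apply (reduced_no_cheaper 4); auto. left.
    change (wprod ([(false, a1); (true, b1); (false, c1)] ++ [(true, - s)]) =
            wprod ([(false, a); (true, b); (false, c)])).
    rewrite !wprod_app, E.
    change [(false, a); (true, b); (false, c); (true, s)]
      with ([(false, a); (true, b); (false, c)] ++ [(true, s)]).
    rewrite wprod_app, <- qmul_assoc. simpl wprod at 2 3.
    rewrite !qmul_1_r, lquat_add, Rplus_opp_r, lquat_0. apply qmul_1_r. }
  simpl in L. rewrite Rabs_Ropp in L. lra.
Qed.

Lemma reduced3_opposite_XYX a b c : reduced 4 [(false, a); (true, b); (false, c)] ->
  opposite a c -> Rabs c <= Rabs b.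
Proof.
  intros H Hac. generalize (reduced3_slope4 a b c H); intros S.
  generalize (reduced_letters _ _ H); intros F.
  inversion F as [|? ? Ha F1]; inversion F1 as [|? ? Hb F2]; inversion F2 as [|? ? Hc F3];
    subst; simpl in *; clear F F1 F2 F3.
  assert (Hb' : Rabs b < PI) by exact (reduced3_mid_lt_PI 4 false a b c H).
  assert (Hc' : Rabs c < PI) by exact (reduced3_last_lt_PI 4 false a b c H).
  generalize (slope_sin a b c Ha Hb Hb' Hc); intros T.
  rewrite (proj2 (proj2 (sign_mult_pos a c Ha Hc)) Hac) in T.
  assert (0 < Rabs b) by now apply Rabs_pos_lt. assert (0 < Rabs c) by now apply Rabs_pos_lt.
  assert (0 < sin (Rabs b)) by (apply sin_gt_0; auto).
  apply opposite_slope_trig; auto.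
  apply Rabs_le_between in S.
  destruct (sign_neq0 b Hb) as [[Sb|Sb] _]; rewrite Sb in T; nra.
Qed.

(** The slope condition bounds the last letter; the first one is the last letter of the inverse
    word. *)
Lemma reduced3_opposite x y z a b c : reduced 4 [(x, a); (y, b); (z, c)] ->
  opposite a c -> Rabs a <= Rabs b /\ Rabs c <= Rabs b.
Proof.
  intros H Hac.
  assert (y = negb x) as ->.
  { eapply reduced_alternate. exact (reduced_infix 4 [] [(x, a); (y, b)] [(z, c)] H). }
  assert (z = negb (negb x)) as ->.
  { eapply reduced_alternate. exact (reduced_infix 4 [(x, a)] [(negb x, b); (z, c)] [] H). }
  assert (K : forall a b c, reduced 4 [(x, a); (negb x, b); (negb (negb x), c)] ->
    opposite a c -> Rabs c <= Rabs b).
  { intros a' b' c' H' Hac'.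
    destruct x; [apply reduced_swap in H'|]; now apply (reduced3_opposite_XYX a' b' c'). }
  split; [|now apply (K a b c)].
  apply reduced_inv in H. unfold winv, linv in H; simpl in H.
  rewrite Bool.negb_involutive in H.
  rewrite <- (Rabs_Ropp a), <- (Rabs_Ropp b). apply (K (- c)).
  - now rewrite Bool.negb_involutive.
  - unfold opposite in *; lra.
Qed.

(** Near the start of the third letter the slope exceeds 1 in size, so a letter inserted there saves
    more than it costs. *)
Lemma reduced3_same_XYX a b c : reduced 5 [(false, a); (true, b); (false, c)] ->
  same_sign a c -> False.
Proof.
  intros H Hac.
  generalize (reduced_letters _ _ H); intros F.
  inversion F as [|? ? Ha F1]; inversion F1 as [|? ? Hb F2]; inversion F2 as [|? ? Hc F3];
    subst; simpl in *; clear F F1 F2 F3.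
  assert (Hb' : Rabs b < PI) by exact (reduced3_mid_lt_PI 5 false a b c H).
  assert (Hc' : Rabs c < PI) by exact (reduced3_last_lt_PI 5 false a b c H).
  assert (Pb : 0 < Rabs b) by now apply Rabs_pos_lt.
  assert (Pc : 0 < Rabs c) by now apply Rabs_pos_lt.
  (* The cut is made at a distance [m] below both [Rabs b] and [Rabs c], whereas [same_slope_trig]
     would require [Rabs b <= m]. *)
  set (m := Rmin (Rabs b) (Rabs c) / 2).
  assert (Hm : 0 < m /\ m < Rabs b /\ m < Rabs c).
  { unfold m; generalize (Rmin_pos _ _ Pb Pc) (Rmin_l (Rabs b) (Rabs c))
      (Rmin_r (Rabs b) (Rabs c)); lra. }
  destruct (sign_neq0 c Hc) as [Sc Ec].
  set (c1 := sign c * m).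
  assert (Ac : Rabs c1 = m).
  { unfold c1; rewrite Rabs_mult, (Rabs_right m) by lra.
    destruct Sc as [->| ->]; [rewrite Rabs_R1|rewrite Rabs_left by lra]; ring. }
  assert (Hc1 : c1 <> 0) by (intros Z; rewrite Z, Rabs_R0 in Ac; lra).
  assert (Sc1 : sign c1 = sign c).
  { unfold c1; destruct Sc as [->| ->]; [apply sign_eq_1|apply sign_eq_m1]; lra. }
  assert (S : Rabs (slope a b c1) <= 1).
  { apply (reduced3_slope a b c c1 H Hc1). rewrite Ac.
    replace (c - c1) with (sign c * (Rabs c - m)) by (rewrite Ec at 3; unfold c1; ring).
    rewrite Rabs_mult, (Rabs_right (Rabs c - m)) by lra.
    destruct Sc as [->| ->]; [rewrite Rabs_R1|rewrite (Rabs_left (-1)) by lra]; lra. }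
  generalize (slope_sin a b c1 Ha Hb Hb' Hc1); intros T.
  rewrite Sc1, (proj2 (proj1 (sign_mult_pos a c Ha Hc)) Hac), Ac in T.
  assert (0 < sin (Rabs b)) by (apply sin_gt_0; auto).
  apply Rabs_le_between in S.
  assert (Rabs b <= m); [|lra].
  apply same_slope_trig; try lra.
  destruct (sign_neq0 b Hb) as [[Sb|Sb] _]; rewrite Sb in T; nra.
Qed.

Lemma reduced3_same x y z a b c : reduced 5 [(x, a); (y, b); (z, c)] ->
  same_sign a c -> False.
Proof.
  intros H.
  assert (y = negb x) as ->.
  { eapply reduced_alternate. exact (reduced_infix 5 [] [(x, a); (y, b)] [(z, c)] H). }
  assert (z = negb (negb x)) as ->.
  { eapply reduced_alternate. exact (reduced_infix 5 [(x, a)] [(negb x, b); (z, c)] [] H). }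
  destruct x; [apply reduced_swap in H|]; now apply (reduced3_same_XYX a b c).
Qed.

(** * Five alternating letters of the commutator type *)

(** Here [s] and [d] are half the sum and half the difference of the sizes of the Y letters; [d]
    turns only the pair [(q0, q2)] and [s] only the pair [(q1, q3)]. *)
Lemma wprod_YXY s d g :
  wprod [(true, s + d); (false, - (2 * g)); (true, - (s - d))] =
  mkQ (cos g * cos d) (- (sin g * cos s)) (cos g * sin d) (sin g * sin s).
Proof.
  replace (cos d) with (cos ((s + d) / 2 - (s - d) / 2)) by (f_equal; field).
  replace (sin d) with (sin ((s + d) / 2 - (s - d) / 2)) by (f_equal; field).
  replace (cos s) with (cos ((s + d) / 2 + (s - d) / 2)) by (f_equal; field).
  replace (sin s) with (sin ((s + d) / 2 + (s - d) / 2)) by (f_equal; field).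
  rewrite cos_minus, sin_minus, cos_plus, sin_plus.
  simpl wprod; rewrite qmul_1_r. unfold lquat; cbn [fst snd].
  replace (- (2 * g) / 2) with (- g) by field.
  replace (- (s - d) / 2) with (- ((s - d) / 2)) by field.
  rewrite !cos_neg, !sin_neg. unfold qmul; simpl; f_equal; ring.
Qed.

(** Outer X letters only shift the phases [f] and [p]. Hence any two middle words with equal [r] and
    [k] can be exchanged, at the price of a correction of [a] and [e]. *)
Lemma sandwich_X a e r k f p :
  qmul (lquat (false, a)) (qmul (mkQ (r * cos f) (- (r * sin f)) (k * sin p) (k * cos p))
    (lquat (false, e))) =
  mkQ (r * cos ((a + e) / 2 - f)) (r * sin ((a + e) / 2 - f))
      (k * sin (p - (a - e) / 2)) (k * cos (p - (a - e) / 2)).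
Proof.
  rewrite !cos_minus, !sin_minus.
  replace ((a + e) / 2) with (a / 2 + e / 2) by field.
  replace ((a - e) / 2) with (a / 2 - e / 2) by field.
  rewrite cos_plus, sin_plus, cos_minus, sin_minus.
  unfold lquat, qmul; simpl; f_equal; ring.
Qed.

Lemma half_angle_pos t : 0 < t < PI -> 0 < sin (t / 2) /\ 0 < cos (t / 2) /\ 0 < sin t.
Proof.
  intros H; repeat split; [apply sin_gt_0|apply cos_gt_0|apply sin_gt_0]; lra.
Qed.

(* Fibre through [R(tY) R(-tX) R(-tY)]: [y] is the squared sine of half the difference of the
   two outer angles, and the relation on [T = tan] of half the middle angle keeps the moduli of
   both complex coordinates fixed. *)
Lemma fibre_mid t T y : 0 < t < PI -> 0 <= y < 1 -> 0 < T ->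
  T ^ 2 = tan (t / 2) ^ 2 - y / (sin t ^ 2 * cos (t / 2) ^ 2) ->
  let d := atan (sqrt y / sqrt (1 - y)) in
  let f := atan (T * cos t / sqrt (1 - y)) in
  let p := atan (sqrt y / (T * sin t)) in
  let k := sin (t / 2) * sin t in
  let r := sqrt (1 - k ^ 2) in
  wprod [(true, t + d); (false, - (2 * atan T)); (true, - (t - d))] =
  mkQ (r * cos f) (- (r * sin f)) (k * sin p) (k * cos p).
Proof.
  intros Ht Hy HT ET d f p k r.
  destruct (half_angle_pos t Ht) as (Hs & Hc & HS).
  assert (Hy1 : 0 < sqrt (1 - y)) by (apply sqrt_lt_R0; lra).
  assert (E1 : sqrt (1 - y) ^ 2 = 1 - y) by (apply pow2_sqrt; lra).
  assert (E2 : sqrt y ^ 2 = y) by (apply pow2_sqrt; lra).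
  destruct (polar (sqrt (1 - y)) (sqrt y) Hy1) as [Cd Sd]. fold d in Cd, Sd.
  replace (sqrt (sqrt (1 - y) ^ 2 + sqrt y ^ 2)) with 1 in Cd, Sd
    by (rewrite E1, E2; replace (1 - y + y) with 1 by ring; now rewrite sqrt_1).
  rewrite Rmult_1_l in Cd, Sd.
  set (g := atan T).
  destruct (polar 1 T Rlt_0_1) as [Cg Sg]. replace (T / 1) with T in Cg, Sg by field. fold g in Cg, Sg.
  set (n := sqrt (1 ^ 2 + T ^ 2)) in *.
  assert (Hn : 0 < n) by (apply sqrt_lt_R0; nra).
  assert (Hcg : 0 < cos g) by (apply Rmult_lt_reg_l with n; lra).
  assert (Sg' : sin g = T * cos g).
  { apply Rmult_eq_reg_l with n; [|lra]. rewrite <- Sg. rewrite <- Rmult_assoc, (Rmult_comm n T), Rmult_assoc, <- Cg; ring. }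
  assert (Hcg2 : cos g ^ 2 * (1 + T ^ 2) = 1).
  { generalize (sin2_cos2' g). rewrite Sg'; lra. }
  rewrite wprod_YXY. fold g. rewrite <- Cd, <- Sd.
  set (u := sqrt (1 - y)) in *. set (v := sqrt y) in *.
  assert (Hsg : 0 < sin g) by (rewrite Sg'; apply Rmult_lt_0_compat; auto).
  assert (K2 : (sin g * sin t) ^ 2 + (cos g * v) ^ 2 = k ^ 2).
  { unfold k. rewrite Sg'.
    transitivity (cos g ^ 2 * (T ^ 2 * sin t ^ 2 + v ^ 2)); [ring|]. rewrite E2.
    apply Rmult_eq_reg_r with (1 + T ^ 2); [|nra].
    transitivity ((cos g ^ 2 * (1 + T ^ 2)) * (T ^ 2 * sin t ^ 2 + y)); [ring|].
    rewrite Hcg2, ET. unfold tan.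
    assert (C2 : cos (t / 2) ^ 2 = 1 - sin (t / 2) ^ 2) by (generalize (sin2_cos2' (t / 2)); lra).
    field_simplify_eq; [ring [C2]|lra]. }
  assert (Hk : 0 < k) by (apply Rmult_lt_0_compat; auto).
  assert (R2 : (cos g * u) ^ 2 + (sin g * cos t) ^ 2 = 1 - k ^ 2).
  { rewrite <- K2. generalize (sin2_cos2' g) (sin2_cos2' t); intros G1 G2.
    transitivity (cos g ^ 2 * (u ^ 2 + v ^ 2) + sin g ^ 2 * (sin t ^ 2 + cos t ^ 2) -
      ((sin g * sin t) ^ 2 + (cos g * v) ^ 2)); [ring|].
    rewrite G2, E1, E2. lra. }
  destruct (polar (cos g * u) (sin g * cos t)) as [A1 A2]; [now apply Rmult_lt_0_compat|].
  destruct (polar (sin g * sin t) (cos g * v)) as [B1 B2]; [now apply Rmult_lt_0_compat|].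
  replace (sin g * cos t / (cos g * u)) with (T * cos t / u) in A1, A2
    by (rewrite Sg'; field; lra).
  replace (cos g * v / (sin g * sin t)) with (v / (T * sin t)) in B1, B2
    by (rewrite Sg'; field; lra).
  rewrite R2 in A1, A2. rewrite K2, sqrt_pow2 in B1, B2 by lra.
  f_equal; auto. f_equal; auto.
Qed.

(* Up to the positive factor [4 s^3 c (c^2 + s^2 cos(t)^2)], with [s, c] the sine and cosine of
   [t/2], the derivative is [c^2 (4 s^4 c^2 - 1)], negative since [s^4 c^2 <= 4/27]. *)
Lemma fibre_cost_derive t : 0 < t < PI ->
  exists l, l < 0 /\
  is_derive (fun y =>
    let T := sqrt (tan (t / 2) ^ 2 - y / (sin t ^ 2 * cos (t / 2) ^ 2)) in
    atan T + atan (T * cos t / sqrt (1 - y))) 0 l.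
Proof.
  intros Ht. destruct (half_angle_pos t Ht) as (Hs & Hc & HS).
  destruct (half_sin_cos t) as [ES EC].
  set (s := sin (t / 2)) in *. set (c := cos (t / 2)) in *.
  assert (E : s ^ 2 + c ^ 2 = 1) by apply sin2_cos2'.
  set (D := c ^ 2 + s ^ 2 * (c ^ 2 - s ^ 2) ^ 2).
  assert (HD : 0 < D).
  { unfold D. apply Rplus_lt_le_0_compat; [now apply pow_lt|].
    apply Rmult_le_pos; apply pow2_ge_0. }
  assert (Ps : 0 < s ^ 3) by (apply pow_lt; auto).
  exists (c ^ 2 * (4 * s ^ 4 * c ^ 2 - 1) / (4 * s ^ 3 * c * D)); split.
  { assert (s ^ 4 * c ^ 2 <= 4 / 27).
    { replace (c ^ 2) with (1 - s ^ 2) by lra.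
      assert (0 < s ^ 2 < 1) by nra. set (p := s ^ 2) in *.
      replace (s ^ 4) with (p ^ 2) by (unfold p; ring).
      assert (0 <= (p + 1 / 3) * (p - 2 / 3) ^ 2) by (apply Rmult_le_pos; [lra|apply pow2_ge_0]).
      lra. }
    assert (0 < c ^ 2) by (apply pow_lt; auto).
    assert (0 < 4 * s ^ 3 * c * D) by (repeat apply Rmult_lt_0_compat; auto; lra).
    replace (c ^ 2 * (4 * s ^ 4 * c ^ 2 - 1) / (4 * s ^ 3 * c * D)) with
      (- (c ^ 2 * (1 - 4 * s ^ 4 * c ^ 2) / (4 * s ^ 3 * c * D))) by (field; lra).
    apply Ropp_lt_gt_0_contravar. apply Rdiv_lt_0_compat; auto.
    apply Rmult_lt_0_compat; lra. }
  assert (HT : 0 < tan (t / 2)) by (unfold tan; fold s c; now apply Rdiv_lt_0_compat).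
  assert (E0 : sqrt (tan (t / 2) ^ 2) = tan (t / 2)) by (apply sqrt_pow2; lra).
  cbv zeta. auto_derive.
  - replace (tan (t / 2) * (tan (t / 2) * 1) + - (0 * / (sin t * (sin t * 1) * (c * (c * 1)))))
      with (tan (t / 2) ^ 2) by ring.
    replace (1 + - 0) with 1 by ring. rewrite sqrt_1.
    repeat split; try lra; apply pow_lt; auto.
  - replace (tan (t / 2) * (tan (t / 2) * 1) + - (0 * / (sin t * (sin t * 1) * (c * (c * 1)))))
      with (tan (t / 2) ^ 2) by ring.
    replace (1 + - 0) with 1 by ring. rewrite sqrt_1, E0.
    unfold tan; fold s c. rewrite ES, EC.
    assert (c ^ 2 + s ^ 2 <> 0) by lra.
    assert (HD' : c ^ 2 + (s * (c ^ 2 - s ^ 2)) ^ 2 <> 0)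
      by (replace (c ^ 2 + (s * (c ^ 2 - s ^ 2)) ^ 2) with D by (unfold D; ring); lra).
    assert (E' : c ^ 2 = 1 - s ^ 2) by lra.
    unfold D in *.
    field_simplify_eq.
    + ring [E'].
    + repeat split; try lra; nra.
Qed.

Lemma continuity_at_0_small f e : continuity_pt f 0 -> f 0 = 0 -> 0 < e ->
  exists d, 0 < d /\ forall s, Rabs s < d -> Rabs (f s) < e.
Proof.
  intros H Hf He. destruct (H e He) as [d [Hd K]]. exists d; split; auto.
  intros s Hs. destruct (Req_dec s 0) as [->|E].
  - rewrite Hf, Rabs_R0; auto.
  - assert (Hk : R_dist (f s) (f 0) < e).
    { apply K. split; [split; [exact I|auto]|simpl; unfold R_dist; now rewrite Rminus_0_r]. }
    unfold R_dist in Hk; now rewrite Hf, Rminus_0_r in Hk.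
Qed.

(** Along the fibre the outer letters absorb both phases: [p] enters them with opposite signs and
    cancels in the cost, and so does the difference of the two Y letters. What remains is twice
    [atan (T y) + f y], plus a constant, and this decreases in [y]. Since [y] is quadratic in the
    difference of the Y letters, the gain is of second order in the angles. *)
Lemma commutator5_improvable a t e : 0 < a -> 0 < t < PI -> 0 < e ->
  exists w', length w' = 5%nat /\
    wprod w' = wprod [(false, a); (true, t); (false, - t); (true, - t); (false, e)] /\
    wcost w' < wcost [(false, a); (true, t); (false, - t); (true, - t); (false, e)].
Proof.
  intros Ha Ht He. destruct (half_angle_pos t Ht) as (Hs & Hc & HS).
  set (k := sin t ^ 2 * cos (t / 2) ^ 2).
  assert (Hk : 0 < k) by (unfold k; apply Rmult_lt_0_compat; apply pow_lt; auto).
  set (i := fun y => tan (t / 2) ^ 2 - y / k).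
  set (T := fun y => sqrt (i y)).
  set (f := fun y => atan (T y * cos t / sqrt (1 - y))).
  set (p := fun y => atan (sqrt y / (T y * sin t))).
  assert (HT0 : 0 < tan (t / 2)) by (unfold tan; now apply Rdiv_lt_0_compat).
  assert (i0 : i 0 = tan (t / 2) ^ 2) by (unfold i; field; lra).
  assert (T0 : T 0 = tan (t / 2)) by (unfold T; rewrite i0; apply sqrt_pow2; lra).
  assert (p0 : p 0 = 0).
  { unfold p; rewrite sqrt_0. unfold Rdiv; rewrite Rmult_0_l; apply atan_0. }
  assert (Ci : continuity_pt i 0) by (unfold i; reg; lra).
  assert (CT : continuity_pt T 0).
  { apply (continuity_pt_comp i sqrt); auto. apply continuity_pt_sqrt.
    rewrite i0; apply pow2_ge_0. }
  assert (Catan : forall x, continuity_pt atan x).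
  { intros x; apply derivable_continuous_pt, derivable_pt_atan. }
  assert (Cf : continuity_pt f 0).
  { apply (continuity_pt_comp (fun y => T y * cos t / sqrt (1 - y)) atan); auto.
    apply (continuity_pt_div (fun y => T y * cos t) (fun y => sqrt (1 - y))).
    - apply (continuity_pt_mult T (fun _ => cos t)); auto. reg.
    - apply (continuity_pt_comp (fun y => 1 - y) sqrt); [reg|apply continuity_pt_sqrt; lra].
    - rewrite Rminus_0_r, sqrt_1; lra. }
  assert (Cp : continuity_pt p 0).
  { apply (continuity_pt_comp (fun y => sqrt y / (T y * sin t)) atan); auto.
    apply (continuity_pt_div sqrt (fun y => T y * sin t)).
    - apply continuity_pt_sqrt; lra.
    - apply (continuity_pt_mult T (fun _ => sin t)); auto. reg.
    - rewrite T0; apply Rgt_not_eq, Rmult_lt_0_compat; auto. }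
  (* Both phase changes stay below [m], half the smaller outer angle, so the corrected outer letters
     remain positive. *)
  set (m := Rmin a e / 2).
  assert (Hm : 0 < m /\ 2 * m <= a /\ 2 * m <= e).
  { unfold m; generalize (Rmin_pos a e Ha He) (Rmin_l a e) (Rmin_r a e); lra. }
  destruct (continuity_at_0_small (fun y => f y - f 0) m) as [d1 [Hd1 K1]]; try lra.
  { apply (continuity_pt_minus f (fun _ => f 0)); auto. reg. }
  destruct (continuity_at_0_small p m) as [d2 [Hd2 K2]]; try lra; auto.
  set (q := fun y => atan (sqrt y / sqrt (1 - y))).
  assert (Cq : continuity_pt q 0).
  { apply (continuity_pt_comp (fun y => sqrt y / sqrt (1 - y)) atan); auto.
    apply (continuity_pt_div sqrt (fun y => sqrt (1 - y))).
    - apply continuity_pt_sqrt; lra.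
    - apply (continuity_pt_comp (fun y => 1 - y) sqrt); [reg|apply continuity_pt_sqrt; lra].
    - rewrite Rminus_0_r, sqrt_1; lra. }
  (* The difference of the Y letters stays below [t], so neither of them changes sign. *)
  destruct (continuity_at_0_small q t) as [d5 [Hd5 K5]]; try lra; auto.
  { unfold q; rewrite sqrt_0. unfold Rdiv; rewrite Rmult_0_l; apply atan_0. }
  destruct (continuity_pos i 0) as [d3 [Hd3 K3]]; auto.
  { rewrite i0; apply pow_lt; auto. }
  destruct (fibre_cost_derive t Ht) as (l & Hl & Dl).
  (* The error may consume half of the slope [l]; a strict decrease is left. *)
  destruct (derive_expansion _ _ Dl (- l / 2)) as [d4 [Hd4 K4]]; [lra|].
  cbv zeta in K4. fold k in K4.
  set (d := Rmin (Rmin d1 d2) (Rmin (Rmin d3 d4) (Rmin d5 1))).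
  assert (Hd : 0 < d) by (unfold d; repeat apply Rmin_pos; lra).
  set (y := d / 2).
  assert (Hy : 0 < y /\ y < d1 /\ y < d2 /\ y < d3 /\ y < d4 /\ y < d5 /\ y < 1).
  { unfold y, d in *.
    generalize (Rmin_l (Rmin d1 d2) (Rmin (Rmin d3 d4) (Rmin d5 1)))
      (Rmin_r (Rmin d1 d2) (Rmin (Rmin d3 d4) (Rmin d5 1)))
      (Rmin_l (Rmin d3 d4) (Rmin d5 1)) (Rmin_r (Rmin d3 d4) (Rmin d5 1))
      (Rmin_l d1 d2) (Rmin_r d1 d2) (Rmin_l d3 d4) (Rmin_r d3 d4) (Rmin_l d5 1) (Rmin_r d5 1).
    lra. }
  assert (Ay : Rabs y = y) by (apply Rabs_right; lra).
  specialize (K1 y ltac:(lra)). specialize (K2 y ltac:(lra)).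
  specialize (K3 y ltac:(rewrite Rminus_0_r; lra)). specialize (K4 y ltac:(lra)). specialize (K5 y ltac:(lra)).
  change (Rabs ((atan (T y) + f y) - (atan (T 0) + f 0) - l * y) <= - l / 2 * Rabs y) in K4.
  assert (G : atan (T y) + f y < atan (T 0) + f 0).
  { rewrite Ay in K4. apply Rabs_le_between in K4. nra. }
  apply Rabs_lt_between in K1. apply Rabs_lt_between in K2. apply Rabs_lt_between in K5.
  set (dl := q y) in *.
  assert (HT : 0 < T y) by (apply sqrt_lt_R0; auto).
  assert (ET : T y ^ 2 = tan (t / 2) ^ 2 - y / k) by (unfold T; rewrite pow2_sqrt; auto; lra).
  generalize (fibre_mid t (T y) y Ht ltac:(lra) HT ET); intros M.
  assert (HT0' : 0 < T 0) by (rewrite T0; auto).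
  generalize (fibre_mid t (T 0) 0 Ht ltac:(lra) HT0' ltac:(rewrite T0; fold k; field; lra)); intros M0.
  cbv zeta in M, M0. fold (q y) in M. fold dl in M. fold (f y) in M. fold (p y) in M. fold (f 0) in M0. fold (p 0) in M0.
  rewrite p0 in M0. rewrite Rminus_0_r, sqrt_0, sqrt_1 in M0.
  replace (0 / 1) with 0 in M0 by field. rewrite atan_0, Rplus_0_r, Rminus_0_r in M0.
  assert (AT0 : 2 * atan (T 0) = t) by (rewrite T0, atan_tan by lra; field).
  rewrite AT0 in M0.
  exists [(false, a + (f y - f 0) + p y); (true, t + dl); (false, - (2 * atan (T y)));
     (true, - (t - dl)); (false, e + (f y - f 0) - p y)].
  assert (W : forall u v x1 x2 x3 : bool * R, wprod [u; x1; x2; x3; v] =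
    qmul (lquat u) (qmul (wprod [x1; x2; x3]) (lquat v))).
  { intros; simpl; now rewrite !qmul_1_r, <- !qmul_assoc. }
  split; [reflexivity|split].
  - rewrite !W, M, M0, !sandwich_X. f_equal; do 2 f_equal; field.
  - simpl.
    assert (0 < atan (T y)) by (rewrite <- atan_0; now apply atan_increasing).
    rewrite !Rabs_Ropp, (Rabs_right (a + _ + _)), (Rabs_right (t + dl)), (Rabs_right (2 * _)),
      (Rabs_right (t - dl)), (Rabs_right (e + _ - _)), (Rabs_right a), (Rabs_right t),
      (Rabs_right e) by lra.
    lra.
Qed.

(** The two windows of four letters leave only the pattern [a, b, -b, -b, e], which is the
    improvable one. *)
Lemma reduced5_positive a b c d e :
  reduced 5 [(false, a); (true, b); (false, c); (true, d); (false, e)] ->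
  opposite a c -> 0 < a -> 0 < b -> False.
Proof.
  intros H Hac Ha Hb.
  destruct (reduced4 _ _ _ _ _ _ _ _
    (reduced_infix 5 [] [(false, a); (true, b); (false, c); (true, d)] [(false, e)] H))
    as [E1 S1].
  destruct (reduced4 _ _ _ _ _ _ _ _
    (reduced_infix 5 [(false, a)] [(true, b); (false, c); (true, d); (false, e)] [] H))
    as [E2 S2].
  assert (Hb' : Rabs b < PI).
  { apply (reduced3_mid_lt_PI 3 false a b c).
    exact (reduced_infix 5 [] [(false, a); (true, b); (false, c)] [(true, d); (false, e)] H). }
  unfold same_sign, opposite in *.
  destruct S1 as [[S1 _]|[_ S1]]; [lra|]. destruct S2 as [[S2 _]|[_ S2]]; [lra|].
  assert (c < 0) by nra. assert (d < 0) by nra. assert (0 < e) by nra.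
  rewrite (Rabs_right b), ?(Rabs_left c), ?(Rabs_left d) in * by lra.
  replace c with (- b) in * by lra. replace d with (- b) in * by lra.
  destruct (commutator5_improvable a b e) as (w' & L & P & C); try lra.
  assert (wcost [(false, a); (true, b); (false, - b); (true, - b); (false, e)] <= wcost w').
  { apply (reduced_no_cheaper 5); auto; [rewrite L; auto|left; auto]. }
  lra.
Qed.

Lemma reduced5_opposite x1 x2 x3 x4 x5 a b c d e :
  reduced 5 [(x1, a); (x2, b); (x3, c); (x4, d); (x5, e)] -> opposite a c -> False.
Proof.
  intros H Hac.
  assert (E2 : x2 = negb x1).
  { eapply reduced_alternate. exact (reduced_infix 5 [] [(x1, a); (x2, b)] [(x3, c); (x4, d); (x5, e)] H). }
  assert (E3 : x3 = negb x2).
  { eapply reduced_alternate. exact (reduced_infix 5 [(x1, a)] [(x2, b); (x3, c)] [(x4, d); (x5, e)] H). }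
  assert (E4 : x4 = negb x3).
  { eapply reduced_alternate. exact (reduced_infix 5 [(x1, a); (x2, b)] [(x3, c); (x4, d)] [(x5, e)] H). }
  assert (E5 : x5 = negb x4).
  { eapply reduced_alternate. exact (reduced_infix 5 [(x1, a); (x2, b); (x3, c)] [(x4, d); (x5, e)] [] H). }
  assert (H0 : reduced 5 [(false, a); (true, b); (false, c); (true, d); (false, e)]).
  { subst. destruct x1; [apply reduced_swap in H|]; exact H. }
  clear - H0 Hac.
  assert (Hb : b <> 0).
  { apply (reduced_letter_neq0 1 true).
    exact (reduced_infix 5 [(false, a)] [(true, b)] [(false, c); (true, d); (false, e)] H0). }
  assert (K : forall a b c d e,
    reduced 5 [(false, a); (true, b); (false, c); (true, d); (false, e)] ->
    opposite a c -> 0 < a -> b <> 0 -> False).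
  { intros a' b' c' d' e' H' Hac' Ha' Hb'. destruct (Rlt_le_dec 0 b').
    - eapply reduced5_positive; eauto.
    - apply reduced_flip in H'.
      apply (reduced5_positive a' (- b') c' (- d') e'); auto; lra. }
  destruct (Rlt_le_dec 0 a) as [Ha|Ha]; [eapply K; eauto|].
  (* A flip between two swaps reverses the X axis. *)
  apply reduced_swap, reduced_flip, reduced_swap in H0.
  unfold opposite in Hac. assert (a <> 0) by (intros Z; rewrite Z in Hac; lra).
  refine (K (- a) b (- c) d (- e) H0 _ _ _); auto; [unfold opposite|]; lra.
Qed.

(** * Structure of reduced words *)

Fixpoint alternating (n : nat) (u v : letter) : list letter :=
  match n with O => [] | S n => u :: alternating n v u end.

Lemma reduced_tail N l w : reduced (S N) (l :: w) -> reduced N w.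
Proof.
  intros H. generalize (reduced_infix (S N) [l] w []). rewrite app_nil_r; simpl.
  intros K. specialize (K H). now replace (N - 0 - 0)%nat with N in K by lia.
Qed.

Lemma same_sign_abs_eq x y : same_sign x y -> Rabs x = Rabs y -> x = y.
Proof.
  unfold same_sign, Rabs; destruct (Rcase_abs x), (Rcase_abs y); intros; try lra; nra.
Qed.

(** Overlapping windows of four letters transport size and sign along the word, so every letter
    strictly inside is [b] or [c]. The last letter is never in an inner position of a window; only
    its sign is determined. *)
Lemma reduced_same_alternating N x y z t a b c d w :
  reduced N ((x, a) :: (y, b) :: (z, c) :: (t, d) :: w) -> same_sign a c ->
  exists e, (x, a) :: (y, b) :: (z, c) :: (t, d) :: w =
    (x, a) :: alternating (2 + length w) (negb x, b) (x, c) ++ [e] /\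
    fst e = (if Nat.even (length w) then negb x else x) /\
    same_sign (snd e) (if Nat.even (length w) then b else c) /\ Rabs b = Rabs c.
Proof.
  revert N x y z t a b c d; induction w as [|[t' d'] w IH]; intros N x y z t a b c d H Hs.
  - assert (H4 : reduced 4 [(x, a); (y, b); (z, c); (t, d)]).
    { apply (reduced_mono N); [apply H|simpl; lia|exact H]. }
    destruct (reduced4 _ _ _ _ _ _ _ _ H4) as [E [[_ S]|[S _]]];
      [|unfold same_sign, opposite in *; lra].
    assert (y = negb x) as ->.
    { eapply reduced_alternate. exact (reduced_infix 4 [] [(x, a); (y, b)] [(z, c); (t, d)] H4). }
    assert (z = negb (negb x)) as ->.
    { eapply reduced_alternate.
      exact (reduced_infix 4 [(x, a)] [(negb x, b); (z, c)] [(t, d)] H4). }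
    assert (t = negb (negb (negb x))) as ->.
    { eapply reduced_alternate.
      exact (reduced_infix 4 [(x, a); (negb x, b)] [(negb (negb x), c); (t, d)] [] H4). }
    rewrite !Bool.negb_involutive. exists (negb x, d); simpl. repeat split; auto.
    unfold same_sign in *; lra.
  - assert (H4 : reduced 4 [(x, a); (y, b); (z, c); (t, d)]).
    { apply (reduced_mono (N - 0 - S (length w))).
      - destruct H as [H _]; simpl in H; lia.
      - simpl; lia.
      - exact (reduced_infix N [] [(x, a); (y, b); (z, c); (t, d)] ((t', d') :: w) H). }
    destruct (reduced4 _ _ _ _ _ _ _ _ H4) as [E [[_ S]|[S _]]];
      [|unfold same_sign, opposite in *; lra].
    assert (y = negb x) as ->.
    { eapply reduced_alternate. exact (reduced_infix 4 [] [(x, a); (y, b)] [(z, c); (t, d)] H4). }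
    assert (H' : reduced (N - 1) ((negb x, b) :: (z, c) :: (t, d) :: (t', d') :: w)).
    { destruct N as [|N]; [destruct H as [H _]; simpl in H; lia|].
      simpl; rewrite Nat.sub_0_r; now apply reduced_tail in H. }
    destruct (reduced4 _ _ _ _ _ _ _ _ (reduced_mono (N - 1 - 0 - length w) 4
      [(negb x, b); (z, c); (t, d); (t', d')]
      ltac:(destruct H as [H _]; simpl in H; lia) ltac:(simpl; lia)
      (reduced_infix (N - 1) [] [(negb x, b); (z, c); (t, d); (t', d')] w H'))) as [Ecd _].
    (* In the second window [d] is an inner letter, so it has the size of [c], hence of [b]; the
       first window gives its sign. *)
    replace d with b in * by (apply same_sign_abs_eq; auto; congruence).
    destruct (IH _ _ _ _ _ _ _ _ _ H') as (e & E1 & E2 & E3 & E4); auto.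
    exists e. rewrite Bool.negb_involutive in *. split; [|split; [|split]]; auto.
    + rewrite E1. reflexivity.
    + simpl length. rewrite Nat.even_succ, <- Nat.negb_even, E2.
      destruct (Nat.even (length w)); auto.
    + simpl length. rewrite Nat.even_succ, <- Nat.negb_even.
      destruct (Nat.even (length w)); simpl in *; auto.
Qed.

(** * Compactness *)

(** Closedness for an arbitrary nearness relation: [near_pair] can then add real parameters one at a
    time, and [closed_projection] remove them again. *)
Definition closed_for {A : Type} (near : R -> A -> A -> Prop) (S : A -> Prop) : Prop :=
  forall a, (forall e, 0 < e -> exists a', near e a a' /\ S a') -> S a.

Definition monotone_near {A : Type} (near : R -> A -> A -> Prop) : Prop :=
  forall e e' a a', e <= e' -> near e a a' -> near e' a a'.

Definition near_pair {A : Type} (near : R -> A -> A -> Prop) (e : R) (x y : R * A) : Prop :=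
  Rabs (fst x - fst y) < e /\ near e (snd x) (snd y).

Definition qnear (e : R) (x y : quat * R) : Prop :=
  qabs (qsub (fst x) (fst y)) < e /\ Rabs (snd x - snd y) < e.

Lemma qnear_monotone : monotone_near qnear.
Proof. intros e e' a a' H [H1 H2]; split; lra. Qed.

Lemma near_pair_monotone {A : Type} (near : R -> A -> A -> Prop) :
  monotone_near near -> monotone_near (near_pair near).
Proof. intros Hm e e' a a' H [H1 H2]; split; [lra|now apply (Hm e)]. Qed.

Lemma bounded_cluster (u : nat -> R) B : (forall n, Rabs (u n) <= B) ->
  exists l, forall e N, 0 < e -> exists n, (N <= n)%nat /\ Rabs (l - u n) < e.
Proof.
  intros H.
  destruct (Bolzano_Weierstrass u (fun x => - B <= x <= B)) as [l Hl].
  - apply compact_P3.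
  - intros n; now apply Rabs_le_between.
  - exists l. intros e N He.
    destruct (Hl (fun x => Rabs (l - x) < e) N) as [n Hn]; [|now exists n].
    exists (mkposreal e He). intros x Hx. unfold disc in Hx; simpl in Hx.
    now rewrite Rabs_minus_sym.
Qed.

(** The fibre coordinate of the approximants is bounded near [a], so Bolzano-Weierstrass supplies a
    limit for it. *)
Lemma closed_projection {A : Type} (near : R -> A -> A -> Prop) (S : R -> A -> Prop) :
  monotone_near near ->
  closed_for (near_pair near) (fun x => S (fst x) (snd x)) ->
  (forall a, exists B, forall t a', near 1 a a' -> S t a' -> Rabs t <= B) ->
  closed_for near (fun a => exists t, S t a).
Proof.
  intros Hm Hc Hb a Ha. destruct (Hb a) as [B HB].
  assert (Hn : forall n : nat, exists x : R * A,
    near (/ (INR n + 1)) a (snd x) /\ S (fst x) (snd x)).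
  { intros n. destruct (Ha (/ (INR n + 1))) as (a' & Hn & t & HS).
    - apply Rinv_0_lt_compat; generalize (pos_INR n); lra.
    - now exists (t, a'). }
  apply choice in Hn. destruct Hn as [u Hu].
  destruct (bounded_cluster (fun n => fst (u n)) B) as [l Hl].
  { intros n. destruct (Hu n) as [H1 H2]. apply (HB _ (snd (u n))); auto.
    apply (Hm (/ (INR n + 1))); auto.
    rewrite <- Rinv_1. apply Rinv_le_contravar; [lra|]. generalize (pos_INR n); lra. }
  exists l. apply (Hc (l, a)). intros e He.
  destruct (INR_unbounded (/ e)) as [N HN].
  destruct (Hl e N He) as (n & Hn & Hln).
  exists (u n). destruct (Hu n) as [H1 H2]. split; auto. split; simpl; auto.
  apply (Hm (/ (INR n + 1))); auto.
  rewrite <- (Rinv_inv e). apply Rinv_le_contravar; [now apply Rinv_0_lt_compat|].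
  apply le_INR in Hn. lra.
Qed.

(** If [a] misses the first closed set, it does so with a radius [e0]; approximants closer than that
    come from the remaining sets. *)
Lemma closed_exists_list {A I : Type} (near : R -> A -> A -> Prop) (S : I -> A -> Prop) (L : list I) :
  monotone_near near ->
  (forall i, In i L -> closed_for near (S i)) ->
  closed_for near (fun a => exists i, In i L /\ S i a).
Proof.
  intros Hm; induction L as [|i L IH]; intros H a Ha.
  - destruct (Ha 1 Rlt_0_1) as (a' & _ & i & [] & _).
  - destruct (classic (S i a)) as [K|K]; [exists i; split; simpl; auto|].
    assert (K1 : exists e0, 0 < e0 /\ forall a', near e0 a a' -> ~ S i a').
    { apply NNPP; intros K1. apply K. apply (H i (or_introl eq_refl)). intros e He.
      apply NNPP; intros K2. apply K1. exists e; split; auto.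
      intros a' Hn HS; apply K2; now exists a'. }
    destruct K1 as (e0 & He0 & K1).
    destruct (IH (fun j Hj => H j (or_intror Hj)) a) as (j & Hj & HS).
    + intros e He. destruct (Ha (Rmin e e0)) as (a' & Hn & j & [<-|Hj] & HS).
      * now apply Rmin_pos.
      * exfalso. apply (K1 a'); auto. apply (Hm (Rmin e e0)); auto. apply Rmin_r.
      * exists a'; split; [|now exists j]. apply (Hm (Rmin e e0)); auto. apply Rmin_l.
    + exists j; split; simpl; auto.
Qed.

Lemma closed_has_min (S : R -> Prop) :
  (exists c, S c) -> (forall c, S c -> 0 <= c) ->
  (forall c, (forall e, 0 < e -> exists c', Rabs (c - c') < e /\ S c') -> S c) ->
  exists m, S m /\ forall c, S c -> m <= c.
Proof.
  intros [c0 H0] Hp Hc.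
  destruct (completeness (fun x => S (- x))) as [l [Hl1 Hl2]].
  - exists 0. intros x Hx. specialize (Hp _ Hx). lra.
  - exists (- c0). now rewrite Ropp_involutive.
  - exists (- l); split.
    + apply Hc. intros e He. apply NNPP; intros K.
      assert (l <= l - e); [|lra].
      apply Hl2. intros x Hx. apply Rnot_lt_le; intros Hx'. apply K.
      exists (- x); split; auto. specialize (Hl1 x Hx).
      apply Rabs_def1; lra.
    + intros c H. assert (- c <= l); [|lra]. apply Hl1. now rewrite Ropp_involutive.
Qed.

(** * Lipschitz bounds, and closedness of the set of words of bounded length *)

Lemma Rabs_sin_le x : Rabs (sin x) <= Rabs x.
Proof.
  assert (P : forall x, 0 <= x -> Rabs (sin x) <= x).
  { intros y Hy. generalize (SIN_bound y); intros B.
    destruct (Rle_lt_dec 1 y) as [K|K]; [apply Rabs_le; lra|].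
    assert (0 <= sin y) by (apply sin_ge_0; generalize PI2_1; lra).
    rewrite Rabs_right by lra.
    destruct (Rle_lt_or_eq_dec 0 y Hy) as [Z|<-]; [|rewrite sin_0; lra].
    now apply Rlt_le, sin_lt_x. }
  unfold Rabs at 2; destruct (Rcase_abs x).
  - rewrite <- (Rabs_Ropp (sin x)), <- sin_neg. apply P; lra.
  - apply P; lra.
Qed.

Lemma sin_lipschitz x y : Rabs (sin x - sin y) <= Rabs (x - y).
Proof.
  rewrite form4, !Rabs_mult, (Rabs_right 2) by lra.
  generalize (Rabs_sin_le ((x - y) / 2)); unfold Rdiv at 2. rewrite Rabs_mult, (Rabs_right (/ 2)) by lra.
  assert (Rabs (cos ((x + y) / 2)) <= 1) by (apply Rabs_le, COS_bound).
  generalize (Rabs_pos (sin ((x - y) / 2))) (Rabs_pos (cos ((x + y) / 2))). nra.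
Qed.

Lemma cos_lipschitz x y : Rabs (cos x - cos y) <= Rabs (x - y).
Proof.
  rewrite !cos_sin. eapply Rle_trans; [apply sin_lipschitz|]. right; f_equal; ring.
Qed.

Lemma lquat_lipschitz b s t : qabs (qsub (lquat (b, s)) (lquat (b, t))) <= Rabs (s - t).
Proof.
  generalize (sin_lipschitz (s / 2) (t / 2)) (cos_lipschitz (s / 2) (t / 2)).
  replace (s / 2 - t / 2) with ((s - t) * / 2) by field.
  rewrite Rabs_mult, (Rabs_right (/ 2)) by lra.
  unfold lquat, qabs, qsub; destruct b; simpl; rewrite Rminus_0_r, Rabs_R0; lra.
Qed.

Lemma qmul_closed_map (S : quat * R -> Prop) (u : R -> quat) (v : R -> R) K :
  (forall t, qunit (u t)) ->
  (forall s t, qabs (qsub (u s) (u t)) <= K * Rabs (s - t)) ->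
  (forall s t, Rabs (v s - v t) <= K * Rabs (s - t)) ->
  0 <= K -> closed_for qnear S ->
  closed_for (near_pair qnear)
    (fun x => S (qmul (u (fst x)) (fst (snd x)), snd (snd x) - v (fst x))).
Proof.
  intros Hu Lu Lv HK HS [t [q c]] H; simpl in *. apply HS. intros e He.
  (* [M] dominates both error rates, [2 + K * qabs q] for the quaternion and [1 + K] for the
     cost. *)
  set (M := 3 + K * (qabs q + 2)).
  assert (HM : 0 < M) by (generalize (qabs_pos q); unfold M; nra).
  destruct (H (Rmin 1 (e / M))) as ([t' [q' c']] & [H1 [H2 H3]] & H4).
  { apply Rmin_pos; [lra|now apply Rdiv_lt_0_compat]. }
  simpl in *. set (d := Rmin 1 (e / M)) in *.
  assert (Hd1 : d <= 1) by apply Rmin_l.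
  assert (Hd2 : d * M <= e).
  { assert (d <= e / M) by apply Rmin_r. apply (Rmult_le_compat_r M) in H0; [|lra].
    replace (e / M * M) with e in H0 by (field; lra). auto. }
  exists (qmul (u t') q', c' - v t'); split; auto.
  specialize (Lu t t'). specialize (Lv t t').
  generalize (Rabs_pos (t - t')) (qabs_pos q); intros P1 P2.
  split; simpl.
  - eapply Rle_lt_trans; [apply (qabs_triangle _ (qmul (u t') q))|].
    rewrite qsub_mul_r, qsub_mul_l.
    generalize (qabs_mul (qsub (u t) (u t')) q) (qabs_mul (u t') (qsub q q'))
      (qunit_qabs _ (Hu t')) (qabs_pos (qsub q q')) (qabs_pos (u t')) (qabs_pos (qsub (u t) (u t'))).
    intros A1 A2 A3 A4 A5 A6.
    assert (qabs (qsub (u t) (u t')) * qabs q <= K * d * qabs q).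
    { apply Rmult_le_compat_r; auto. eapply Rle_trans; [apply Lu|]. nra. }
    assert (qabs (u t') * qabs (qsub q q') <= 2 * qabs (qsub q q')) by nra.
    assert (0 < d) by lra.
    assert (0 <= K * d) by nra.
    unfold M in Hd2. nra.
  - replace (c - v t - (c' - v t')) with ((c - c') + - (v t - v t')) by ring.
    eapply Rle_lt_trans; [apply Rabs_triang|]. rewrite Rabs_Ropp.
    assert (0 < d) by lra.
    assert (0 <= K * d * qabs q) by (apply Rmult_le_pos; nra).
    assert (K * Rabs (t - t') <= K * d) by (apply Rmult_le_compat_l; lra).
    unfold M in Hd2. nra.
Qed.

(** The epigraph of the least cost: the inequality turns that cost into the minimum of a section. *)
Definition word_reach (N : nat) (x : quat * R) : Prop :=
  exists w, (length w <= N)%nat /\ qeq (wprod w) (fst x) /\ wcost w <= snd x.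

Lemma qeq_closed p q :
  (forall e, 0 < e -> exists p' q', qabs (qsub p p') < e /\ qabs (qsub q q') < e /\ qeq p' q') ->
  qeq p q.
Proof.
  intros H.
  destruct (classic (p = q)) as [K|K]; [now left|].
  right. apply NNPP; intros K'.
  assert (P : forall p q, p <> q -> 0 < qabs (qsub p q)).
  { intros a b Hab.
    destruct (Rle_lt_or_eq_dec 0 _ (qabs_pos (qsub a b))) as [Z|Z]; auto.
    exfalso; apply Hab, qabs_qsub_0. intros; lra. }
  apply P in K. apply P in K'. set (e1 := qabs (qsub p q)) in *. set (e2 := qabs (qsub p (qneg q))) in *.
  destruct (H (Rmin e1 e2 / 2)) as (p' & q' & Hp & Hq & Hpq).
  { generalize (Rmin_pos _ _ K K'); lra. }
  generalize (Rmin_l e1 e2) (Rmin_r e1 e2); intros.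
  destruct Hpq as [->| ->].
  - generalize (qabs_triangle p q' q). rewrite (qabs_sub_sym q' q). fold e1. lra.
  - generalize (qabs_triangle p (qneg q') (qneg q)). fold e2.
    replace (qabs (qsub (qneg q') (qneg q))) with (qabs (qsub q q')); [lra|].
    unfold qabs, qsub, qneg; simpl.
    replace (- q0 q' - - q0 q) with (q0 q - q0 q') by ring.
    replace (- q1 q' - - q1 q) with (q1 q - q1 q') by ring.
    replace (- q2 q' - - q2 q) with (q2 q - q2 q') by ring.
    now replace (- q3 q' - - q3 q) with (q3 q - q3 q') by ring.
Qed.

Lemma qabs_sub_diag p : qabs (qsub p p) = 0.
Proof. unfold qabs, qsub; simpl. rewrite !Rminus_diag, Rabs_R0. ring. Qed.

(** Induction by splitting off the first letter: [None] stands for one letter fewer, [Some b] for a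
    first letter about the axis [b]. The angle of that letter is bounded by the cost, so it can be
    projected away. *)
Lemma word_reach_closed N : closed_for qnear (word_reach N).
Proof.
  induction N as [|N IH].
  - intros [q c] H. exists []; simpl. split; [auto|split].
    + apply qeq_closed. intros e He. destruct (H e He) as ([q' c'] & [H1 H2] & w & L & E & _).
      destruct w; [|simpl in L; lia]. exists qone, q'. rewrite qabs_sub_diag. auto.
    + apply le_epsilon. intros e He. destruct (H e He) as ([q' c'] & [H1 H2] & w & L & _ & E).
      simpl in *. generalize (wcost_pos w). apply Rabs_lt_between in H2. lra.
  - assert (K : closed_for qnear (fun x => exists i : option bool, In i [None; Some false; Some true] /\
      match i with None => word_reach N x
      | Some b => exists t, word_reach N (qmul (lquat (b, - t)) (fst x), snd x - Rabs t) end)).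
    { apply closed_exists_list; [apply qnear_monotone|].
      intros [b|] _; auto.
      apply (closed_projection qnear (fun t x =>
        word_reach N (qmul (lquat (b, - t)) (fst x), snd x - Rabs t))).
      - apply qnear_monotone.
      - apply (qmul_closed_map _ (fun t => lquat (b, - t)) Rabs 1); auto; try lra.
        + intros; apply lquat_unit.
        + intros s t. eapply Rle_trans; [apply lquat_lipschitz|]. rewrite Rmult_1_l.
          right. rewrite <- Rabs_Ropp. f_equal; ring.
        + intros s t. rewrite Rmult_1_l. apply Rabs_triang_inv2.
      - intros [q c]. exists (c + 1). intros t [q' c'] [_ H] (w & _ & _ & Hw). simpl in *.
        generalize (wcost_pos w). apply Rabs_lt_between in H. lra. }
    intros x Hx.
    assert (Hx' : forall e, 0 < e -> exists x', qnear e x x' /\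
      exists i : option bool, In i [None; Some false; Some true] /\
      match i with None => word_reach N x'
      | Some b => exists t, word_reach N (qmul (lquat (b, - t)) (fst x'), snd x' - Rabs t) end).
    { intros e He. destruct (Hx e He) as (x' & Hn & w & L & E & C). exists x'; split; auto.
      destruct w as [|[b t] w].
      - exists None; split; [simpl; auto|]. exists []; simpl in *; split; [lia|auto].
      - exists (Some b); split; [destruct b; simpl; auto|]. exists t, w; simpl in *.
        split; [lia|split; [|lra]].
        rewrite lquat_neg_conj. apply (qeq_mul (qconj (lquat (b, t))) _ _ _ (qeq_refl _)) in E.
        now rewrite qmul_assoc, qconj_mul_l, qmul_1_l in E by apply lquat_unit. }
    destruct (K x Hx') as ([b|] & _ & H).
    + destruct H as (t & w & L & E & C). exists ((b, t) :: w); simpl in *.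
      split; [lia|split; [|lra]].
      apply (qeq_mul (lquat (b, t)) _ _ _ (qeq_refl _)) in E.
      now rewrite lquat_neg_conj, qmul_assoc, qconj_mul_r, qmul_1_l in E by apply lquat_unit.
    + destruct H as (w & L & E & C). exists w; split; [lia|auto].
Qed.

(** The least cost exists by closedness; among its minimisers the least length exists because
    lengths are natural numbers. *)
Lemma exists_reduced N w0 : (length w0 <= N)%nat ->
  exists w, reduced N w /\ qeq (wprod w) (wprod w0) /\ wcost w <= wcost w0.
Proof.
  intros H0.
  destruct (closed_has_min (fun c => word_reach N (wprod w0, c))) as (m & (w1 & L1 & E1 & C1) & Hm).
  - exists (wcost w0), w0; simpl; split; [auto|split; [apply qeq_refl|lra]].
  - intros c (w & _ & _ & C); simpl in C. generalize (wcost_pos w); lra.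
  - intros c Hc. apply word_reach_closed. intros e He. destruct (Hc e He) as (c' & Hn & Hr).
    exists (wprod w0, c'); split; auto. split; simpl; auto.
    rewrite qabs_sub_diag; auto.
  - simpl in *.
    assert (Hm' : forall w, (length w <= N)%nat -> qeq (wprod w) (wprod w0) -> m <= wcost w).
    { intros w L E. apply Hm. exists w; simpl; split; [auto|split; [auto|lra]]. }
    assert (Hn : exists n, (exists w, length w = n /\ (length w <= N)%nat /\
        qeq (wprod w) (wprod w0) /\ wcost w = m) /\
      forall k, (exists w, length w = k /\ (length w <= N)%nat /\
        qeq (wprod w) (wprod w0) /\ wcost w = m) -> (n <= k)%nat).
    { destruct (dec_inh_nat_subset_has_unique_least_element (fun n => exists w, length w = n /\
        (length w <= N)%nat /\ qeq (wprod w) (wprod w0) /\ wcost w = m)) as (n & Hn & _).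
      - intros n; apply classic.
      - exists (length w1), w1. repeat split; auto. apply Rle_antisym; auto.
      - now exists n. }
    destruct Hn as (n & (w & Ln & L & E & C) & Hn). exists w. split; [|split; auto].
    + split; auto. intros w' L' E'.
      assert (E'' : qeq (wprod w') (wprod w0)) by (eapply qeq_trans; eauto).
      destruct (Rle_lt_or_eq_dec _ _ (Hm' w' L' E'')) as [K|K]; [left; lra|right; split; [lra|]].
      rewrite Ln. apply Hn. now exists w'.
    + rewrite C. apply Hm'; auto using qeq_refl.
Qed.

(** * Factors as quaternions *)

(** The quaternion of [factor_mat] in the frame of X and Y. The quotient by [r] is multiplied by [a]
    or [b], so it is harmless for the zero vector, where the value is [qone]. *)
Definition fquat (f : factor) : quat :=
  let t := fst f in let a := fst (snd f) in let b := snd (snd f) in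
  let r := sqrt (a ^ 2 + b ^ 2) in
  mkQ (cos (t * r / 2)) (a * (sin (t * r / 2) / r)) (b * (sin (t * r / 2) / r)) 0.

Definition dquat (d : list factor) : quat :=
  fold_right (fun f p => qmul (fquat f) p) qone d.

Lemma coef_norm a b : let r := sqrt (a ^ 2 + b ^ 2) in
  0 <= r /\ r ^ 2 = a ^ 2 + b ^ 2 /\ Rabs a <= r /\ Rabs b <= r /\ r <= Rabs a + Rabs b /\
  (r = 0 -> a = 0 /\ b = 0).
Proof.
  intros r.
  assert (H0 : 0 <= r) by apply sqrt_pos.
  assert (H1 : r ^ 2 = a ^ 2 + b ^ 2)
    by (apply pow2_sqrt; generalize (pow2_ge_0 a) (pow2_ge_0 b); lra).
  generalize (Rabs_pos a) (Rabs_pos b); intros Pa Pb.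
  generalize (pow2_abs a) (pow2_abs b); intros Ea Eb.
  repeat split; auto.
  - nra.
  - nra.
  - nra.
  - rewrite H in H1. nra.
  - rewrite H in H1. nra.
Qed.

Lemma fquat_unit f : qunit (fquat f).
Proof.
  destruct f as [t [a b]]. unfold qunit, qnorm2, fquat; simpl.
  destruct (coef_norm a b) as (H0 & H1 & _ & _ & _ & H2). simpl in *.
  set (r := sqrt (a * (a * 1) + b * (b * 1))) in *.
  generalize (sin2_cos2' (t * r / 2)); simpl; intros E.
  destruct (Req_dec r 0) as [Z|Z].
  - destruct (H2 Z) as [-> ->]. rewrite Z in *.
    replace (t * 0 / 2) with 0 in * by field. rewrite cos_0, sin_0 in *. ring.
  - set (s := sin (t * r / 2)) in *. set (c := cos (t * r / 2)) in *.
    transitivity (c * (c * 1) + (a * (a * 1) + b * (b * 1)) * (s / r) ^ 2); [ring|].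
    rewrite <- H1. transitivity (s * (s * 1) + c * (c * 1)); auto. field; auto.
Qed.

Lemma dquat_unit d : qunit (dquat d).
Proof. induction d; simpl; auto using qunit_one, qunit_mul, fquat_unit. Qed.

Lemma dquat_app d d' : dquat (d ++ d') = qmul (dquat d) (dquat d').
Proof.
  induction d as [|f d IH]; simpl; [now rewrite qmul_1_l|]. now rewrite IH, qmul_assoc.
Qed.

Lemma fquat_lipschitz s t a b :
  qabs (qsub (fquat (s, (a, b))) (fquat (t, (a, b)))) <= 2 * (Rabs a + Rabs b) * Rabs (s - t).
Proof.
  destruct (coef_norm a b) as (H0 & _ & Ha & Hb & Hr & H2).
  unfold fquat; simpl fst; simpl snd.
  set (r := sqrt (a ^ 2 + b ^ 2)) in *.
  generalize (sin_lipschitz (s * r / 2) (t * r / 2)) (cos_lipschitz (s * r / 2) (t * r / 2)).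
  replace (s * r / 2 - t * r / 2) with ((s - t) * (r / 2)) by field.
  rewrite Rabs_mult, (Rabs_right (r / 2)) by lra. intros L1 L2.
  unfold qabs, qsub; simpl. rewrite <- !Rmult_minus_distr_l, Rminus_0_r, Rabs_R0, !Rabs_mult.
  set (sn := sin (s * r / 2)) in *. set (sn' := sin (t * r / 2)) in *.
  generalize (Rabs_pos (s - t)) (Rabs_pos a) (Rabs_pos b); intros P1 P2 P3.
  destruct (Req_dec r 0) as [Z|Z].
  - destruct (H2 Z) as [-> ->]. rewrite Rabs_R0 in *. rewrite Z in *. lra.
  - replace (sn / r - sn' / r) with ((sn - sn') / r) by (field; auto).
    assert (Rabs ((sn - sn') / r) <= Rabs (s - t) / 2).
    { unfold Rdiv; rewrite Rabs_mult, (Rabs_right (/ r))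
        by (apply Rle_ge, Rlt_le, Rinv_0_lt_compat; lra).
      apply (Rmult_le_reg_r r); [lra|].
      replace (Rabs (sn - sn') * / r * r) with (Rabs (sn - sn')) by (field; auto). lra. }
    generalize (Rabs_pos ((sn - sn') / r)). nra.
Qed.

Lemma fquat_axis t e : Rabs e = 1 ->
  fquat (t, (e, 0)) = lquat (false, e * t) /\ fquat (t, (0, e)) = lquat (true, e * t).
Proof.
  intros He. unfold fquat, lquat; simpl fst; simpl snd.
  assert (E : e ^ 2 = 1) by (rewrite <- pow2_abs, He; ring).
  replace (sqrt (e ^ 2 + 0 ^ 2)) with 1 by (rewrite E; replace (1 + 0 ^ 2) with 1 by ring; now rewrite sqrt_1).
  replace (sqrt (0 ^ 2 + e ^ 2)) with 1 by (rewrite E; replace (0 ^ 2 + 1) with 1 by ring; now rewrite sqrt_1).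
  rewrite !Rmult_1_r.
  assert (H : cos (t / 2) = cos (e * t / 2) /\ e * (sin (t / 2) / 1) = sin (e * t / 2)).
  { revert He; unfold Rabs; destruct (Rcase_abs e); intros He.
    - replace e with (-1) by lra. replace (-1 * t / 2) with (- (t / 2)) by field.
      rewrite cos_neg, sin_neg. split; field.
    - replace e with 1 by lra. replace (1 * t / 2) with (t / 2) by field. split; field. }
  destruct H as [-> ->]. split; f_equal; ring.
Qed.

Lemma fquat_rescale t a b : 0 <= t -> fquat (t, (a, b)) = fquat (1, (t * a, t * b)).
Proof.
  intros Ht. unfold fquat; simpl fst; simpl snd.
  assert (E : sqrt ((t * a) ^ 2 + (t * b) ^ 2) = t * sqrt (a ^ 2 + b ^ 2)).
  { replace ((t * a) ^ 2 + (t * b) ^ 2) with (t ^ 2 * (a ^ 2 + b ^ 2)) by ring.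
    rewrite sqrt_mult, sqrt_pow2; auto; generalize (pow2_ge_0 a) (pow2_ge_0 b) (pow2_ge_0 t); lra. }
  rewrite E. destruct (coef_norm a b) as (_ & _ & _ & _ & _ & H2).
  set (r := sqrt (a ^ 2 + b ^ 2)) in *. rewrite Rmult_1_l.
  destruct (Req_dec t 0) as [->|Zt].
  { rewrite !Rmult_0_l. replace (0 / 2) with 0 by field. rewrite sin_0. unfold Rdiv; f_equal; ring. }
  destruct (Req_dec r 0) as [Z|Z].
  { destruct (H2 Z) as [-> ->]. f_equal; ring. }
  f_equal; field; auto.
Qed.

Lemma fquat_plus s t a b :
  qmul (fquat (s, (a, b))) (fquat (t, (a, b))) = fquat (s + t, (a, b)).
Proof.
  unfold fquat; simpl fst; simpl snd.
  destruct (coef_norm a b) as (_ & H1 & _ & _ & _ & H2).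
  set (r := sqrt (a ^ 2 + b ^ 2)) in *.
  replace ((s + t) * r / 2) with (s * r / 2 + t * r / 2) by field.
  rewrite cos_plus, sin_plus. unfold qmul; simpl.
  destruct (Req_dec r 0) as [Z|Z].
  { destruct (H2 Z) as [-> ->]. rewrite Z. replace (s * 0 / 2) with 0 by field.
    replace (t * 0 / 2) with 0 by field. rewrite sin_0. f_equal; ring. }
  f_equal; try (field; auto).
  set (x := sin (s * r / 2)). set (y := sin (t * r / 2)).
  transitivity (cos (s * r / 2) * cos (t * r / 2) - (a ^ 2 + b ^ 2) * (x / r * (y / r))); [ring|].
  rewrite <- H1. field; auto.
Qed.

Lemma fquat_0 c : fquat (0, c) = qone.
Proof.
  destruct c as [a b]; unfold fquat, qone; simpl fst; simpl snd.
  replace (0 * _ / 2) with 0 by field. rewrite cos_0, sin_0. f_equal; unfold Rdiv; ring.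
Qed.

Lemma fquat_pow n t a b : qpow (fquat (t, (a, b))) n = fquat (INR n * t, (a, b)).
Proof.
  induction n as [|n IH]; simpl qpow.
  - now rewrite Rmult_0_l, fquat_0.
  - rewrite IH, fquat_plus, S_INR. do 2 f_equal; ring.
Qed.

(** * Error of the Lie product formula *)

Lemma Rabs_cos_1 u : Rabs (cos u - 1) <= u ^ 2 / 2.
Proof.
  replace u with (2 * (u / 2)) at 1 by field. rewrite cos_2a_sin.
  generalize (Rabs_sin_le (u / 2)); intros H.
  apply Rsqr_le_abs_1 in H. unfold Rsqr in H.
  rewrite Rabs_left1; generalize (Rle_0_sqr (sin (u / 2))); unfold Rsqr; nra.
Qed.

Lemma Rabs_sin_sub u : Rabs (sin u - u) <= u ^ 2.
Proof.
  assert (P : forall u, 0 <= u -> Rabs (sin u - u) <= u ^ 2).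
  { intros v Hv.
    assert (sin v <= v).
    { generalize (Rle_abs (sin v)) (Rabs_sin_le v). rewrite (Rabs_right v) by lra. lra. }
    rewrite Rabs_left1 by lra.
    (* The Taylor bound [pre_sin_bound] holds up to 4; beyond, [Rabs (sin v) <= 1] suffices. *)
    destruct (Rle_lt_dec v 4) as [K|K].
    - destruct (pre_sin_bound v 0 Hv K) as [L _].
      unfold sin_approx, sin_term in L; simpl in L. nra.
    - generalize (SIN_bound v); nra. }
  destruct (Rle_lt_dec 0 u) as [K|K]; auto.
  replace (u ^ 2) with ((- u) ^ 2) by ring.
  replace (sin u - u) with (- (sin (- u) - - u)) by (rewrite sin_neg; ring).
  rewrite Rabs_Ropp. apply P; lra.
Qed.

(** Both sides agree to first order, so each coordinate differs by a multiple of [x ^ 2 + y ^ 2].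
    Only the quadratic order matters later: [n] steps of size [1/n] then accumulate an error of
    order [1/n]. *)
Lemma lie_product_error x y :
  qabs (qsub (qmul (lquat (false, x)) (lquat (true, y))) (fquat (1, (x, y)))) <= 2 * (x ^ 2 + y ^ 2).
Proof.
  unfold fquat; simpl fst; simpl snd. rewrite Rmult_1_l.
  destruct (coef_norm x y) as (H0 & H1 & Hx & Hy & _ & H2).
  set (r := sqrt (x ^ 2 + y ^ 2)) in *.
  unfold lquat, qmul, qsub, qabs; simpl.
  assert (Cx := Rabs_cos_1 (x / 2)). assert (Cy := Rabs_cos_1 (y / 2)). assert (Cr := Rabs_cos_1 (r / 2)).
  assert (Sx := Rabs_sin_sub (x / 2)). assert (Sy := Rabs_sin_sub (y / 2)). assert (Sr := Rabs_sin_sub (r / 2)).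
  assert (Bx : Rabs (sin (x / 2)) <= 1) by (apply Rabs_le, SIN_bound).
  assert (By : Rabs (sin (y / 2)) <= 1) by (apply Rabs_le, SIN_bound).
  assert (Bc : Rabs (cos (x / 2)) <= 1) by (apply Rabs_le, COS_bound).
  assert (Lx := Rabs_sin_le (x / 2)). assert (Ly := Rabs_sin_le (y / 2)).
  set (sx := sin (x / 2)) in *. set (cx := cos (x / 2)) in *.
  set (sy := sin (y / 2)) in *. set (cy := cos (y / 2)) in *.
  set (sr := sin (r / 2)) in *. set (cr := cos (r / 2)) in *.
  replace ((x / 2) ^ 2) with (x ^ 2 / 4) in * by field.
  replace ((y / 2) ^ 2) with (y ^ 2 / 4) in * by field.
  replace ((r / 2) ^ 2) with (r ^ 2 / 4) in * by field.
  generalize (pow2_ge_0 x) (pow2_ge_0 y); intros Px Py.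
  assert (D : forall z, Rabs z <= r -> Rabs (z / 2 - z * (sr / r)) <= r ^ 2 / 4).
  { intros z Hz. destruct (Req_dec r 0) as [Z|Z].
    - rewrite Z in Hz. assert (z = 0) as ->.
      { destruct (Req_dec z 0) as [?|Hz0]; auto. apply Rabs_pos_lt in Hz0; lra. }
      rewrite Rmult_0_l. replace (0 / 2 - 0) with 0 by field. rewrite Rabs_R0, Z; lra.
    - replace (z / 2 - z * (sr / r)) with ((z / r) * - (sr - r / 2)) by (field; auto).
      rewrite Rabs_mult, Rabs_Ropp.
      assert (Rabs (z / r) <= 1).
      { unfold Rdiv; rewrite Rabs_mult, (Rabs_right (/ r))
          by (apply Rle_ge, Rlt_le, Rinv_0_lt_compat; lra).
        apply (Rmult_le_reg_r r); [lra|].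
        replace (Rabs z * / r * r) with (Rabs z) by (field; auto). lra. }
      generalize (Rabs_pos (z / r)) (Rabs_pos (sr - r / 2)); nra. }
  assert (Dx := D x Hx). assert (Dy := D y Hy).
  assert (T1 : Rabs (cx * cy - sx * 0 - 0 * sy - 0 * 0 - cr) <= r ^ 2 / 4).
  { replace (cx * cy - sx * 0 - 0 * sy - 0 * 0 - cr) with (cx * (cy - 1) + (cx - 1) + - (cr - 1)) by ring.
    eapply Rle_trans; [apply Rabs_triang|]. rewrite Rabs_Ropp.
    generalize (Rabs_triang (cx * (cy - 1)) (cx - 1)). rewrite Rabs_mult.
    generalize (Rabs_pos cx) (Rabs_pos (cy - 1)). nra. }
  assert (T2 : Rabs (cx * 0 + sx * cy + 0 * 0 - 0 * sy - x * (sr / r)) <= x ^ 2 / 4 + y ^ 2 / 8 + r ^ 2 / 4).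
  { replace (cx * 0 + sx * cy + 0 * 0 - 0 * sy - x * (sr / r))
      with (sx * (cy - 1) + (sx - x / 2) + (x / 2 - x * (sr / r))) by ring.
    eapply Rle_trans; [apply Rabs_triang|].
    generalize (Rabs_triang (sx * (cy - 1)) (sx - x / 2)). rewrite Rabs_mult.
    generalize (Rabs_pos sx) (Rabs_pos (cy - 1)). nra. }
  assert (T3 : Rabs (cx * sy - sx * 0 + 0 * cy + 0 * 0 - y * (sr / r)) <= x ^ 2 / 8 + y ^ 2 / 4 + r ^ 2 / 4).
  { replace (cx * sy - sx * 0 + 0 * cy + 0 * 0 - y * (sr / r))
      with ((cx - 1) * sy + (sy - y / 2) + (y / 2 - y * (sr / r))) by ring.
    eapply Rle_trans; [apply Rabs_triang|].
    generalize (Rabs_triang ((cx - 1) * sy) (sy - y / 2)). rewrite Rabs_mult.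
    generalize (Rabs_pos sy) (Rabs_pos (cx - 1)). nra. }
  assert (T4 : Rabs (cx * 0 + sx * sy - 0 * 0 + 0 * cy - 0) <= (x ^ 2 + y ^ 2) / 8).
  { replace (cx * 0 + sx * sy - 0 * 0 + 0 * cy - 0) with (sx * sy) by ring. rewrite Rabs_mult.
    unfold Rdiv in Lx, Ly. rewrite Rabs_mult, (Rabs_right (/ 2)) in Lx, Ly by lra.
    generalize (Rabs_pos sx) (Rabs_pos sy) (pow2_ge_0 (Rabs x - Rabs y)) (pow2_abs x) (pow2_abs y)
      (Rabs_pos x) (Rabs_pos y).
    intros.
    assert (Rabs sx * Rabs sy <= (Rabs x * / 2) * (Rabs y * / 2)) by (apply Rmult_le_compat; auto).
    nra. }
  lra.
Qed.

(** * Normal forms *)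

(** Letters of a pattern refer to their times by index because form (2) uses [t2] twice. *)
Definition time (k : nat) (t1 t2 t3 : R) : R :=
  match k with O => t1 | S O => t2 | _ => t3 end.

Definition pattern := list (nat * (R * R)).

Definition build (L : pattern) (t1 t2 t3 : R) : list factor :=
  map (fun p => (time (fst p) t1 t2 t3, snd p)) L.

Definition dominated (t1 t2 t3 : R) : Prop :=
  0 <= t1 /\ 0 <= t2 /\ 0 <= t3 /\ t1 <= t2 /\ t3 <= t2 /\ t2 <= PI.
(** No upper bounds are imposed for forms (3) and (4): they are recovered at the end from
    optimality, and the times are bounded by the cost anyway. *)
Definition nonneg (t1 t2 t3 : R) : Prop := 0 <= t1 /\ 0 <= t2 /\ 0 <= t3.

Definition shapes : list (pattern * (R -> R -> R -> Prop)) :=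
  [([(0%nat, (1, 0)); (1%nat, (0, 1)); (2%nat, (-1, 0))], dominated);
   ([(0%nat, (1, 0)); (1%nat, (0, 1)); (1%nat, (-1, 0)); (2%nat, (0, -1))], dominated);
   ([(0%nat, (1, 0)); (1%nat, (1/2, 1/2)); (2%nat, (1, 0))], nonneg);
   ([(0%nat, (1, 0)); (1%nat, (1/2, 1/2)); (2%nat, (0, 1))], nonneg)].

Definition substs : list ((R * R) * (R * R)) :=
  [((1, 0), (0, 1)); ((1, 0), (0, -1)); ((-1, 0), (0, 1)); ((-1, 0), (0, -1));
   ((0, 1), (1, 0)); ((0, 1), (-1, 0)); ((0, -1), (1, 0)); ((0, -1), (-1, 0))].

Lemma substs_admissible s : In s substs <-> admissible_subst (fst s) (snd s).
Proof.
  split.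
  - unfold substs; simpl; intros H; unfold admissible_subst, is_sign.
    repeat (destruct H as [<-|H]); [..|contradiction]; simpl;
    [exists 1, 1|exists 1, (-1)|exists (-1), 1|exists (-1), (-1)
    |exists 1, 1|exists 1, (-1)|exists (-1), 1|exists (-1), (-1)]; intuition.
  - destruct s as [sX sY]; simpl. intros (e & e' & He & He' & H).
    destruct He as [->| ->], He' as [->| ->], H as [[-> ->]|[-> ->]]; unfold substs; simpl; tauto.
Qed.

(** An epigraph, like [word_reach]: the real coordinate is an upper bound for the cost. *)
Definition normal (i : ((R * R) * (R * R)) * (pattern * (R -> R -> R -> Prop))) (x : quat * R) : Prop :=
  exists t1 t2 t3, snd (snd i) t1 t2 t3 /\
    let d := subst_decomp (fst (fst i)) (snd (fst i)) (build (fst (snd i)) t1 t2 t3) in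
    qeq (dquat d) (fst x) /\ cost_decomp 1 d <= snd x.

Definition has_normal_form (x : quat * R) : Prop :=
  exists i, In i (list_prod substs shapes) /\ normal i x.

Definition subst_pattern (sX sY : R * R) (L : pattern) : pattern :=
  map (fun p => (fst p, snd (subst_factor sX sY (0, snd p)))) L.

Lemma subst_build sX sY L t1 t2 t3 :
  subst_decomp sX sY (build L t1 t2 t3) = build (subst_pattern sX sY L) t1 t2 t3.
Proof.
  unfold subst_decomp, build, subst_pattern. rewrite !map_map. reflexivity.
Qed.

(** All vectors of the four forms, including [(X + Y) / 2], have cost 1, so the cost of a form is
    the sum of its times. *)
Definition unit_cost (L : pattern) : Prop :=
  Forall (fun p => Rabs (fst (snd p)) + Rabs (snd (snd p)) = 1) L.

Lemma subst_unit_cost sX sY L : admissible_subst sX sY -> unit_cost L ->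
  unit_cost (subst_pattern sX sY L).
Proof.
  intros H HL. unfold unit_cost, subst_pattern. apply Forall_map.
  eapply Forall_impl; [|apply HL]. intros [k [a b]]; simpl; intros E.
  destruct H as (e & e' & He & He' & [[-> ->]|[-> ->]]); simpl;
  rewrite !Rmult_0_r, ?Rplus_0_l, ?Rplus_0_r, !Rabs_mult;
  destruct He as [->| ->], He' as [->| ->];
  rewrite ?(Rabs_left (-1)), ?Rabs_R1 by lra; lra.
Qed.

Lemma shapes_unit_cost s : In s shapes -> unit_cost (fst s).
Proof.
  assert (E1 : Rabs 0 = 0) by apply Rabs_R0. assert (E2 : Rabs 1 = 1) by apply Rabs_R1.
  assert (E3 : Rabs (-1) = 1) by (rewrite Rabs_left; lra).
  assert (E4 : Rabs (1/2) = 1/2) by (rewrite Rabs_right; lra).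
  unfold shapes; simpl; intros H; unfold unit_cost;
    repeat (destruct H as [<-|H]); [..|contradiction]; simpl;
    repeat constructor; simpl; rewrite ?E1, ?E2, ?E3, ?E4; lra.
Qed.

Lemma build_cost L t1 t2 t3 : unit_cost L ->
  cost_decomp 1 (build L t1 t2 t3) = fold_right (fun p s => time (fst p) t1 t2 t3 + s) 0 L.
Proof.
  induction 1 as [|[k [a b]] L E HL IH]; simpl in *; auto.
  rewrite IH, Rmult_1_l, E; ring.
Qed.

Lemma time_close k t1 t2 t3 s1 s2 s3 e :
  Rabs (t1 - s1) <= e -> Rabs (t2 - s2) <= e -> Rabs (t3 - s3) <= e ->
  Rabs (time k t1 t2 t3 - time k s1 s2 s3) <= e.
Proof. destruct k as [|[|k]]; simpl; auto. Qed.

(** Each further factor doubles the old error and adds at most [4 * e]; the base 8 covers both. *)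
Lemma build_close L t1 t2 t3 s1 s2 s3 e : unit_cost L ->
  Rabs (t1 - s1) <= e -> Rabs (t2 - s2) <= e -> Rabs (t3 - s3) <= e ->
  qabs (qsub (dquat (build L t1 t2 t3)) (dquat (build L s1 s2 s3))) <= 8 ^ length L * e /\
  Rabs (cost_decomp 1 (build L t1 t2 t3) - cost_decomp 1 (build L s1 s2 s3)) <= INR (length L) * e.
Proof.
  intros HL H1 H2 H3. assert (He : 0 <= e) by (generalize (Rabs_pos (t1 - s1)); lra).
  rewrite !build_cost by auto.
  induction HL as [|[k [a b]] L E HL IH]; cbn [build map fold_right length dquat fst snd] in *.
  - simpl. rewrite qabs_sub_diag, Rminus_diag, Rabs_R0. lra.
  - generalize (time_close k _ _ _ _ _ _ _ H1 H2 H3); intros Ht.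
    set (t := time k t1 t2 t3) in *. set (s := time k s1 s2 s3) in *.
    destruct IH as [IH1 IH2]. split.
    + fold (build L t1 t2 t3) (build L s1 s2 s3).
      fold (dquat (build L t1 t2 t3)) (dquat (build L s1 s2 s3)).
      eapply Rle_trans; [apply qabs_mul_close; [apply fquat_unit|apply dquat_unit]|].
      generalize (fquat_lipschitz t s a b). rewrite E; intros L1.
      assert (1 <= 8 ^ length L) by (apply pow_R1_Rle; lra).
      fold (build L t1 t2 t3) (build L s1 s2 s3) in IH1.
      fold (dquat (build L t1 t2 t3)) (dquat (build L s1 s2 s3)) in IH1.
      simpl pow. nra.
    + rewrite S_INR.
      match goal with |- Rabs (t + ?x - (s + ?y)) <= _ =>
        replace (t + x - (s + y)) with ((t - s) + (x - y)) by ring end.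
      eapply Rle_trans; [apply Rabs_triang|]. lra.
Qed.

Lemma dominated_closed t1 t2 t3 :
  (forall e, 0 < e -> exists s1 s2 s3, Rabs (t1 - s1) < e /\ Rabs (t2 - s2) < e /\
     Rabs (t3 - s3) < e /\ dominated s1 s2 s3) -> dominated t1 t2 t3.
Proof.
  intros H. repeat split; apply le_epsilon; intros e He;
  destruct (H (e / 2)) as (s1 & s2 & s3 & K1 & K2 & K3 & K); try lra;
  apply Rabs_lt_between in K1, K2, K3; destruct K as (?&?&?&?&?&?); lra.
Qed.

Lemma nonneg_closed t1 t2 t3 :
  (forall e, 0 < e -> exists s1 s2 s3, Rabs (t1 - s1) < e /\ Rabs (t2 - s2) < e /\
     Rabs (t3 - s3) < e /\ nonneg s1 s2 s3) -> nonneg t1 t2 t3.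
Proof.
  intros H. repeat split; apply le_epsilon; intros e He;
  destruct (H (e / 2)) as (s1 & s2 & s3 & K1 & K2 & K3 & K); try lra;
  apply Rabs_lt_between in K1, K2, K3; destruct K as (?&?&?); lra.
Qed.

(** The relation between the times, the quaternion and the cost bound is closed, and nonnegative
    times are bounded by the cost. Three projections then remove [t3], [t2] and [t1]. *)
Lemma normal_closed i : In i (list_prod substs shapes) -> closed_for qnear (normal i).
Proof.
  destruct i as [[sX sY] [L G]]. intros Hi. apply in_prod_iff in Hi; destruct Hi as [Hs Hp].
  assert (Hadm : admissible_subst sX sY) by (apply (substs_admissible (sX, sY)); auto).
  assert (HL := shapes_unit_cost _ Hp). simpl in HL.
  assert (HL' := subst_unit_cost sX sY L Hadm HL).
  assert (HG : forall t1 t2 t3, (forall e, 0 < e -> exists s1 s2 s3, Rabs (t1 - s1) < e /\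
     Rabs (t2 - s2) < e /\ Rabs (t3 - s3) < e /\ G s1 s2 s3) -> G t1 t2 t3).
  { unfold shapes in Hp; simpl in Hp.
    repeat (destruct Hp as [E|Hp]; [injection E as _ <-; apply dominated_closed || apply nonneg_closed|]).
    contradiction. }
  assert (HB : forall t1 t2 t3, G t1 t2 t3 ->
    0 <= t1 /\ 0 <= t2 /\ 0 <= t3 /\
    t1 + t2 + t3 <= cost_decomp 1 (build (subst_pattern sX sY L) t1 t2 t3)).
  { intros t1 t2 t3. rewrite build_cost by auto. unfold shapes in Hp; simpl in Hp.
    repeat (destruct Hp as [E|Hp]; [injection E as <- <-; unfold dominated, nonneg; simpl; lra|]).
    contradiction. }
  set (D := fun t1 t2 t3 => build (subst_pattern sX sY L) t1 t2 t3) in *.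
  set (S := fun t1 t2 t3 (x : quat * R) =>
    G t1 t2 t3 /\ qeq (dquat (D t1 t2 t3)) (fst x) /\ cost_decomp 1 (D t1 t2 t3) <= snd x).
  assert (K : closed_for qnear (fun x => exists t1 t2 t3, S t1 t2 t3 x)).
  { assert (B : forall x : quat * R, forall t1 t2 t3 x', qnear 1 x x' -> S t1 t2 t3 x' ->
      Rabs t1 <= snd x + 1 /\ Rabs t2 <= snd x + 1 /\ Rabs t3 <= snd x + 1).
    { intros x t1 t2 t3 x' [_ Hn] (K1 & _ & K2). apply HB in K1.
      apply Rabs_lt_between in Hn.
      rewrite !Rabs_right by lra. lra. }
    apply (closed_projection qnear (fun t1 x => exists t2 t3, S t1 t2 t3 x) qnear_monotone).
    2:{ intros x; exists (snd x + 1). intros t1 x' Hn (t2 & t3 & HS). apply (B x t1 t2 t3 x' Hn HS). }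
    apply (closed_projection (near_pair qnear) (fun t2 x => exists t3, S (fst x) t2 t3 (snd x))
      (near_pair_monotone _ qnear_monotone)).
    2:{ intros [t1 x]; exists (snd x + 1). intros t2 [t1' x'] [_ Hn] (t3 & HS).
        apply (B x t1' t2 t3 x' Hn HS). }
    apply (closed_projection (near_pair (near_pair qnear))
      (fun t3 x => S (fst (snd x)) (fst x) t3 (snd (snd x)))
      (near_pair_monotone _ (near_pair_monotone _ qnear_monotone))).
    2:{ intros [t2 [t1 x]]; exists (snd x + 1). intros t3 [t2' [t1' x']] [_ [_ Hn]] HS.
        apply (B x t1' t2' t3 x' Hn HS). }
    intros [t3 [t2 [t1 [q c]]]] H; simpl.
    assert (H' : forall e, 0 < e -> exists s1 s2 s3 q' c', Rabs (t1 - s1) < e /\ Rabs (t2 - s2) < e /\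
      Rabs (t3 - s3) < e /\ qabs (qsub q q') < e /\ Rabs (c - c') < e /\ S s1 s2 s3 (q', c')).
    { intros e He. destruct (H e He) as ([s3 [s2 [s1 [q' c']]]] & [K3 [K2 [K1 [Kq Kc]]]] & HS).
      simpl in *. exists s1, s2, s3, q', c'; auto 10. }
    clear H. repeat split; simpl.
    - apply HG. intros e He.
      destruct (H' e He) as (s1 & s2 & s3 & q' & c' & K1 & K2 & K3 & _ & _ & HS & _).
      exists s1, s2, s3; auto.
    - apply qeq_closed. intros e He.
      set (M := 8 ^ length (subst_pattern sX sY L)).
      assert (HM : 1 <= M) by (apply pow_R1_Rle; lra).
      destruct (H' (e / (2 * M))) as (s1 & s2 & s3 & q' & c' & K1 & K2 & K3 & Kq & _ & _ & HS & _).
      { apply Rdiv_lt_0_compat; lra. }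
      simpl in HS.
      assert (Q : M * (e / (2 * M)) = e / 2) by (field; lra).
      assert (Q' : 0 < e / (2 * M)) by (apply Rdiv_lt_0_compat; lra).
      exists (dquat (D s1 s2 s3)), q'; split; [|split; auto].
      + destruct (build_close (subst_pattern sX sY L) t1 t2 t3 s1 s2 s3 (e / (2 * M)) HL') as [Z _];
          try lra. fold M in Z. unfold D. lra.
      + nra.
    - apply le_epsilon. intros e He.
      set (M := INR (length (subst_pattern sX sY L)) + 1).
      assert (HM : 1 <= M) by (unfold M; generalize (pos_INR (length (subst_pattern sX sY L))); lra).
      destruct (H' (e / M)) as (s1 & s2 & s3 & q' & c' & K1 & K2 & K3 & _ & Kc & _ & _ & HS).
      { apply Rdiv_lt_0_compat; lra. }
      simpl in HS.
      assert (Q : M * (e / M) = e) by (field; lra).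
      destruct (build_close (subst_pattern sX sY L) t1 t2 t3 s1 s2 s3 (e / M) HL') as [_ Z]; try lra.
      fold (D t1 t2 t3) (D s1 s2 s3) in Z.
      apply Rabs_le_between in Z. apply Rabs_lt_between in Kc. unfold M in Q at 1. lra. }
  intros x Hx. destruct (K x) as (t1 & t2 & t3 & H1 & H2 & H3).
  - intros e He. destruct (Hx e He) as (x' & Hn & t1 & t2 & t3 & H1 & H2 & H3). exists x'; split; auto.
    exists t1, t2, t3. simpl in *. rewrite subst_build in *. split; auto.
  - exists t1, t2, t3. simpl in *. rewrite subst_build. split; auto.
Qed.

Lemma has_normal_form_closed : closed_for qnear has_normal_form.
Proof.
  apply closed_exists_list; [apply qnear_monotone|]. apply normal_closed.
Qed.

Lemma has_normal_form_mono p q c c' : has_normal_form (p, c) -> qeq p q -> c <= c' ->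
  has_normal_form (q, c').
Proof.
  intros (i & Hi & t1 & t2 & t3 & HG & Hq & Hc) Hpq Hcc.
  exists i; split; auto. exists t1, t2, t3. simpl in *. repeat split; auto; [|lra].
  eapply qeq_trans; eauto.
Qed.

(** * Recognising words as normal forms *)

Lemma is_sign_abs e : is_sign e -> Rabs e = 1.
Proof. intros [->| ->]; [apply Rabs_R1|rewrite Rabs_left; lra]. Qed.

Lemma is_sign_opp e : is_sign e -> is_sign (- e).
Proof. intros [->| ->]; [right|left]; ring. Qed.

Lemma sign_decompose a : exists e, is_sign e /\ a = e * Rabs a.
Proof.
  unfold is_sign, Rabs; destruct (Rcase_abs a); [exists (-1)|exists 1]; split; auto; ring.
Qed.

(** The entry [u] belongs to the axis [x] and [v] to the other one, so words that begin with either
    axis are treated together. *)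
Definition axis_pair (x : bool) (u v : R) : R * R := if x then (v, u) else (u, v).

Lemma fquat_letter x e t : is_sign e -> fquat (t, axis_pair x e 0) = lquat (x, e * t).
Proof.
  intros He. destruct (fquat_axis t e (is_sign_abs e He)) as [E1 E2].
  destruct x; auto.
Qed.

Lemma axis_subst x e e' : is_sign e -> is_sign e' ->
  In (axis_pair x e 0, axis_pair (negb x) e' 0) substs.
Proof.
  intros He He'. apply substs_admissible. exists e, e'. destruct x; simpl; auto.
Qed.

Lemma normal_form_intro x e e' k t1 t2 t3 q :
  is_sign e -> is_sign e' -> (k < 4)%nat ->
  let s := nth k shapes ([], nonneg) in
  snd s t1 t2 t3 ->
  let d := subst_decomp (axis_pair x e 0) (axis_pair (negb x) e' 0) (build (fst s) t1 t2 t3) in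
  qeq (dquat d) q ->
  has_normal_form (q, cost_decomp 1 d).
Proof.
  intros He He' Hk s Hs d Hq.
  exists ((axis_pair x e 0, axis_pair (negb x) e' 0), s). split.
  - apply in_prod; [now apply axis_subst|]. apply nth_In. simpl; lia.
  - exists t1, t2, t3; simpl. split; auto. split; auto. apply Rle_refl.
Qed.

Lemma subst_cost x e e' k t1 t2 t3 : is_sign e -> is_sign e' -> (k < 4)%nat ->
  cost_decomp 1 (subst_decomp (axis_pair x e 0) (axis_pair (negb x) e' 0)
    (build (fst (nth k shapes ([], nonneg))) t1 t2 t3)) =
  t1 + t2 + t3 + (if Nat.eqb k 1 then t2 else 0).
Proof.
  intros He He' Hk. rewrite subst_build, build_cost.
  - destruct k as [|[|[|[|k]]]]; simpl; try lia; ring.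
  - apply subst_unit_cost.
    + apply (substs_admissible (_, _)), axis_subst; auto.
    + apply shapes_unit_cost, nth_In. simpl; lia.
Qed.

Lemma form1_word x e e' t1 t2 t3 : is_sign e -> is_sign e' -> dominated t1 t2 t3 ->
  has_normal_form (wprod [(x, e * t1); (negb x, e' * t2); (x, - e * t3)], t1 + t2 + t3).
Proof.
  intros He He' Hd.
  generalize (normal_form_intro x e e' 0 t1 t2 t3
    (wprod [(x, e * t1); (negb x, e' * t2); (x, - e * t3)]) He He' ltac:(lia) Hd).
  cbv zeta. rewrite subst_cost by (auto; lia). simpl Nat.eqb; cbv iota. rewrite Rplus_0_r. intros K; apply K.
  left. simpl. unfold subst_factor; simpl.
  rewrite <- (fquat_letter x e t1), <- (fquat_letter (negb x) e' t2),
    <- (fquat_letter x (- e) t3) by auto using is_sign_opp.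
  repeat f_equal; destruct x; simpl; f_equal; ring.
Qed.

Lemma form2_word x e e' t1 t2 t3 : is_sign e -> is_sign e' -> dominated t1 t2 t3 ->
  has_normal_form (wprod [(x, e * t1); (negb x, e' * t2); (x, - e * t2); (negb x, - e' * t3)],
    t1 + t2 + t2 + t3).
Proof.
  intros He He' Hd.
  generalize (normal_form_intro x e e' 1 t1 t2 t3
    (wprod [(x, e * t1); (negb x, e' * t2); (x, - e * t2); (negb x, - e' * t3)])
    He He' ltac:(lia) Hd).
  cbv zeta. rewrite subst_cost by (auto; lia). simpl Nat.eqb; cbv iota.
  replace (t1 + t2 + t3 + t2) with (t1 + t2 + t2 + t3) by ring. intros K; apply K.
  left. simpl. unfold subst_factor; simpl.
  rewrite <- (fquat_letter x e t1), <- (fquat_letter (negb x) e' t2),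
    <- (fquat_letter x (- e) t2), <- (fquat_letter (negb x) (- e') t3) by auto using is_sign_opp.
  repeat f_equal; destruct x; simpl; f_equal; ring.
Qed.

Lemma form34_quat (b x : bool) e e' t1 t2 t3 :
  is_sign e -> is_sign e' -> nonneg t1 t2 t3 ->
  has_normal_form (qmul (lquat (x, e * t1)) (qmul (fquat (t2, axis_pair x (e / 2) (e' / 2)))
    (lquat (if b then (negb x, e' * t3) else (x, e * t3)))), t1 + t2 + t3).
Proof.
  intros He He' Hd.
  generalize (normal_form_intro x e e' (if b then 3 else 2) t1 t2 t3
    (qmul (lquat (x, e * t1)) (qmul (fquat (t2, axis_pair x (e / 2) (e' / 2)))
    (lquat (if b then (negb x, e' * t3) else (x, e * t3)))))
    He He' ltac:(destruct b; lia) ltac:(destruct b; exact Hd)).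
  cbv zeta. rewrite subst_cost by (auto; destruct b; lia).
  replace (if Nat.eqb (if b then 3 else 2) 1 then t2 else 0) with 0 by (destruct b; auto).
  rewrite Rplus_0_r. intros K; apply K.
  left. rewrite <- (fquat_letter x e t1) by auto.
  destruct b; simpl; unfold subst_factor; simpl;
    [rewrite <- (fquat_letter (negb x) e' t3) by auto|rewrite <- (fquat_letter x e t3) by auto];
  rewrite qmul_1_r; repeat f_equal; destruct x; simpl; f_equal; lra.
Qed.

(** Form (1) with one outer time zero. The longer letter has to play the middle one, which decides
    on which side the empty letter is added. *)
Lemma two_letters_normal x a b : Rabs a <= PI -> Rabs b <= PI ->
  has_normal_form (wprod [(x, a); (negb x, b)], wcost [(x, a); (negb x, b)]).
Proof.
  intros Ha Hb.
  destruct (sign_decompose a) as (e & He & Ea). destruct (sign_decompose b) as (e' & He' & Eb).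
  generalize (Rabs_pos a) (Rabs_pos b); intros.
  destruct (Rle_lt_dec (Rabs a) (Rabs b)) as [K|K].
  - apply (has_normal_form_mono _ _ _ _ (form1_word x e e' (Rabs a) (Rabs b) 0 He He'
      ltac:(unfold dominated; lra))).
    + left. rewrite <- Ea, <- Eb. simpl. now rewrite Rmult_0_r, lquat_0, !qmul_1_r.
    + simpl; lra.
  - apply (has_normal_form_mono _ _ _ _ (form1_word (negb x) (- e') e 0 (Rabs a) (Rabs b)
      (is_sign_opp _ He') He ltac:(unfold dominated; lra))).
    + left. rewrite Bool.negb_involutive, Ropp_involutive, <- Ea, <- Eb. simpl.
      now rewrite Rmult_0_r, lquat_0, !qmul_1_l.
    + simpl; lra.
Qed.

Lemma three_letters_normal x a b c : opposite a c ->
  Rabs a <= Rabs b -> Rabs c <= Rabs b -> Rabs b <= PI ->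
  has_normal_form (wprod [(x, a); (negb x, b); (x, c)], wcost [(x, a); (negb x, b); (x, c)]).
Proof.
  intros Hac Ha Hc Hb.
  destruct (sign_decompose a) as (e & He & Ea). destruct (sign_decompose b) as (e' & He' & Eb).
  generalize (Rabs_pos a) (Rabs_pos c); intros.
  assert (Ec : c = - e * Rabs c).
  { unfold opposite in Hac. rewrite Ea in Hac.
    destruct He as [->| ->]; unfold Rabs at 1; destruct (Rcase_abs c); nra. }
  apply (has_normal_form_mono _ _ _ _ (form1_word x e e' (Rabs a) (Rabs b) (Rabs c) He He'
    ltac:(unfold dominated; lra))).
  - left. now rewrite <- Ea, <- Eb, <- Ec.
  - simpl; lra.
Qed.

Lemma four_letters_normal x a b c d : opposite a c -> opposite b d -> Rabs b = Rabs c ->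
  Rabs a <= Rabs b -> Rabs d <= Rabs b -> Rabs b <= PI ->
  has_normal_form (wprod [(x, a); (negb x, b); (x, c); (negb x, d)],
    wcost [(x, a); (negb x, b); (x, c); (negb x, d)]).
Proof.
  intros Hac Hbd Hbc Ha Hd Hb.
  destruct (sign_decompose a) as (e & He & Ea). destruct (sign_decompose b) as (e' & He' & Eb).
  generalize (Rabs_pos a) (Rabs_pos c) (Rabs_pos d); intros.
  assert (S : forall u v e, is_sign e -> u = e * Rabs u -> opposite u v -> v = - e * Rabs v).
  { intros u v s Hs Eu Ho. unfold opposite in Ho. rewrite Eu in Ho. generalize (Rabs_pos u); intros.
    destruct Hs as [->| ->]; unfold Rabs at 1; destruct (Rcase_abs v); nra. }
  assert (Ec := S a c e He Ea Hac). assert (Ed := S b d e' He' Eb Hbd).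
  apply (has_normal_form_mono _ _ _ _ (form2_word x e e' (Rabs a) (Rabs b) (Rabs d) He He'
    ltac:(unfold dominated; lra))).
  - left. rewrite <- Ea, <- Eb. rewrite Hbc. now rewrite <- Ec, <- Ed.
  - simpl; lra.
Qed.

Lemma reduced_classification N w : (6 <= N)%nat -> reduced N w ->
  has_normal_form (wprod w, wcost w) \/
  exists x a b c e n,
    w = (x, a) :: alternating n (negb x, b) (x, c) ++
        [if Nat.even n then (negb x, e) else (x, e)] /\
    (N <= n + 3)%nat /\ same_sign a c /\ Rabs b = Rabs c /\
    same_sign e (if Nat.even n then b else c).
Proof.
  intros HN H.
  assert (HP : forall x t p s, w = p ++ [(x, t)] ++ s -> Rabs t <= PI).
  { intros x t p s ->. eapply reduced_letter_le_PI, reduced_infix, H. }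
  assert (HA : forall x y a b p s, w = p ++ [(x, a); (y, b)] ++ s -> y = negb x).
  { intros x y a b p s ->. eapply reduced_alternate, reduced_infix, H. }
  destruct w as [|[x a] w].
  { left. apply (has_normal_form_mono _ _ _ _ (two_letters_normal false 0 0
      ltac:(rewrite Rabs_R0; generalize PI_RGT_0; lra) ltac:(rewrite Rabs_R0; generalize PI_RGT_0; lra))).
    - left. simpl. now rewrite !lquat_0, !qmul_1_l.
    - simpl. rewrite Rabs_R0; lra. }
  destruct w as [|[y b] w].
  { left. apply (has_normal_form_mono _ _ _ _ (two_letters_normal x a 0
      (HP x a [] [] eq_refl) ltac:(rewrite Rabs_R0; generalize PI_RGT_0; lra))).
    - left. simpl. now rewrite !lquat_0, !qmul_1_l.
    - simpl. rewrite Rabs_R0; lra. }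
  assert (y = negb x) as -> by (apply (HA x y a b [] w eq_refl)).
  assert (Pb : Rabs b <= PI) by (apply (HP (negb x) b [(x, a)] w eq_refl)).
  destruct w as [|[z c] w].
  { left. apply two_letters_normal; auto. apply (HP x a [] [(negb x, b)] eq_refl). }
  assert (z = x) as ->.
  { rewrite <- (Bool.negb_involutive x). apply (HA (negb x) z b c [(x, a)] w eq_refl). }
  destruct w as [|[t d] w].
  { left. assert (F := reduced_letters _ _ H).
    inversion F as [|? ? Ha F1]; inversion F1 as [|? ? Hb F2]; inversion F2 as [|? ? Hc F3];
      subst; simpl in *; clear F F1 F2 F3.
    destruct (Rtotal_order (a * c) 0) as [K|[K|K]].
    - destruct (reduced3_opposite x (negb x) x a b c) as [K1 K2]; auto.
      { apply (reduced_mono N); auto; simpl; lia. }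
      now apply three_letters_normal.
    - apply Rmult_integral in K; tauto.
    - exfalso. apply (reduced3_same x (negb x) x a b c); auto.
      apply (reduced_mono N); auto; simpl; lia. }
  assert (t = negb x) as -> by (apply (HA x t c d [(x, a); (negb x, b)] w eq_refl)).
  assert (HL : (4 + length w <= N)%nat) by (destruct H as [HL _]; simpl in HL; lia).
  assert (H4 : reduced 4 [(x, a); (negb x, b); (x, c); (negb x, d)]).
  { apply (reduced_mono (N - 0 - length w)); [lia|simpl; lia|].
    exact (reduced_infix N [] [(x, a); (negb x, b); (x, c); (negb x, d)] w H). }
  destruct (reduced4 _ _ _ _ _ _ _ _ H4) as [E [[S1 S2]|[S1 S2]]].
  - destruct (Nat.le_gt_cases (length w + 6) N) as [KN|KN].
    + exfalso. apply (reduced3_same x (negb x) x a b c); auto.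
      apply (reduced_mono (N - 0 - S (length w))); [lia|simpl; lia|].
      exact (reduced_infix N [] [(x, a); (negb x, b); (x, c)] ((negb x, d) :: w) H).
    + right. destruct (reduced_same_alternating N x (negb x) x (negb x) a b c d w H S1)
        as ([y e] & E1 & E2 & E3 & E4).
      exists x, a, b, c, e, (2 + length w)%nat.
      replace (Nat.even (2 + length w)) with (Nat.even (length w)) by reflexivity.
      split; [|split; [lia|split; [auto|split; [auto|exact E3]]]].
      rewrite E1. do 3 f_equal. simpl in E2. rewrite E2. now destruct (Nat.even (length w)).
  - destruct w as [|[y e] w].
    + left.
      destruct (reduced3_opposite x (negb x) x a b c) as [K1 _]; auto.
      { apply (reduced_mono (N - 0 - 1)); [lia|simpl; lia|].
        exact (reduced_infix N [] [(x, a); (negb x, b); (x, c)] [(negb x, d)] H). }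
      destruct (reduced3_opposite (negb x) x (negb x) b c d) as [_ K2]; auto.
      { apply (reduced_mono (N - 1 - 0)); [lia|simpl; lia|].
        exact (reduced_infix N [(x, a)] [(negb x, b); (x, c); (negb x, d)] [] H). }
      apply four_letters_normal; auto. lra.
    + exfalso. apply (reduced5_opposite x (negb x) x (negb x) y a b c d e); auto.
      simpl in HL.
      apply (reduced_mono (N - 0 - length w)); [lia|simpl; lia|].
      exact (reduced_infix N [] [(x, a); (negb x, b); (x, c); (negb x, d); (y, e)] w H).
Qed.

(** * Long words approach the diagonal rotations *)

Lemma qabs_conj p q : qabs (qsub (qconj p) (qconj q)) = qabs (qsub p q).
Proof.
  unfold qabs, qsub, qconj; simpl.
  assert (E : forall x y, Rabs (- x - - y) = Rabs (x - y)).
  { intros; rewrite <- Rabs_Ropp; f_equal; ring. }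
  now rewrite !E.
Qed.

Lemma fquat_conj t a b : qconj (fquat (t, (a, b))) = fquat (t, (- a, - b)).
Proof.
  unfold fquat, qconj; simpl fst; simpl snd.
  replace ((- a) ^ 2 + (- b) ^ 2) with (a ^ 2 + b ^ 2) by ring. simpl; f_equal; ring.
Qed.

(** The order Y, X follows from X, Y because conjugation reverses products. *)
Lemma lie_product_error_axis x u v :
  qabs (qsub (qmul (lquat (x, u)) (lquat (negb x, v))) (fquat (1, axis_pair x u v)))
  <= 2 * (u ^ 2 + v ^ 2).
Proof.
  destruct x; simpl.
  - rewrite <- qabs_conj, qconj_mul, <- !lquat_neg_conj, fquat_conj.
    eapply Rle_trans; [apply lie_product_error|]. right; ring.
  - apply lie_product_error.
Qed.

Lemma qpow_comm p n : qmul p (qpow p n) = qmul (qpow p n) p.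
Proof.
  induction n as [|n IH]; simpl; [now rewrite qmul_1_l, qmul_1_r|].
  now rewrite qmul_assoc, IH.
Qed.

Lemma wprod_alternating m u v :
  wprod (alternating (2 * m) u v) = qpow (qmul (lquat u) (lquat v)) m /\
  wprod (alternating (2 * m + 1) u v) = qmul (qpow (qmul (lquat u) (lquat v)) m) (lquat u).
Proof.
  induction m as [|m [IH1 IH2]].
  - simpl. now rewrite qmul_1_l, qmul_1_r.
  - replace (2 * S m)%nat with (S (S (2 * m))) by lia.
    replace (S (S (2 * m)) + 1)%nat with (S (S (2 * m + 1))) by lia.
    cbn [alternating wprod fold_right]. fold (wprod (alternating (2 * m) u v)).
    fold (wprod (alternating (2 * m + 1) u v)). rewrite IH1, IH2. simpl qpow.
    now rewrite <- qpow_comm, <- !qmul_assoc.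
Qed.

Lemma wcost_alternating n u v : Rabs (snd u) = Rabs (snd v) ->
  wcost (alternating n u v) = INR n * Rabs (snd u).
Proof.
  revert u v; induction n as [|n IH]; intros u v H.
  - simpl; ring.
  - cbn [alternating wcost fold_right]. fold (wcost (alternating n v u)).
    rewrite IH by auto. rewrite S_INR, H; ring.
Qed.

Lemma same_sign_decompose u v e : is_sign e -> u = e * Rabs u -> same_sign u v -> v = e * Rabs v.
Proof.
  intros He Eu H. unfold same_sign in H. rewrite Eu in H. generalize (Rabs_pos u); intros.
  destruct He as [->| ->]; unfold Rabs at 1; destruct (Rcase_abs v); nra.
Qed.

(** The inner angle [th] satisfies [n * th <= C]. Each of the [m] pairs of inner letters differs
    from a diagonal rotation by a multiple of [th ^ 2], in total a multiple of [C * th]; an unpaired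
    inner letter, present for odd [n], is dropped with an error of order [th]. Multiplied by [n],
    everything is bounded in terms of [C]. Even [n] leads to form (4), odd [n] to form (3). *)
Lemma long_word_close x a b c e n :
  same_sign a c -> Rabs b = Rabs c -> same_sign e (if Nat.even n then b else c) ->
  let w := (x, a) :: alternating n (negb x, b) (x, c) ++
        [if Nat.even n then (negb x, e) else (x, e)] in
  exists q', has_normal_form (q', wcost w) /\
    INR n * qabs (qsub (wprod w) q') <= (64 * wcost w + 8) * wcost w.
Proof.
  intros Hac Hbc He w.
  destruct (sign_decompose a) as (s & Hs & Ea). destruct (sign_decompose b) as (s' & Hs' & Eb).
  assert (Ec := same_sign_decompose a c s Hs Ea Hac).
  set (m := Nat.div2 n). set (th := Rabs b).
  assert (Hth : 0 <= th) by apply Rabs_pos.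
  assert (Hm : 0 <= INR m) by apply pos_INR.
  set (l := if Nat.even n then (negb x, e) else (x, e)) in *.
  assert (El : l = if Nat.even n then (negb x, s' * Rabs e) else (x, s * Rabs e)).
  { unfold l. destruct (Nat.even n); f_equal.
    - apply (same_sign_decompose b); auto. unfold same_sign in *; lra.
    - apply (same_sign_decompose c); auto. unfold same_sign in *; lra. }
  assert (Hn : n = if Nat.even n then (2 * m)%nat else (2 * m + 1)%nat).
  { unfold m. generalize (Nat.div2_odd n). rewrite <- Nat.negb_even.
    destruct (Nat.even n); simpl; lia. }
  assert (Hn' : 2 * INR m <= INR n).
  { replace (2 * INR m) with (INR (2 * m)) by (rewrite mult_INR; simpl; ring).
    apply le_INR. destruct (Nat.even n); lia. }
  assert (Cw : wcost w = Rabs a + INR n * th + Rabs e).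
  { unfold w. cbn [wcost fold_right]. fold (wcost (alternating n (negb x, b) (x, c) ++ [l])).
    rewrite wcost_app, wcost_alternating by (simpl; auto). simpl.
    unfold l; destruct (Nat.even n); simpl; unfold th; ring. }
  set (C := wcost w) in *.
  generalize (Rabs_pos a) (Rabs_pos e) (pos_INR n); intros Pa Pe Pn.
  (* Merging the [m] pairs gives coefficients [m * th] on both axes, that is, the time [2 * m * th]
     along half the sum of the signed axes, at the same cost. *)
  set (D := fquat (2 * INR m * th, axis_pair x (s / 2) (s' / 2))).
  exists (qmul (lquat (x, s * Rabs a)) (qmul D
    (lquat (if Nat.even n then (negb x, s' * Rabs e) else (x, s * Rabs e))))).
  split.
  { eapply has_normal_form_mono;
      [apply (form34_quat (Nat.even n) x s s' (Rabs a) (2 * INR m * th) (Rabs e)); auto|apply qeq_refl|].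
    - unfold nonneg. assert (0 <= INR m * th) by (apply Rmult_le_pos; auto). lra.
    - rewrite Cw. assert (2 * INR m * th <= INR n * th) by (apply Rmult_le_compat_r; auto). lra. }
  rewrite <- El, <- Ea.
  assert (ED : D = qpow (fquat (1, axis_pair (negb x) b c)) m).
  { assert (Hz : 0 <= 2 * INR m * th) by (apply Rmult_le_pos; lra).
    unfold D. rewrite Eb, Ec, <- Hbc. fold th.
    destruct x; simpl; rewrite fquat_pow, Rmult_1_r, (fquat_rescale (INR m)),
      (fquat_rescale (2 * INR m * th)) by auto; do 3 f_equal; field. }
  set (P := qmul (lquat (negb x, b)) (lquat (x, c))).
  assert (EP : qabs (qsub (qpow P m) D) <= 16 * INR m * th ^ 2).
  { rewrite ED. eapply Rle_trans; [apply qpow_close|].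
    - apply qunit_mul; apply lquat_unit.
    - apply fquat_unit.
    - generalize (lie_product_error_axis (negb x) b c). rewrite Bool.negb_involutive. fold P.
      replace (c ^ 2) with (b ^ 2) by (rewrite <- (pow2_abs b), <- (pow2_abs c), Hbc; ring).
      rewrite <- (pow2_abs b). fold th. intros Z. nra. }
  assert (UP : qunit (qpow P m)) by (apply qunit_pow, qunit_mul; apply lquat_unit).
  assert (UD : qunit D) by apply fquat_unit.
  destruct (wprod_alternating m (negb x, b) (x, c)) as [A1 A2]. fold P in A1, A2.
  assert (EA : qabs (qsub (wprod (alternating n (negb x, b) (x, c))) D) <=
    32 * INR m * th ^ 2 + 2 * th).
  { assert (0 <= INR m * th ^ 2) by (apply Rmult_le_pos; [auto|apply pow2_ge_0]).
    destruct (Nat.even n); rewrite Hn.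
    - rewrite A1. lra.
    - rewrite A2. rewrite <- (qmul_1_r D).
      eapply Rle_trans; [apply qabs_mul_close; [auto|apply qunit_one]|].
      generalize (lquat_lipschitz (negb x) b 0). rewrite lquat_0, Rminus_0_r. fold th. lra. }
  assert (Ew : qabs (qsub (wprod w) (qmul (lquat (x, a)) (qmul D (lquat l)))) <=
    4 * (32 * INR m * th ^ 2 + 2 * th)).
  { unfold w. cbn [wprod fold_right]. fold (wprod (alternating n (negb x, b) (x, c) ++ [l])).
    rewrite wprod_app. simpl (wprod [l]). rewrite qmul_1_r.
    eapply Rle_trans; [apply qabs_mul_close; [apply lquat_unit|apply qunit_mul; auto; apply lquat_unit]|].
    rewrite qabs_sub_diag.
    generalize (qabs_mul_close (wprod (alternating n (negb x, b) (x, c))) D (lquat l) (lquat l)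
      (wprod_unit _) (lquat_unit _)). rewrite qabs_sub_diag. lra. }
  assert (Hnth : INR n * th <= C) by lra.
  assert (0 <= INR n * th) by (apply Rmult_le_pos; auto).
  assert (HC : 0 <= C) by lra.
  assert (Hmth : 2 * INR m * th <= C).
  { assert (2 * INR m * th <= INR n * th) by (apply Rmult_le_compat_r; auto). lra. }
  (* From [Ew], [128 * m * th ^ 2 + 8 * th] is [(64 * (2 * m * th) + 8) * th], and
     [2 * m * th <= C]. *)
  apply Rle_trans with (INR n * ((64 * C + 8) * th)).
  - apply Rmult_le_compat_l; auto. eapply Rle_trans; [apply Ew|].
    assert (2 * INR m * th * th <= C * th) by (apply Rmult_le_compat_r; auto).
    nra.
  - replace (INR n * ((64 * C + 8) * th)) with ((64 * C + 8) * (INR n * th)) by ring.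
    apply Rmult_le_compat_l; lra.
Qed.

(** By closedness it suffices to find normal forms arbitrarily near. Raising the cap never raises
    the cost of the reduced word above that of [w0], so the bound of [long_word_close] is uniform in
    [N]. *)
Lemma word_has_normal_form w0 : has_normal_form (wprod w0, wcost w0).
Proof.
  apply has_normal_form_closed. intros eps Heps.
  set (C := wcost w0). assert (HC : 0 <= C) by apply wcost_pos.
  (* In the long case [n >= N - 3 > K], which makes the error smaller than [eps]. *)
  destruct (INR_unbounded ((64 * C + 8) * C / eps)) as [K HK].
  set (N := (length w0 + 6 + K)%nat).
  destruct (exists_reduced N w0) as (w & Hw & Hq & Hc); [lia|].
  assert (Hn : has_normal_form (wprod w, wcost w) \/
    exists q', has_normal_form (q', wcost w) /\ qabs (qsub (wprod w) q') < eps).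
  { destruct (reduced_classification N w) as [H|(x & a & b & c & e & n & E & H1 & H2 & H3 & H4)];
      auto; [lia|right].
    destruct (long_word_close x a b c e n H2 H3 H4) as (q' & Hq' & Hd).
    cbv zeta in Hq', Hd. rewrite <- E in Hq', Hd. exists q'; split; auto.
    assert (Hn : INR K < INR n) by (apply lt_INR; lia).
    generalize (pos_INR K) (wcost_pos w) (qabs_pos (qsub (wprod w) q')); intros P1 P2 P3.
    assert ((64 * wcost w + 8) * wcost w <= (64 * C + 8) * C).
    { apply Rmult_le_compat; fold C in Hc; lra. }
    apply (Rmult_lt_compat_r eps) in HK; auto.
    replace ((64 * C + 8) * C / eps * eps) with ((64 * C + 8) * C) in HK by (field; lra).
    apply (Rmult_lt_reg_l (INR n)); [lra|]. nra. }
  (* The reduced word has the right product only up to sign, while [qnear] compares quaternions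
     themselves; the sign is transferred to the normal form. *)
  assert (G : forall q', has_normal_form (q', wcost w) -> qabs (qsub (wprod w) q') < eps ->
    exists a', qnear eps (wprod w0, C) a' /\ has_normal_form a').
  { intros q' Hq' Hd. destruct Hq as [Hq|Hq].
    - exists (q', C); split.
      + split; simpl; [rewrite <- Hq; auto|rewrite Rminus_diag, Rabs_R0; auto].
      + eapply has_normal_form_mono; [apply Hq'|apply qeq_refl|auto].
    - exists (qneg q', C); split.
      + split; simpl; [|rewrite Rminus_diag, Rabs_R0; auto].
        rewrite Hq in Hd.
        replace (qabs (qsub (wprod w0) (qneg q'))) with (qabs (qsub (qneg (wprod w0)) q')); auto.
        unfold qabs, qsub, qneg; simpl.
        assert (E : forall x y, Rabs (- x - y) = Rabs (x - - y)).
        { intros; rewrite <- Rabs_Ropp; f_equal; ring. }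
        now rewrite !E.
      + eapply has_normal_form_mono; [apply Hq'|right; now rewrite qneg_neg|auto]. }
  destruct Hn as [Hn|(q' & Hq' & Hd)]; [|now apply (G q')].
  apply (G (wprod w)); auto. rewrite qabs_sub_diag; auto.
Qed.

(** * Arbitrary decompositions *)

Fixpoint staircase (n : nat) (x y : R) : list letter :=
  match n with O => [] | S n => (false, x) :: (true, y) :: staircase n x y end.

Lemma wprod_staircase n x y :
  wprod (staircase n x y) = qpow (qmul (lquat (false, x)) (lquat (true, y))) n.
Proof.
  induction n as [|n IH]; [reflexivity|].
  cbn [staircase wprod fold_right]. fold (wprod (staircase n x y)).
  rewrite IH, qmul_assoc, qpow_comm. reflexivity.
Qed.

Lemma wcost_staircase n x y : wcost (staircase n x y) = INR n * (Rabs x + Rabs y).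
Proof.
  induction n as [|n IH]; [simpl; ring|].
  cbn [staircase wcost fold_right]. fold (wcost (staircase n x y)).
  rewrite IH, S_INR; simpl; ring.
Qed.

Lemma factor_approximation f e : 0 <= fst f -> 0 < e ->
  exists w, wcost w = fst f * (Rabs (fst (snd f)) + 1 * Rabs (snd (snd f))) /\
    qabs (qsub (wprod w) (fquat f)) < e.
Proof.
  destruct f as [t [a b]]; simpl. intros Ht He.
  (* The constants 4 of [qpow_close] and 2 of [lie_product_error] combine to a total error of at
     most [M / N]. *)
  set (M := 8 * ((t * a) ^ 2 + (t * b) ^ 2)).
  assert (HM : 0 <= M) by (unfold M; generalize (pow2_ge_0 (t * a)) (pow2_ge_0 (t * b)); lra).
  destruct (INR_unbounded (M / e)) as [K HK].
  assert (HN : 0 < INR (S K)) by (rewrite S_INR; generalize (pos_INR K); lra).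
  assert (HKN : INR K < INR (S K)) by (rewrite S_INR; lra).
  set (N := INR (S K)) in *.
  exists (staircase (S K) (t * a / N) (t * b / N)); split.
  - rewrite wcost_staircase. fold N. unfold Rdiv. rewrite !Rabs_mult.
    rewrite (Rabs_right t), (Rabs_right (/ N)) by (try lra; apply Rle_ge, Rlt_le, Rinv_0_lt_compat; lra).
    field; lra.
  - rewrite wprod_staircase, fquat_rescale by auto.
    replace (fquat (1, (t * a, t * b))) with (qpow (fquat (1, (t * a / N, t * b / N))) (S K)).
    2:{ rewrite fquat_pow, Rmult_1_r. fold N. rewrite fquat_rescale by lra. do 3 f_equal; field; lra. }
    eapply Rle_lt_trans; [apply qpow_close; [apply qunit_mul; apply lquat_unit|apply fquat_unit]|].
    fold N. generalize (lie_product_error (t * a / N) (t * b / N)).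
    replace (2 * ((t * a / N) ^ 2 + (t * b / N) ^ 2)) with (M / (4 * N * N)) by (unfold M; field; lra).
    intros Z. apply Rle_lt_trans with (4 * N * (M / (4 * N * N))).
    + apply Rmult_le_compat_l; lra.
    + replace (4 * N * (M / (4 * N * N))) with (M / N) by (field; lra).
      apply (Rmult_lt_compat_r e) in HK; auto.
      replace (M / e * e) with M in HK by (field; lra).
      apply (Rmult_lt_reg_r N); auto. replace (M / N * N) with M by (field; lra). nra.
Qed.

Lemma decomposition_approximation d e : Forall (fun f => 0 <= fst f) d -> 0 < e ->
  exists w, wcost w = cost_decomp 1 d /\ qabs (qsub (wprod w) (dquat d)) < e.
Proof.
  intros H; revert e; induction H as [|f d Hf Hd IH]; intros e He.
  - exists []; simpl. rewrite qabs_sub_diag; auto.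
  - destruct (IH (e / 4)) as (w & C & E); [lra|].
    destruct (factor_approximation f (e / 4)) as (u & Cu & Eu); auto; [lra|].
    exists (u ++ w). rewrite wcost_app, wprod_app, C, Cu; simpl. split; auto.
    eapply Rle_lt_trans; [apply qabs_mul_close; [apply wprod_unit|apply dquat_unit]|]. lra.
Qed.

Lemma decomposition_has_normal_form d : Forall (fun f => 0 <= fst f) d ->
  has_normal_form (dquat d, cost_decomp 1 d).
Proof.
  intros H. apply has_normal_form_closed. intros e He.
  destruct (decomposition_approximation d e H He) as (w & C & E).
  exists (wprod w, wcost w); split; [|apply word_has_normal_form].
  split; simpl; [rewrite qabs_sub_sym; auto|rewrite C, Rminus_diag, Rabs_R0; auto].
Qed.

(** * From quaternions to rotation matrices *)

Lemma mat_eq (A B : mat) :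
  m11 A = m11 B -> m12 A = m12 B -> m13 A = m13 B ->
  m21 A = m21 B -> m22 A = m22 B -> m23 A = m23 B ->
  m31 A = m31 B -> m32 A = m32 B -> m33 A = m33 B -> A = B.
Proof. destruct A, B; simpl; congruence. Qed.

Lemma mat_mul_assoc A B C : mat_mul A (mat_mul B C) = mat_mul (mat_mul A B) C.
Proof. unfold mat_mul; simpl; f_equal; ring. Qed.
Lemma mat_mul_1_l A : mat_mul mat_id A = A.
Proof. apply mat_eq; simpl; ring. Qed.
Lemma mat_mul_1_r A : mat_mul A mat_id = A.
Proof. apply mat_eq; simpl; ring. Qed.
Lemma transpose_mul A B : transpose (mat_mul A B) = mat_mul (transpose B) (transpose A).
Proof. unfold transpose, mat_mul; simpl; f_equal; ring. Qed.
Lemma transpose_transpose A : transpose (transpose A) = A.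
Proof. now destruct A. Qed.
Lemma det_mul A B : det (mat_mul A B) = det A * det B.
Proof. unfold det, mat_mul; simpl; ring. Qed.
Lemma det_transpose A : det (transpose A) = det A.
Proof. unfold det, transpose; simpl; ring. Qed.

Definition qmat (p : quat) : mat :=
  mkM (q0 p ^ 2 + q1 p ^ 2 - q2 p ^ 2 - q3 p ^ 2) (2 * (q1 p * q2 p - q0 p * q3 p))
      (2 * (q1 p * q3 p + q0 p * q2 p))
      (2 * (q1 p * q2 p + q0 p * q3 p)) (q0 p ^ 2 - q1 p ^ 2 + q2 p ^ 2 - q3 p ^ 2)
      (2 * (q2 p * q3 p - q0 p * q1 p))
      (2 * (q1 p * q3 p - q0 p * q2 p)) (2 * (q2 p * q3 p + q0 p * q1 p))
      (q0 p ^ 2 - q1 p ^ 2 - q2 p ^ 2 + q3 p ^ 2).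

Lemma qmat_mul p q : qmat (qmul p q) = mat_mul (qmat p) (qmat q).
Proof. unfold qmat, qmul, mat_mul; simpl; f_equal; ring. Qed.

Lemma qmat_one : qmat qone = mat_id.
Proof. unfold qmat, qone, mat_id; simpl; f_equal; ring. Qed.

Lemma qmat_neg p : qmat (qneg p) = qmat p.
Proof. unfold qmat, qneg; simpl; f_equal; ring. Qed.

(** With the norm fixed, the matrix determines all products of two coordinates. A nonzero coordinate
    is then known up to sign, and this sign fixes the other three. *)
Lemma qmat_injective p q : qunit p -> qunit q -> qmat p = qmat q -> qeq p q.
Proof.
  intros Hp Hq E. unfold qunit, qnorm2 in *.
  assert (E11 := f_equal m11 E). assert (E12 := f_equal m12 E). assert (E13 := f_equal m13 E).
  assert (E21 := f_equal m21 E). assert (E22 := f_equal m22 E). assert (E23 := f_equal m23 E).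
  assert (E31 := f_equal m31 E). assert (E32 := f_equal m32 E). assert (E33 := f_equal m33 E).
  clear E. destruct p as [a b c d], q as [a' b' c' d']. cbn [q0 q1 q2 q3 qmat m11 m12 m13 m21 m22 m23 m31 m32 m33] in *.
  assert (K : forall x x', x * x = x' * x' -> x = x' \/ x = - x').
  { intros x x' H. assert (H' : (x - x') * (x + x') = 0) by lra.
    apply Rmult_integral in H'; lra. }
  assert (L : forall x x' y y', x <> 0 -> x = x' -> x * y = x' * y' -> y = y').
  { intros x x' y y' Hx <- H. now apply Rmult_eq_reg_l in H. }
  assert (L' : forall x x' y y', x <> 0 -> x = - x' -> x * y = x' * y' -> y = - y').
  { intros x x' y y' Hx Hx' H. apply (Rmult_eq_reg_l x); auto. rewrite H, Hx'. ring. }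
  assert (aa : a * a = a' * a') by lra. assert (bb : b * b = b' * b') by lra.
  assert (cc : c * c = c' * c') by lra. assert (dd : d * d = d' * d') by lra.
  assert (ab : a * b = a' * b') by lra. assert (ac : a * c = a' * c') by lra.
  assert (ad : a * d = a' * d') by lra. assert (bc : b * c = b' * c') by lra.
  assert (bd : b * d = b' * d') by lra. assert (cd : c * d = c' * d') by lra.
  assert (ba : b * a = b' * a') by lra. assert (ca : c * a = c' * a') by lra.
  assert (da : d * a = d' * a') by lra. assert (cb : c * b = c' * b') by lra.
  assert (db : d * b = d' * b') by lra. assert (dc : d * c = d' * c') by lra.
  assert (N : a <> 0 \/ b <> 0 \/ c <> 0 \/ d <> 0).
  { apply NNPP; intros N.
    assert (a = 0) by (apply NNPP; tauto). assert (b = 0) by (apply NNPP; tauto).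
    assert (c = 0) by (apply NNPP; tauto). assert (d = 0) by (apply NNPP; tauto). subst. lra. }
  unfold qeq, qneg; simpl.
  destruct N as [N|[N|[N|N]]];
    [destruct (K _ _ aa)|destruct (K _ _ bb)|destruct (K _ _ cc)|destruct (K _ _ dd)];
    ((left; f_equal; solve [assumption|eapply L; eassumption]) ||
     (right; f_equal; solve [assumption|eapply L'; eassumption])).
Qed.

Definition cross (u w : vec) : vec :=
  mkV (v2 u * v3 w - v3 u * v2 w) (v3 u * v1 w - v1 u * v3 w) (v1 u * v2 w - v2 u * v1 w).

Definition frame (X Y : vec) : mat :=
  let Z := cross X Y in
  mkM (v1 X) (v1 Y) (v1 Z) (v2 X) (v2 Y) (v2 Z) (v3 X) (v3 Y) (v3 Z).

Definition orthonormal (X Y : vec) : Prop := dot X X = 1 /\ dot Y Y = 1 /\ dot X Y = 0.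

Lemma frame_orthogonal X Y : orthonormal X Y ->
  mat_mul (transpose (frame X Y)) (frame X Y) = mat_id /\
  mat_mul (frame X Y) (transpose (frame X Y)) = mat_id /\ det (frame X Y) = 1.
Proof.
  destruct X as [x1 x2 x3], Y as [y1 y2 y3]. unfold orthonormal, dot; simpl.
  intros (HX & HY & HXY).
  assert (X3 : x3 * x3 = 1 - x1 * x1 - x2 * x2) by lra.
  assert (Y3 : y3 * y3 = 1 - y1 * y1 - y2 * y2) by lra.
  assert (XY : x3 * y3 = - x1 * y1 - x2 * y2) by lra.
  split; [|split].
  - apply mat_eq; simpl; try lra; try ring.
    transitivity ((x1 * x1 + x2 * x2 + x3 * x3) * (y1 * y1 + y2 * y2 + y3 * y3) -
      (x1 * y1 + x2 * y2 + x3 * y3) ^ 2); [ring|]. rewrite HX, HY, HXY; ring.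
  (* Lagrange's identity in two coordinates rewrites the entries of the cross product; cyclic
     permutations of the coordinates give the remaining rows. *)
  - assert (D : forall a b c a' b' c', a * a + b * b + c * c = 1 -> a' * a' + b' * b' + c' * c' = 1 ->
      a * a' + b * b' + c * c' = 0 -> a * a + a' * a' + (b * c' - c * b') * (b * c' - c * b') = 1).
    { intros a b c a' b' c' H1 H2 H3.
      transitivity (a * a + a' * a' + ((b * b + c * c) * (b' * b' + c' * c') - (b * b' + c * c') ^ 2));
        [ring|].
      replace (b * b + c * c) with (1 - a * a) by lra.
      replace (b' * b' + c' * c') with (1 - a' * a') by lra.
      replace (b * b' + c * c') with (- (a * a')) by lra. ring. }
    assert (F : forall a b c a' b' c', a * a + b * b + c * c = 1 -> a' * a' + b' * b' + c' * c' = 1 ->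
      a * a' + b * b' + c * c' = 0 ->
      a * b + a' * b' + (b * c' - c * b') * (c * a' - a * c') = 0).
    { intros a b c a' b' c' H1 H2 H3.
      transitivity (a * b + a' * b' + (c * c') * (b * a' + a * b') - a * b * (c' * c') - a' * b' * (c * c));
        [ring|].
      replace (c * c') with (- (a * a') - b * b') by lra.
      replace (c' * c') with (1 - a' * a' - b' * b') by lra.
      replace (c * c) with (1 - a * a - b * b) by lra. ring. }
    apply mat_eq; simpl.
    + apply (D x1 x2 x3 y1 y2 y3); lra.
    + rewrite <- (F x1 x2 x3 y1 y2 y3); lra.
    + rewrite <- (F x3 x1 x2 y3 y1 y2); lra.
    + rewrite <- (F x1 x2 x3 y1 y2 y3); lra.
    + rewrite <- (D x2 x3 x1 y2 y3 y1); lra.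
    + rewrite <- (F x2 x3 x1 y2 y3 y1); lra.
    + rewrite <- (F x3 x1 x2 y3 y1 y2); lra.
    + rewrite <- (F x2 x3 x1 y2 y3 y1); lra.
    + rewrite <- (D x3 x1 x2 y3 y1 y2); lra.
  - unfold det; simpl.
    transitivity ((x1 * x1 + x2 * x2 + x3 * x3) * (y1 * y1 + y2 * y2 + y3 * y3) -
      (x1 * y1 + x2 * y2 + x3 * y3) ^ 2); [ring|]. rewrite HX, HY, HXY; ring.
Qed.

Definition rotation (X Y : vec) (p : quat) : mat :=
  mat_mul (frame X Y) (mat_mul (qmat p) (transpose (frame X Y))).

Lemma rotation_mul X Y p q : orthonormal X Y ->
  rotation X Y (qmul p q) = mat_mul (rotation X Y p) (rotation X Y q).
Proof.
  intros H. destruct (frame_orthogonal X Y H) as (E & _ & _).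
  unfold rotation. rewrite qmat_mul. set (O := frame X Y) in *.
  rewrite <- !mat_mul_assoc, (mat_mul_assoc (transpose O) O), E, mat_mul_1_l. reflexivity.
Qed.

Lemma rotation_one X Y : orthonormal X Y -> rotation X Y qone = mat_id.
Proof.
  intros H. destruct (frame_orthogonal X Y H) as (_ & E & _).
  unfold rotation. now rewrite qmat_one, mat_mul_1_l.
Qed.

Lemma rotation_qeq X Y p q : qeq p q -> rotation X Y p = rotation X Y q.
Proof. intros [->| ->]; unfold rotation; now rewrite ?qmat_neg. Qed.

Lemma rotation_injective X Y p q : orthonormal X Y -> qunit p -> qunit q ->
  rotation X Y p = rotation X Y q -> qeq p q.
Proof.
  intros H Hp Hq E. apply qmat_injective; auto.
  destruct (frame_orthogonal X Y H) as (E1 & _ & _).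
  unfold rotation in E. set (O := frame X Y) in *.
  assert (T : forall M, mat_mul (mat_mul (transpose O) (mat_mul O (mat_mul M (transpose O)))) O = M).
  { intros M. rewrite <- !mat_mul_assoc, E1, mat_mul_1_r, mat_mul_assoc, E1. apply mat_mul_1_l. }
  rewrite <- (T (qmat p)), <- (T (qmat q)), E. reflexivity.
Qed.

(** The cosine part is invariant because the frame is orthogonal. The sine part needs a positively
    oriented frame, through [Y x Z = X] and [Z x X = Y]. *)
Lemma rot_unit_frame X Y t a b : orthonormal X Y ->
  mat_mul (frame X Y) (mat_mul (rot_unit t (mkV a b 0)) (transpose (frame X Y))) =
  rot_unit t (vadd (vscale a X) (vscale b Y)).
Proof.
  intros H. destruct (frame_orthogonal X Y H) as (_ & E & _).
  assert (E11 := f_equal m11 E). assert (E12 := f_equal m12 E). assert (E13 := f_equal m13 E).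
  assert (E22 := f_equal m22 E). assert (E23 := f_equal m23 E). assert (E33 := f_equal m33 E).
  assert (C : cross Y (cross X Y) = X /\ cross (cross X Y) X = Y).
  { clear E E11 E12 E13 E22 E23 E33. destruct H as (HX & HY & HXY).
    destruct X as [x1 x2 x3], Y as [y1 y2 y3]. unfold dot in *; simpl in *.
    unfold cross; simpl. split; f_equal.
    - transitivity (x1 * (y1 * y1 + y2 * y2 + y3 * y3) - y1 * (x1 * y1 + x2 * y2 + x3 * y3)); [ring|].
      rewrite HY, HXY; ring.
    - transitivity (x2 * (y1 * y1 + y2 * y2 + y3 * y3) - y2 * (x1 * y1 + x2 * y2 + x3 * y3)); [ring|].
      rewrite HY, HXY; ring.
    - transitivity (x3 * (y1 * y1 + y2 * y2 + y3 * y3) - y3 * (x1 * y1 + x2 * y2 + x3 * y3)); [ring|].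
      rewrite HY, HXY; ring.
    - transitivity (y1 * (x1 * x1 + x2 * x2 + x3 * x3) - x1 * (x1 * y1 + x2 * y2 + x3 * y3)); [ring|].
      rewrite HX, HXY; ring.
    - transitivity (y2 * (x1 * x1 + x2 * x2 + x3 * x3) - x2 * (x1 * y1 + x2 * y2 + x3 * y3)); [ring|].
      rewrite HX, HXY; ring.
    - transitivity (y3 * (x1 * x1 + x2 * x2 + x3 * x3) - x3 * (x1 * y1 + x2 * y2 + x3 * y3)); [ring|].
      rewrite HX, HXY; ring. }
  destruct C as [CX CY].
  assert (X1 := f_equal v1 CX). assert (X2 := f_equal v2 CX). assert (X3 := f_equal v3 CX).
  assert (Y1 := f_equal v1 CY). assert (Y2 := f_equal v2 CY). assert (Y3 := f_equal v3 CY).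
  clear E CX CY H. unfold frame in *. set (Z := cross X Y) in *. clearbody Z.
  destruct X as [x1 x2 x3], Y as [y1 y2 y3], Z as [z1 z2 z3].
  unfold rot_unit. set (c := cos t). set (s := sin t). clearbody c s.
  cbn [cross mat_mul transpose mat_id m11 m12 m13 m21 m22 m23 m31 m32 m33 v1 v2 v3] in *.
  unfold vadd, vscale; apply mat_eq; cbn [mat_mul transpose m11 m12 m13 m21 m22 m23 m31 m32 m33 v1 v2 v3].
  - transitivity (c * (x1 * x1 + y1 * y1 + z1 * z1) +
      (1 - c) * (a * x1 + b * y1) * (a * x1 + b * y1)); [ring|rewrite E11; ring].
  - transitivity (c * (x1 * x2 + y1 * y2 + z1 * z2) - s * (a * (y1 * z2 - y2 * z1) + b * (z1 * x2 - z2 * x1)) +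
      (1 - c) * (a * x1 + b * y1) * (a * x2 + b * y2)); [ring|rewrite E12, X3, Y3; ring].
  - transitivity (c * (x1 * x3 + y1 * y3 + z1 * z3) + s * (a * (y3 * z1 - y1 * z3) + b * (z3 * x1 - z1 * x3)) +
      (1 - c) * (a * x1 + b * y1) * (a * x3 + b * y3)); [ring|rewrite E13, X2, Y2; ring].
  - transitivity (c * (x1 * x2 + y1 * y2 + z1 * z2) + s * (a * (y1 * z2 - y2 * z1) + b * (z1 * x2 - z2 * x1)) +
      (1 - c) * (a * x2 + b * y2) * (a * x1 + b * y1)); [ring|rewrite E12, X3, Y3; ring].
  - transitivity (c * (x2 * x2 + y2 * y2 + z2 * z2) +
      (1 - c) * (a * x2 + b * y2) * (a * x2 + b * y2)); [ring|rewrite E22; ring].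
  - transitivity (c * (x2 * x3 + y2 * y3 + z2 * z3) - s * (a * (y2 * z3 - y3 * z2) + b * (z2 * x3 - z3 * x2)) +
      (1 - c) * (a * x2 + b * y2) * (a * x3 + b * y3)); [ring|rewrite E23, X1, Y1; ring].
  - transitivity (c * (x1 * x3 + y1 * y3 + z1 * z3) - s * (a * (y3 * z1 - y1 * z3) + b * (z3 * x1 - z1 * x3)) +
      (1 - c) * (a * x3 + b * y3) * (a * x1 + b * y1)); [ring|rewrite E13, X2, Y2; ring].
  - transitivity (c * (x2 * x3 + y2 * y3 + z2 * z3) + s * (a * (y2 * z3 - y3 * z2) + b * (z2 * x3 - z3 * x2)) +
      (1 - c) * (a * x3 + b * y3) * (a * x2 + b * y2)); [ring|rewrite E23, X1, Y1; ring].
  - transitivity (c * (x3 * x3 + y3 * y3 + z3 * z3) +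
      (1 - c) * (a * x3 + b * y3) * (a * x3 + b * y3)); [ring|rewrite E33; ring].
Qed.

(** * Decompositions in terms of quaternions *)

Lemma factor_vec_dot X Y t a b : orthonormal X Y ->
  dot (factor_vec X Y (t, (a, b))) (factor_vec X Y (t, (a, b))) = a ^ 2 + b ^ 2.
Proof.
  intros (HX & HY & HXY). unfold factor_vec; simpl.
  transitivity (a ^ 2 * dot X X + b ^ 2 * dot Y Y + 2 * a * b * dot X Y).
  - unfold dot, vadd, vscale; simpl; ring.
  - rewrite HX, HY, HXY; ring.
Qed.

Lemma factor_vec_nonzero X Y t a b : orthonormal X Y ->
  (factor_vec X Y (t, (a, b)) <> mkV 0 0 0 <-> (a, b) <> (0, 0)).
Proof.
  intros H. split; intros K E; apply K.
  - injection E as -> ->. unfold factor_vec, vadd, vscale; simpl. f_equal; ring.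
  - generalize (factor_vec_dot X Y t a b H). rewrite E. unfold dot; simpl. intros Z.
    f_equal; nra.
Qed.

Lemma rot_unit_quat t a b : a ^ 2 + b ^ 2 = 1 ->
  rot_unit (2 * t) (mkV a b 0) = qmat (mkQ (cos t) (a * sin t) (b * sin t) 0).
Proof.
  intros E. unfold rot_unit, qmat; cbn [v1 v2 v3 q0 q1 q2 q3].
  rewrite cos_2a, sin_2a. generalize (sin2_cos2' t); intros G.
  assert (C2 : cos t ^ 2 = 1 - sin t ^ 2) by lra.
  assert (B2 : b ^ 2 = 1 - a ^ 2) by lra.
  apply mat_eq; cbn [m11 m12 m13 m21 m22 m23 m31 m32 m33]; ring [C2 B2].
Qed.

Lemma factor_mat_rotation X Y f : orthonormal X Y -> snd f <> (0, 0) ->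
  factor_mat X Y f = rotation X Y (fquat f).
Proof.
  destruct f as [t [a b]]; simpl. intros H Hab.
  unfold factor_mat, rot. simpl fst.
  assert (En : vnorm (factor_vec X Y (t, (a, b))) = sqrt (a ^ 2 + b ^ 2)).
  { unfold vnorm; now rewrite factor_vec_dot. }
  rewrite En. unfold fquat; simpl fst; simpl snd.
  destruct (coef_norm a b) as (H0 & H1 & _ & _ & _ & H2).
  set (r := sqrt (a ^ 2 + b ^ 2)) in *.
  assert (Hr : r <> 0) by (intros Z; destruct (H2 Z) as [-> ->]; auto).
  replace (vscale (/ r) (factor_vec X Y (t, (a, b))))
    with (vadd (vscale (a / r) X) (vscale (b / r) Y)).
  2:{ unfold factor_vec, vadd, vscale; simpl; f_equal; field; auto. }
  rewrite <- rot_unit_frame by auto. unfold rotation. do 2 f_equal.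
  replace (t * r) with (2 * (t * r / 2)) at 1 by field.
  rewrite rot_unit_quat.
  - do 2 f_equal; field; auto.
  - transitivity ((a ^ 2 + b ^ 2) / r ^ 2); [field; auto|]. rewrite <- H1. field; auto.
Qed.

Lemma prod_decomp_rotation X Y d : orthonormal X Y -> Forall (fun f => snd f <> (0, 0)) d ->
  prod_decomp X Y d = rotation X Y (dquat d).
Proof.
  intros H. induction 1 as [|f d Hf Hd IH]; simpl.
  - now rewrite rotation_one.
  - now rewrite IH, factor_mat_rotation, rotation_mul.
Qed.

Lemma is_decomp_rotation X Y g d : orthonormal X Y ->
  (is_decomp X Y g d <->
   Forall (fun f => 0 <= fst f /\ snd f <> (0, 0)) d /\ rotation X Y (dquat d) = g).
Proof.
  intros H. unfold is_decomp.
  assert (E : Forall (fun f => 0 <= fst f /\ factor_vec X Y f <> mkV 0 0 0) d <->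
              Forall (fun f => 0 <= fst f /\ snd f <> (0, 0)) d).
  { split; apply Forall_impl; intros [t [a b]]; rewrite factor_vec_nonzero; auto. }
  rewrite E. split; intros [F P]; split; auto.
  - rewrite <- prod_decomp_rotation; auto. eapply Forall_impl; [|apply F]. simpl; tauto.
  - rewrite prod_decomp_rotation; auto. eapply Forall_impl; [|apply F]. simpl; tauto.
Qed.

(** * Every rotation is a product of axis rotations *)

Lemma unit_circle x y : x ^ 2 + y ^ 2 = 1 -> exists t, cos t = x /\ sin t = y.
Proof.
  intros H. assert (Hx : -1 <= x <= 1) by (generalize (pow2_ge_0 y); nra).
  assert (E : sqrt (1 - x²) = Rabs y).
  { rewrite <- sqrt_Rsqr_abs. f_equal. unfold Rsqr; lra. }
  destruct (Rle_lt_dec 0 y) as [K|K].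
  - exists (acos x). rewrite cos_acos, sin_acos, E by auto. rewrite Rabs_right by lra. auto.
  - exists (- acos x). rewrite cos_neg, sin_neg, cos_acos, sin_acos, E by auto.
    rewrite Rabs_left by lra. split; ring.
Qed.

Lemma polar_angle x y : exists t, x = sqrt (x ^ 2 + y ^ 2) * cos t /\ y = sqrt (x ^ 2 + y ^ 2) * sin t.
Proof.
  destruct (coef_norm x y) as (H0 & H1 & _ & _ & _ & H2).
  set (r := sqrt (x ^ 2 + y ^ 2)) in *.
  destruct (Req_dec r 0) as [Z|Z].
  - destruct (H2 Z) as [-> ->]. exists 0. rewrite Z; split; ring.
  - destruct (unit_circle (x / r) (y / r)) as (t & Et & Et').
    { transitivity ((x ^ 2 + y ^ 2) / r ^ 2); [field; auto|]. rewrite <- H1. field; auto. }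
    exists t. rewrite Et, Et'. split; field; auto.
Qed.

Lemma qmat_orthogonal p : qunit p ->
  mat_mul (transpose (qmat p)) (qmat p) = mat_id /\ det (qmat p) = 1.
Proof.
  unfold qunit; intros H. split.
  - apply mat_eq; cbn [mat_mul transpose qmat mat_id m11 m12 m13 m21 m22 m23 m31 m32 m33]; try ring;
    transitivity (qnorm2 p ^ 2); try (rewrite H; ring); unfold qnorm2; ring.
  - transitivity (qnorm2 p ^ 3); [unfold det, qmat, qnorm2; simpl; ring|rewrite H; ring].
Qed.

Lemma transpose_qmat p : transpose (qmat p) = qmat (qconj p).
Proof. unfold transpose, qmat, qconj; simpl; f_equal; ring. Qed.

Lemma in_SO3_mul A B : in_SO3 A -> in_SO3 B -> in_SO3 (mat_mul A B).
Proof.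
  intros [H1 H2] [H3 H4]; split.
  - rewrite transpose_mul, <- mat_mul_assoc, (mat_mul_assoc (transpose A)), H1, mat_mul_1_l; auto.
  - rewrite det_mul, H2, H4; ring.
Qed.

Lemma in_SO3_X_rotation k : in_SO3 k -> m11 k = 1 -> m21 k = 0 -> m31 k = 0 ->
  exists t, k = qmat (lquat (false, t)).
Proof.
  intros [H1 H2] E1 E2 E3.
  assert (A12 := f_equal m12 H1). assert (A13 := f_equal m13 H1). assert (A22 := f_equal m22 H1).
  assert (A23 := f_equal m23 H1).
  destruct k as [a b c d e f g h i]. unfold det in H2.
  cbn [mat_mul transpose mat_id m11 m12 m13 m21 m22 m23 m31 m32 m33] in *. subst.
  assert (b = 0) by lra. assert (c = 0) by lra. subst.
  assert (D : e * i - f * h = 1) by lra.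
  assert (S : e * e + h * h = 1) by lra.
  assert (T : e * f + h * i = 0) by lra.
  assert (i = e).
  { transitivity ((e * e + h * h) * i); [rewrite S; ring|].
    transitivity (e * (e * i - f * h) + h * (e * f + h * i)); [ring|]. rewrite D, T; ring. }
  assert (f = - h).
  { transitivity ((e * e + h * h) * f); [rewrite S; ring|].
    transitivity (e * (e * f + h * i) - h * (e * i - f * h)); [ring|]. rewrite D, T; ring. }
  subst. destruct (unit_circle e h) as (t & <- & <-); [lra|].
  exists t. unfold qmat, lquat; cbn [fst snd q0 q1 q2 q3].
  replace (cos t) with (cos (2 * (t / 2))) by (f_equal; field).
  replace (sin t) with (sin (2 * (t / 2))) by (f_equal; field).
  rewrite cos_2a, sin_2a. generalize (sin2_cos2' (t / 2)); intros G.
  f_equal; lra.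
Qed.

(** The angles [a] and [b] are spherical coordinates of the first column of [h], so [R(aX) R(bY)]
    has the same first column; the quotient fixes the first basis vector and is a rotation about
    it. *)
Lemma euler_angles h : in_SO3 h -> exists w, qmat (wprod w) = h.
Proof.
  intros Hh.
  destruct (polar_angle (- m31 h) (m21 h)) as (a & Ea & Ea').
  set (s := sqrt ((- m31 h) ^ 2 + m21 h ^ 2)) in *.
  assert (S2 : s ^ 2 = (- m31 h) ^ 2 + m21 h ^ 2)
    by (apply pow2_sqrt; generalize (pow2_ge_0 (- m31 h)) (pow2_ge_0 (m21 h)); lra).
  assert (N : m11 h ^ 2 + s ^ 2 = 1).
  { assert (A := f_equal m11 (proj1 Hh)).
    cbn [mat_mul transpose mat_id m11 m12 m13 m21 m22 m23 m31 m32 m33] in A. lra. }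
  destruct (unit_circle (m11 h) s N) as (b & Eb & Eb').
  set (u := wprod [(false, a); (true, b)]).
  assert (Uu : qunit (qconj u)) by (apply qunit_conj, wprod_unit).
  assert (M : forall t, cos t = cos (t / 2) ^ 2 - sin (t / 2) ^ 2 /\ sin t = 2 * sin (t / 2) * cos (t / 2)).
  { intros t; destruct (half_sin_cos t); auto. }
  assert (C1 : m11 (qmat u) = m11 h /\ m21 (qmat u) = m21 h /\ m31 (qmat u) = m31 h).
  { replace (m31 h) with (- (s * cos a)) by lra. rewrite Ea', <- Eb, <- Eb'.
    destruct (M a) as [-> ->], (M b) as [-> ->].
    unfold u; simpl wprod; rewrite qmul_1_r. unfold lquat, qmul, qmat; simpl.
    generalize (sin2_cos2' (a / 2)) (sin2_cos2' (b / 2)); intros G1 G2.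
    set (ca := cos (a / 2)) in *. set (sa := sin (a / 2)) in *.
    set (cb := cos (b / 2)) in *. set (sb := sin (b / 2)) in *.
    repeat split; try ring.
    transitivity ((sa ^ 2 + ca ^ 2) * (cb ^ 2 - sb ^ 2)); [ring|rewrite G1; ring]. }
  destruct C1 as (C11 & C21 & C31).
  set (k := mat_mul (qmat (qconj u)) h).
  assert (Hk : in_SO3 k) by (apply in_SO3_mul; auto; apply qmat_orthogonal; auto).
  assert (A := proj1 (qmat_orthogonal u (wprod_unit _))).
  destruct (in_SO3_X_rotation k Hk) as (t & Et).
  - unfold k. rewrite <- transpose_qmat. assert (A1 := f_equal m11 A).
    cbn [mat_mul transpose mat_id m11 m12 m13 m21 m22 m23 m31 m32 m33] in *. rewrite <- C11, <- C21, <- C31; auto.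
  - unfold k. rewrite <- transpose_qmat. assert (A1 := f_equal m21 A).
    cbn [mat_mul transpose mat_id m11 m12 m13 m21 m22 m23 m31 m32 m33] in *. rewrite <- C11, <- C21, <- C31; auto.
  - unfold k. rewrite <- transpose_qmat. assert (A1 := f_equal m31 A).
    cbn [mat_mul transpose mat_id m11 m12 m13 m21 m22 m23 m31 m32 m33] in *. rewrite <- C11, <- C21, <- C31; auto.
  - exists [(false, a); (true, b); (false, t)].
    change [(false, a); (true, b); (false, t)] with ([(false, a); (true, b)] ++ [(false, t)]).
    rewrite wprod_app. fold u. simpl wprod; rewrite qmul_1_r, qmat_mul, <- Et. unfold k.
    rewrite mat_mul_assoc, <- qmat_mul, qconj_mul_r by apply wprod_unit.
    now rewrite qmat_one, mat_mul_1_l.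
Qed.

(** A zero angle receives the coefficient 1: the vector of a factor must be nonzero even at time
    zero. *)
Definition word_factor (l : letter) : factor :=
  (Rabs (snd l), axis_pair (fst l) (if Rle_dec 0 (snd l) then 1 else -1) 0).

Lemma word_factors w :
  dquat (map word_factor w) = wprod w /\
  Forall (fun f => 0 <= fst f /\ snd f <> (0, 0)) (map word_factor w).
Proof.
  induction w as [|[x t] w [IH1 IH2]]; simpl; [auto|]. split.
  - rewrite IH1. f_equal. unfold word_factor; simpl.
    destruct (Rle_dec 0 t) as [K|K]; rewrite fquat_letter by (unfold is_sign; auto); do 2 f_equal.
    + rewrite Rabs_right; lra.
    + rewrite Rabs_left; lra.
  - constructor; auto. simpl. split; [apply Rabs_pos|].
    destruct x, (Rle_dec 0 t); simpl; intros E; injection E; lra.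
Qed.

Lemma exists_decomp X Y g : orthonormal X Y -> in_SO3 g -> exists d, is_decomp X Y g d.
Proof.
  intros H Hg. destruct (frame_orthogonal X Y H) as (E1 & E2 & E3).
  set (O := frame X Y) in *.
  assert (HO : in_SO3 O) by (split; auto).
  assert (HO' : in_SO3 (transpose O)).
  { split; [now rewrite transpose_transpose|now rewrite det_transpose]. }
  destruct (euler_angles (mat_mul (transpose O) (mat_mul g O))) as (w & Hw).
  { repeat apply in_SO3_mul; auto. }
  destruct (word_factors w) as [F1 F2].
  exists (map word_factor w). apply is_decomp_rotation; auto. split; auto.
  rewrite F1. unfold rotation. rewrite Hw. fold O.
  rewrite <- !mat_mul_assoc, E2, mat_mul_1_r, mat_mul_assoc, E2. apply mat_mul_1_l.
Qed.

(** * Optimal decompositions *)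

Lemma cost_decomp_app k d d' : cost_decomp k (d ++ d') = cost_decomp k d + cost_decomp k d'.
Proof. induction d as [|f d IH]; simpl; [ring|rewrite IH; ring]. Qed.

Lemma optimal_angle_le_PI X Y g p t a b s : orthonormal X Y ->
  optimal X Y 1 g (p ++ (t, (a, b)) :: s) -> t * sqrt (a ^ 2 + b ^ 2) <= PI.
Proof.
  intros H [Hd Ho]. apply is_decomp_rotation in Hd; auto. destruct Hd as [F P].
  apply Forall_app in F; destruct F as [Fp F]. inversion F as [|? ? [Ht Hab] Fs]; subst; simpl in *.
  destruct (coef_norm a b) as (H0 & H1 & _ & _ & H4 & H2).
  set (r := sqrt (a ^ 2 + b ^ 2)) in *.
  assert (Hr : 0 < r).
  { destruct (Rle_lt_or_eq_dec 0 r H0) as [Z|Z]; auto.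
    symmetry in Z. destruct (H2 Z) as [-> ->]; congruence. }
  apply Rnot_lt_le; intros K.
  (* A full turn takes the time [2 * PI / r]; if the remaining time is negative, [f] reverses the
     vector instead. *)
  set (u := t - 2 * PI / r).
  assert (Hu : Rabs u < t).
  { assert (PI / r < t) by (apply (Rmult_lt_reg_r r); auto; replace (PI / r * r) with PI by (field; lra); auto).
    assert (0 < PI / r) by (apply Rdiv_lt_0_compat; auto; apply PI_RGT_0).
    unfold u. replace (2 * PI / r) with (2 * (PI / r)) by (field; lra). apply Rabs_def1; lra. }
  assert (Q : fquat (u, (a, b)) = qneg (fquat (t, (a, b)))).
  { unfold fquat, qneg; simpl fst; simpl snd. fold r.
    replace (u * r / 2) with (t * r / 2 - PI) by (unfold u; field; lra).
    rewrite cos_minus, sin_minus, cos_PI, sin_PI. simpl. f_equal; field; lra. }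
  assert (Q' : fquat (- u, (- a, - b)) = qneg (fquat (t, (a, b)))).
  { rewrite <- Q. unfold fquat; simpl fst; simpl snd.
    replace ((- a) ^ 2 + (- b) ^ 2) with (a ^ 2 + b ^ 2) by ring. fold r.
    replace (- u * r / 2) with (- (u * r / 2)) by field. rewrite cos_neg, sin_neg.
    f_equal; field; lra. }
  set (f := if Rle_dec 0 u then (u, (a, b)) else (- u, (- a, - b))).
  assert (Ef : fquat f = qneg (fquat (t, (a, b)))) by (unfold f; destruct (Rle_dec 0 u); auto).
  assert (Gf : 0 <= fst f /\ snd f <> (0, 0) /\ fst f = Rabs u /\
    Rabs (fst (snd f)) + 1 * Rabs (snd (snd f)) = Rabs a + 1 * Rabs b).
  { unfold f; destruct (Rle_dec 0 u) as [Z|Z]; simpl.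
    - rewrite (Rabs_right u) by lra. auto.
    - rewrite (Rabs_left u), !Rabs_Ropp by lra. repeat split; auto; [lra|].
      intros E; apply Hab. injection E; intros. f_equal; lra. }
  destruct Gf as (G1 & G2 & G3 & G4).
  assert (L : cost_decomp 1 (p ++ (t, (a, b)) :: s) <= cost_decomp 1 (p ++ f :: s)).
  { apply Ho. apply is_decomp_rotation; auto. split.
    - apply Forall_app; split; auto.
    - apply rotation_qeq. rewrite !dquat_app. right. simpl.
      now rewrite Ef, qmul_neg_l, qmul_neg_r. }
  rewrite !cost_decomp_app in L; simpl in L. rewrite G3, G4 in L.
  assert (0 < Rabs a + 1 * Rabs b) by lra. nra.
Qed.

Lemma build_valid L t1 t2 t3 : unit_cost L -> nonneg t1 t2 t3 ->
  Forall (fun f => 0 <= fst f /\ snd f <> (0, 0)) (build L t1 t2 t3).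
Proof.
  intros H (H1 & H2 & H3). unfold build. apply Forall_map.
  eapply Forall_impl; [|apply H]. intros [k [a b]]; simpl; intros E. split.
  - destruct k as [|[|k]]; simpl; auto.
  - intros Z; injection Z as -> ->. rewrite Rabs_R0 in E; lra.
Qed.

(** The least bound [m] is attained because normal forms are closed. Any competitor has the
    quaternion [q] up to sign, and some normal form of that quaternion costs no more than the
    competitor. *)
Lemma optimal_normal_form X Y g : orthonormal X Y -> in_SO3 g ->
  exists s p t1 t2 t3, In s substs /\ In p shapes /\ snd p t1 t2 t3 /\
    optimal X Y 1 g (subst_decomp (fst s) (snd s) (build (fst p) t1 t2 t3)).
Proof.
  intros H Hg. destruct (exists_decomp X Y g H Hg) as (d0 & Hd0).
  apply is_decomp_rotation in Hd0; auto. destruct Hd0 as [F0 P0].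
  assert (TF : forall d, Forall (fun f : factor => 0 <= fst f /\ snd f <> (0, 0)) d ->
    Forall (fun f => 0 <= fst f) d).
  { intros d; apply Forall_impl; tauto. }
  set (q := dquat d0) in *.
  destruct (closed_has_min (fun c => has_normal_form (q, c))) as (m & Hm & Hmin).
  - exists (cost_decomp 1 d0). apply decomposition_has_normal_form; auto.
  - intros c ([s p] & Hi & t1 & t2 & t3 & HG & _ & Hc).
    apply in_prod_iff in Hi; destruct Hi as [Hs Hp].
    cbn [fst snd] in *. rewrite subst_build, build_cost in Hc
      by (apply subst_unit_cost; [now apply substs_admissible|now apply shapes_unit_cost]).
    unfold shapes in Hp; simpl in Hp.
    repeat (destruct Hp as [<-|Hp]; [unfold dominated, nonneg in HG; simpl in HG, Hc; lra|]). contradiction.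
  - intros c Hc. apply has_normal_form_closed. intros e He.
    destruct (Hc e He) as (c' & Hn & Hc'). exists (q, c'); split; auto. split; simpl; auto.
    rewrite qabs_sub_diag; auto.
  - destruct Hm as ([s p] & Hi & t1 & t2 & t3 & HG & Hq & Hc).
    apply in_prod_iff in Hi; destruct Hi as [Hs Hp]. cbn [fst snd] in *.
    exists s, p, t1, t2, t3. split; [auto|split; [auto|split; [auto|split]]].
    + apply is_decomp_rotation; auto. split.
      * rewrite subst_build. apply build_valid.
        -- apply subst_unit_cost; [now apply substs_admissible|now apply shapes_unit_cost].
        -- unfold shapes in Hp; simpl in Hp.
           repeat (destruct Hp as [<-|Hp]; [unfold dominated, nonneg in HG; simpl in HG; unfold nonneg; tauto|]).
           contradiction.
      * rewrite <- P0. now apply rotation_qeq.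
    + intros d' Hd'. apply is_decomp_rotation in Hd'; auto. destruct Hd' as [F' P'].
      eapply Rle_trans; [apply Hc|]. apply Hmin.
      apply (has_normal_form_mono (dquat d') _ (cost_decomp 1 d'));
        [now apply decomposition_has_normal_form, TF| |apply Rle_refl].
      apply (rotation_injective X Y); [auto|apply dquat_unit|apply dquat_unit|congruence].
Qed.

Theorem theorem1p1 :
  forall (X Y : vec), vnorm X = 1 -> vnorm Y = 1 ->
  (* angle alpha = pi/2 between the unit vectors X and Y *)
  dot X Y = cos (PI / 2) ->
  forall g : mat, in_SO3 g ->
  exists (sX sY : R * R) (t1 t2 t3 : R),
    admissible_subst sX sY /\ 0 <= t1 /\ 0 <= t2 /\ 0 <= t3 /\
    ( (t1 <= t2 /\ t3 <= t2 /\ t2 <= PI /\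
         optimal X Y 1 g (subst_decomp sX sY (nform1 t1 t2 t3)))
   \/ (t1 <= t2 /\ t3 <= t2 /\ t2 <= PI /\
         optimal X Y 1 g (subst_decomp sX sY (nform2 t1 t2 t3)))
   \/ (t1 <= PI /\ t3 <= PI /\ t2 <= sqrt 2 * PI /\
         optimal X Y 1 g (subst_decomp sX sY (nform3 t1 t2 t3)))
   \/ (t1 <= PI /\ t3 <= PI /\ t2 <= sqrt 2 * PI /\
         optimal X Y 1 g (subst_decomp sX sY (nform4 t1 t2 t3))) ).
Proof.
  intros X Y HX HY HXY g Hg.
  assert (N : forall v, vnorm v = 1 -> dot v v = 1).
  { intros v Hv. unfold vnorm in Hv.
    rewrite <- (sqrt_sqrt (dot v v)), Hv; [ring|].
    unfold dot; generalize (Rle_0_sqr (v1 v)) (Rle_0_sqr (v2 v)) (Rle_0_sqr (v3 v)); unfold Rsqr; lra. }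
  assert (H : orthonormal X Y).
  { rewrite cos_PI2 in HXY. repeat split; auto. }
  destruct (optimal_normal_form X Y g H Hg) as ([sX sY] & p & t1 & t2 & t3 & Hs & Hp & HG & Ho).
  assert (Hadm := proj1 (substs_admissible _) Hs). cbn [fst snd] in *.
  (* A substitution only permutes the coefficients and changes signs, so the length of each vector,
     and with it the bound on the angle, carries over. *)
  assert (U : forall i a b, In (i, (a, b)) (fst p) ->
    exists d1 d2 c, subst_decomp sX sY (build (fst p) t1 t2 t3) =
      d1 ++ (time i t1 t2 t3, c) :: d2 /\ fst c ^ 2 + snd c ^ 2 = a ^ 2 + b ^ 2).
  { intros i a b Hin. apply in_split in Hin. destruct Hin as (L1 & L2 & ->).
    unfold build, subst_decomp. rewrite map_app. cbn [map]. rewrite map_app. cbn [map].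
    eexists _, _, _. split; [reflexivity|]. cbn [fst snd].
    destruct Hadm as (e & e' & He & He' & [[-> ->]|[-> ->]]);
    destruct He as [->| ->], He' as [->| ->]; simpl; ring. }
  assert (B : forall i a b, In (i, (a, b)) (fst p) -> time i t1 t2 t3 * sqrt (a ^ 2 + b ^ 2) <= PI).
  { intros i a b Hin. destruct (U i a b Hin) as (d1 & d2 & [a' b'] & E & Ec). rewrite E in Ho.
    cbn [fst snd] in Ec. rewrite <- Ec. eapply optimal_angle_le_PI; eauto. }
  exists sX, sY, t1, t2, t3. split; [auto|].
  assert (S1 : sqrt (1 ^ 2 + 0 ^ 2) = 1) by (replace (1 ^ 2 + 0 ^ 2) with 1 by ring; apply sqrt_1).
  assert (S2 : sqrt (0 ^ 2 + 1 ^ 2) = 1) by (replace (0 ^ 2 + 1 ^ 2) with 1 by ring; apply sqrt_1).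
  (* The vector [(X + Y) / 2] has length [1 / sqrt 2], so an angle of at most [PI] means a time of
     at most [sqrt 2 * PI]. *)
  assert (S3 : t2 * sqrt ((1 / 2) ^ 2 + (1 / 2) ^ 2) <= PI -> t2 <= sqrt 2 * PI).
  { assert (E : sqrt 2 * sqrt ((1 / 2) ^ 2 + (1 / 2) ^ 2) = 1).
    { rewrite <- sqrt_mult by lra. replace (2 * ((1 / 2) ^ 2 + (1 / 2) ^ 2)) with 1 by field. apply sqrt_1. }
    intros K. apply (Rmult_le_compat_l (sqrt 2)) in K; [|apply sqrt_pos].
    replace (sqrt 2 * (t2 * sqrt ((1 / 2) ^ 2 + (1 / 2) ^ 2)))
      with (t2 * (sqrt 2 * sqrt ((1 / 2) ^ 2 + (1 / 2) ^ 2))) in K by ring.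
    rewrite E in K. lra. }
  unfold shapes in Hp; simpl in Hp.
  destruct Hp as [<-|[<-|[<-|[<-|[]]]]]; cbn [fst snd] in *.
  - destruct HG as (?&?&?&?&?&?). repeat (split; [assumption|]). left. repeat (split; [assumption|]). exact Ho.
  - destruct HG as (?&?&?&?&?&?). repeat (split; [assumption|]).
    right; left. repeat (split; [assumption|]). exact Ho.
  - destruct HG as (?&?&?). repeat (split; [assumption|]). right; right; left.
    assert (B1 := B 0%nat 1 0 ltac:(simpl; auto)). assert (B2 := B 1%nat (1/2) (1/2) ltac:(simpl; auto)).
    assert (B3 := B 2%nat 1 0 ltac:(simpl; auto)). simpl time in *. rewrite S1 in *.
    split; [lra|split; [lra|split; [auto|exact Ho]]].
  - destruct HG as (?&?&?). repeat (split; [assumption|]). right; right; right.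
    assert (B1 := B 0%nat 1 0 ltac:(simpl; auto)). assert (B2 := B 1%nat (1/2) (1/2) ltac:(simpl; auto)).
    assert (B3 := B 2%nat 0 1 ltac:(simpl; auto)). simpl time in *. rewrite S1, S2 in *.
    split; [lra|split; [lra|split; [auto|exact Ho]]].
Qed.
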